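(* Let $\alpha\in(0,1)$ and $0<t<1$. Assume that $f(t,Q_\alpha(t))>0$, $nb_n/\log^2n\to\infty$ and $b_n\to0$. Then under conditions (A1), (B1), (B2), (B3) (stated in the context), $$\sup_{s\in B_n(t)}\left|f(s,Q_\alpha(s))\,\mu_{\mathbf{K}}\,\hat\theta_{\alpha,n}(s)-\frac{S_{\alpha,n}(s)}{nb_n}\right|=O_{\mathbb{P}}\left(\frac{\varrho_n^{1/2}\log n}{\sqrt{nb_n}}+b_n\varrho_n+\varrho_n^2\right),$$ where $B_n(t)=[t-b_n,t+b_n]\cap[0,1]$ and $\varrho_n=(nb_n)^{-1/2}\log n+b_n^2$.
   Context: Model: $(\varepsilon_j)_{j\in\mathbb{Z}}$ are i.i.d. random variables, $\Upsilon_i=(\ldots,\varepsilon_{i-1},\varepsilon_i)$, and $G:[0,1]\times\mathbb{R}^\infty\to\mathbb{R}$ is measurable with $\zeta_i(t)=G(t,\Upsilon_i)$ a well-defined random variable for every $t\in[0,1]$. The observations are $X_i=X_{i,n}=G(i/n,\Upsilon_i)$, $1\le i\le n$. $F(t,x)=\mathbb{P}(\zeta_i(t)\le x)$, $f(t,\cdot)$ is the density of $\zeta_i(t)$, and $Q_\alpha(t)=\inf\{x:F(t,x)\ge\alpha\}$. $\|V\|=(\mathbb{E}|V|^2)^{1/2}$; $|\cdot|$ is the Euclidean norm on vectors. $F(t,x,\Upsilon_i)=\mathbb{P}(G(t,\Upsilon_{i+1})\le x\mid\Upsilon_i)$ and $F_k(t,x,\Upsilon_i)=\partial^kF(t,x,\Upsilon_i)/\partial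 x^k$, $F_0=F$. Stability: let $\varepsilon_0'$ be such that $\varepsilon_0',\varepsilon_j$, $j\in\mathbb{Z}$, are i.i.d., and for $k\ge0$ let $\Upsilon_k^*=(\Upsilon_{-1},\varepsilon_0',\varepsilon_1,\ldots,\varepsilon_k)$. For a family $H(t,x,\Upsilon_i)\in\mathcal{L}^2$, put $\delta_H(k)=\sup_{(t,x)\in[0,1]\times\mathbb{R}}\|H(t,x,\Upsilon_k)-H(t,x,\Upsilon_k^* )\|$; $\{H(\cdot,\cdot,\Upsilon_i)\}_{i\in\mathbb{Z}}$ is stable if $\sum_{k=0}^\infty\delta_H(k)<\infty$. Conditions: (A1) for every $\alpha\in(0,1)$, $Q_\alpha(\cdot)$ is twice continuously differentiable on $[0,1]$. (B1) for $k=0,1,2,3$, $F_k(t,x,\Upsilon_i)$ exists and the family $\{F_k(\cdot,\cdot,\Upsilon_i)\}_{i\in\mathbb{Z}}$ is stable. (B2) there exists $C_0<\infty$ such that $\sup_{(t,x)\in[0,1]\times\mathbb{R}}F_1(t,x,\Upsilon_i)<C_0$ almost surely. (B3) $f(t,x)$ is Lipschitz continuous on $[0,1]\times\mathbb{R}$. Estimator: $K$ is a symmetric probability density with support $[-1,1]$ and $K\in\mathcal{C}^1[-1,1]$; $b_n>0$ is the bandwidth; $K_{b_n}(\cdot)=K(\cdot/b_n)$; $\mu_2=\int_{-1}^1u^2K(u)\,du$; $\mu_{\mathbf{K}}=\mathrm{diag}(1,\mu_2)$. With $\rho_\alpha(x)=\alpha x^++(1-\alpha)(-x)^+$, $x^+=\max(x,0)$,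 $$(\hat Q_\alpha(t),\hat Q'_\alpha(t))=\arg\min_{(\beta_0,\beta_1)}\sum_{i=1}^n\rho_\alpha(X_i-\beta_0-\beta_1(i/n-t))K_{b_n}(i/n-t),$$ and $\hat\theta_{\alpha,n}(t)=(\hat Q_\alpha(t)-Q_\alpha(t),\ b_n(\hat Q'_\alpha(t)-Q'_\alpha(t)))^\top$. With $\psi_\alpha(x)=\alpha-I\{x\le0\}$ and $\mathbf{z}_{i,n}(t)=(1,(i/n-t)/b_n)^\top$, $$S_{\alpha,n}(t)=\sum_{i=1}^n\psi_\alpha(X_i-Q_\alpha(t)-(i/n-t)Q'_\alpha(t))K_{b_n}(i/n-t)\mathbf{z}_{i,n}(t).$$ *)

(* Defs.v *)
From mathcomp Require Import all_boot all_order all_algebra.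
From mathcomp Require Import all_classical all_reals all_analysis.

Set Implicit Arguments.
Unset Strict Implicit.
Unset Printing Implicit Defensive.

Import Order.TTheory GRing.Theory Num.Theory.
Import numFieldNormedType.Exports.

Local Open Scope classical_set_scope.
Local Open Scope ring_scope.

Section Calculus.
Context {R : realType}.
Implicit Types (A : set R) (f : R -> R) (t : R).

(* Differentiation relative to A: at an endpoint of a segment A these are the
   one-sided notions, so C1_on and C2_on really speak of closed segments. *)
Definition diff_quot_in A f t : set_system R :=
  (fun s => (f s - f t) / (s - t)) @ within A t^'.

Definition derivable_in A f t : Prop := cvg (diff_quot_in A f t).

Definition derive_in A f t : R := lim (diff_quot_in A f t).

Definition C1_on A f : Prop :=
  (forall t, A t -> derivable_in A f t) /\
  {within A, continuous (derive_in A f)}.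

Definition C2_on A f : Prop :=
  (forall t, A t -> derivable_in A f t) /\ C1_on A (derive_in A f).

Definition derivable_n (k : nat) f (x : R) : Prop :=
  forall j, (j < k)%N -> derivable (derive1n j f) x 1.

End Calculus.

Section Probability.
Context {R : realType} {d : measure_display} {T : measurableType d}.
Variable P : probability T R.

Definition mutually_independent (I : eqType) (X : I -> {RV P >-> R}) : Prop :=
  forall (J : seq I) (B : I -> set R), uniq J -> (forall j, measurable (B j)) ->
    P (\bigcap_(j in [set` J]) (X j @^-1` B j)) =
      (\prod_(j <- J) P (X j @^-1` B j))%E.

Definition identically_distributed (I : Type) (X : I -> {RV P >-> R}) : Prop :=
  forall i j (B : set R), measurable B -> P (X i @^-1` B) = P (X j @^-1` B).

Definition iid (I : eqType) (X : I -> {RV P >-> R}) : Prop :=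
  mutually_independent X /\ identically_distributed X.

(* g \o Y is a version of the conditional probability of E given Y. *)
Definition is_cond_prob d' (T' : measurableType d') (E : set T) (Y : T -> T')
    (g : T' -> R) : Prop :=
  measurable_fun setT g /\
  forall B : set T', measurable B ->
    P (E `&` Y @^-1` B) = (\int[P]_(w in Y @^-1` B) (g (Y w))%:E)%E.

(* V_n = O_P(r_n). The outer probability P^* is used because the V_n below are
   uncountable suprema involving an arbitrary choice of minimizers, so that
   their measurability is not granted. *)
Definition bigO_P (V : nat -> T -> \bar R) (r : nat -> R) : Prop :=
  forall e : R, 0 < e -> exists M : R, 0 < M /\
    \forall n \near \oo,
      (mu_ext P [set w | (M * r n)%:E < `|V n w|] <= e%:E)%E.

End Probability.

(* The sigma-algebra on sequences generated by the coordinates. *)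
Definition cylinders (R : realType) : set (set (nat -> R)) :=
  [set C | exists (k : nat) (B : set R),
     measurable B /\ C = [set u : nat -> R | B (u k)]].

(* R^oo. A left-infinite sequence (..., e_{i-1}, e_i) is stored with the most
   recent entry first: the entry of index k is e_{i-k}. *)
Definition history (R : realType) := g_sigma_algebraType (@cylinders R).

Section Model.
Context {R : realType} {d : measure_display} {T : measurableType d}.
Variable P : probability T R.
Variables (eps : int -> {RV P >-> R}) (eps' : {RV P >-> R}).

Definition innovations (o : option int) : {RV P >-> R} :=
  if o is Some j then eps j else eps'.

Definition past (i : int) (w : T) : history R := fun k : nat => eps (i - k%:Z) w.

(* (..., e_{-2}, e_{-1}, e'_0, e_1, ..., e_k) *)
Definition coupled_past (k : nat) (w : T) : history R :=
  fun j : nat => if j == k then eps' w else eps (k%:Z - j%:Z) w.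

Definition unit_strip : set (R * R) := `[0, 1] `*` [set: R].

Section Stability.
Variable H : R -> R -> history R -> R.

Definition delta (k : nat) : \bar R :=
  ereal_sup
    [set Lnorm P 2%:E (fun w =>
       (H z.1 z.2 (past k%:Z w) - H z.1 z.2 (coupled_past k w))%:E)
    | z in unit_strip].

Definition stable : Prop :=
  (forall (i : int) (t x : R), 0 <= t <= 1 ->
     (fun w => H t x (past i w)) \in Lfun P 2%:E) /\
  (\sum_(0 <= k <oo) delta k < +oo)%E.

End Stability.

Variable G : R -> history R -> R.

Definition zeta (i : int) (t : R) (w : T) : R := G t (past i w).

(* The law of zeta_i(t) does not depend on i. *)
Definition mcdf (t x : R) : R := fine (P [set w | zeta 0 t w <= x]).

Definition quantile (alpha t : R) : R := inf [set x | alpha <= mcdf t x].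

Definition is_density (f : R -> R -> R) : Prop :=
  forall t : R, 0 <= t <= 1 ->
    [/\ measurable_fun setT (f t), forall x, 0 <= f t x &
        forall (i : int) (B : set R), measurable B ->
          P (zeta i t @^-1` B) = (\int[lebesgue_measure]_(x in B) (f t x)%:E)%E].

(* Fc t x u stands for F(t, x, u), u in R^oo: one fixed choice, for all i, of the
   versions of the conditional probabilities. *)
Definition is_cond_cdf (Fc : R -> R -> history R -> R) : Prop :=
  forall (i : int) (t x : R), 0 <= t <= 1 ->
    is_cond_prob P [set w | zeta (i + 1) t w <= x] (past i) (Fc t x).

Definition measurable_model : Prop :=
  measurable_fun ((`[0, 1]%classic : set R) `*` [set: history R]) (fun z : R * history R => G z.1 z.2).

Definition condA1 : Prop :=
  forall alpha : R, 0 < alpha < 1 -> C2_on `[0, 1] (quantile alpha).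

Definition dFc (Fc : R -> R -> history R -> R) (k : nat) (t x : R)
  (u : history R) : R := derive1n k (fun y => Fc t y u) x.

(* For fixed t, the derivatives are required to exist at all x, for almost every
   u with respect to the law of (..., e_{i-1}, e_i). *)
Definition condB1 (Fc : R -> R -> history R -> R) : Prop :=
  forall k, (k <= 3)%N ->
    (forall (i : int) (t : R), 0 <= t <= 1 ->
       {ae pushforward P (past i), forall u : history R,
          forall x, derivable_n k (fun y => Fc t y u) x}) /\
    stable (dFc Fc k).

Definition condB2 (Fc : R -> R -> history R -> R) : Prop :=
  exists C0 : R, forall i : int,
    {ae P, forall w : T,
       (ereal_sup [set (dFc Fc 1 z.1 z.2 (past i w))%:E
                  | z in unit_strip] < C0%:E)%E}.

Definition condB3 (f : R -> R -> R) : Prop :=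
  [lipschitz (f z.1 z.2 : R^o) | z in (unit_strip : set (R^o * R^o))].

End Model.

Section Estimator.
Context {R : realType}.
Implicit Types (K : R -> R) (b : nat -> R) (alpha : R).

Definition is_kernel K : Prop :=
  [/\ forall u, 0 <= K u,
      (\int[lebesgue_measure]_u (K u)%:E)%E = 1%E,
      forall u, K (- u) = K u,
      closure [set u | K u != 0] = `[-1, 1]%classic &
      C1_on `[-1, 1] K].

Definition mu2 K : R := \int[lebesgue_measure]_(u in `[-1, 1]) (u ^+ 2 * K u).

Definition muK K : 'M[R]_2 :=
  diag_mx (\row_(j < 2) (if j == 0 then 1 else mu2 K)).

Definition vec2 (x y : R) : 'cV[R]_2 := \col_(j < 2) (if j == 0 then x else y).

Definition enorm (v : 'cV[R]_2) : R := Num.sqrt (\sum_(j < 2) v j 0 ^+ 2).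

Definition check_loss alpha (x : R) : R :=
  alpha * Num.max x 0 + (1 - alpha) * Num.max (- x) 0.

Definition psi alpha (x : R) : R := alpha - (x <= 0)%R%:R.

Definition design (n i : nat) : R := i%:R / n%:R.

(* x i stands for the i-th of the n observations, 1 <= i <= n. *)
Definition objective K b alpha (n : nat) (x : nat -> R) (t beta0 beta1 : R) : R :=
  \sum_(1 <= i < n.+1)
    check_loss alpha (x i - beta0 - beta1 * (design n i - t)) *
    K ((design n i - t) / b n).

Definition is_argmin K b alpha n x t (beta0 beta1 : R) : Prop :=
  forall c0 c1, objective K b alpha n x t beta0 beta1 <=
                objective K b alpha n x t c0 c1.

(* q and dq stand for the functions Q_alpha and Q_alpha'. *)
Definition score K b alpha (n : nat) (x : nat -> R) (q dq : R -> R) (t : R) :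
    'cV[R]_2 :=
  \sum_(1 <= i < n.+1)
    (psi alpha (x i - q t - (design n i - t) * dq t) *
     K ((design n i - t) / b n)) *:
    vec2 1 ((design n i - t) / b n).

Definition window b (n : nat) (t : R) : set R :=
  `[t - b n, t + b n] `&` `[0, 1].

Definition rho b (n : nat) : R :=
  ln n%:R / Num.sqrt (n%:R * b n) + b n ^+ 2.

Definition rate b (n : nat) : R :=
  Num.sqrt (rho b n) * ln n%:R / Num.sqrt (n%:R * b n)
  + b n * rho b n + rho b n ^+ 2.

End Estimator.

Section Remainder.
Context {R : realType} {d : measure_display} {T : measurableType d}.
Variables (P : probability T R) (eps : int -> {RV P >-> R}).
Variable G : R -> history R -> R.

Definition obs (n : nat) (w : T) (i : nat) : R :=
  zeta eps G i%:Z (design n i) w.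

Definition dquantile (alpha : R) : R -> R :=
  derive_in `[0, 1] (quantile eps G alpha).

(* Qhat n t w and dQhat n t w are the two components of the estimator. *)
Definition theta_hat (b : nat -> R) (alpha : R) (Qhat dQhat : nat -> R -> T -> R)
    (n : nat) (t : R) (w : T) : 'cV[R]_2 :=
  vec2 (Qhat n t w - quantile eps G alpha t)
       (b n * (dQhat n t w - dquantile alpha t)).

Definition bahadur_remainder (f : R -> R -> R) (K : R -> R) (b : nat -> R)
    (alpha : R) (Qhat dQhat : nat -> R -> T -> R) (n : nat) (s : R) (w : T) :
    'cV[R]_2 :=
  f s (quantile eps G alpha s) *: (muK K *m theta_hat b alpha Qhat dQhat n s w)
  - (n%:R * b n)^-1 *:
    score K b alpha n (obs n w) (quantile eps G alpha) (dquantile alpha) s.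

End Remainder.

(* Main.v *)
From HB Require Import structures.
Require Import Defs.
From mathcomp Require Import all_boot all_order all_algebra.
From mathcomp Require Import all_classical all_reals all_analysis.
From mathcomp Require Import measurable_realfun.
From mathcomp Require Import zify ring lra.
Import Order.TTheory GRing.Theory Num.Theory.
Import numFieldNormedType.Exports.
Set Implicit Arguments.
Unset Strict Implicit.
Unset Printing Implicit Defensive.
Local Open Scope classical_set_scope.
Local Open Scope ring_scope.

(** The estimator at s minimizes a convex criterion whose negative subgradient at
    a perturbation (u, v) of the true line, v being on the scale of the bandwidth,
    is the score S(u, v).  If S(u, v) is, uniformly for (u, v) in a ball of radius
    of order rho, equal to S(0, 0) - n b f (u, mu2 v) up to an error of order
    n b rate, then convexity alone forces the minimizer into a ball of radius of
    order rate around the zero of this affine map, which is exactly the asserted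
    representation (lemma minimizer_near_zero).  The work is to linearize the
    score, uniformly in s and in (u, v) (lemmas score_size and score_increment).

    The score is a kernel-weighted sum of indicators that an observation lies
    below a line.  All the lines that occur, for all s in the window, lie within
    O(rho) of the tangent to the quantile curve at t, so that they form a
    two-parameter family.  Summation by parts removes the kernels, whose variation
    over the design is bounded, and leaves partial sums of centred indicators
    over initial segments of the window.  These are compared with the centring
    obtained from the distribution functions, which is expanded with the density.

    Two bounds on partial sums are needed: O(sqrt(n b) log n) for the indicators
    along the tangent itself (lemma base_deviation_tail), and O(n b rate) for the
    increments between the tangent and a line at distance O(rho), uniformly over
    such lines (lemma uniform_line_deviation_tail).  Both come from lemma
    partial_sums_tail.  An indicator minus its probability is the sum of
    an innovation, namely the indicator minus its conditional probability given
    the past, and of a centred prediction.  The innovations are martingale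
    differences, and an exponential inequality bounds each of their partial sums.
    The predictions are smooth functions of stationary pasts.  Their
    partial sums have a variance proportional to the length, by the Efron-Stein
    inequality and the summability of the coupling coefficients; the
    Rademacher-Menshov argument extends this bound to all initial segments.  The
    prediction of a thin strip of height y - x moves under coupling by at most
    (y - x) times the coefficient of the conditional density (lemma
    slab_predictor_stable), which is why the increments are small.  Uniformity over
    lines follows from a grid of mesh rate: indicators and distribution functions
    are monotone in the line, and there are at most O(sqrt(n b)) grid points, few
    enough for both tail bounds because rho^2 r <= rate^2, where
    r = log n / sqrt(n b). *)

(** * Bounded measurable functions *)

Lemma measurable_le_set (R : realType) d (T : measurableType d) (f g : T -> R) :
  measurable_fun setT f -> measurable_fun setT g -> measurable [set x | f x <= g x].
Proof. by move=> mf mg; rewrite -[X in measurable X]setTI; exact: measurable_fun_le. Qed.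

Lemma measurable_lt_set (R : realType) d (T : measurableType d) (f g : T -> R) :
  measurable_fun setT f -> measurable_fun setT g -> measurable [set x | f x < g x].
Proof.
move=> mf mg; rewrite (_ : [set x | _] = ~` [set x | g x <= f x]).
  by apply: measurableC; exact: measurable_le_set.
apply/seteqP; split => x /=; first by rewrite ltNge => /negP.
by move=> /negP; rewrite -ltNge.
Qed.

(** A class of integrands with finite expectations that is stable under the
    algebraic operations and under composition with measurable maps. *)
Definition bounded_measurable (R : realType) d (T : measurableType d) (f : T -> R) :=
  measurable_fun setT f /\ exists M : R, forall x, `|f x| <= M.

Section BoundedMeasurable.
Context (R : realType) d (T : measurableType d).
Implicit Types f g : T -> R.

Lemma bounded_measurable_cst (c : R) : bounded_measurable (fun _ : T => c).
Proof. by split; [exact: measurable_cst | exists `|c|]. Qed.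

Lemma bounded_measurableD f g : bounded_measurable f -> bounded_measurable g ->
  bounded_measurable (fun x => f x + g x).
Proof.
move=> [mf [M fM]] [mg [N gN]]; split; first exact: measurable_funD.
by exists (M + N) => x; rewrite (le_trans (ler_normD _ _))// lerD.
Qed.

Lemma bounded_measurableM f g : bounded_measurable f -> bounded_measurable g ->
  bounded_measurable (fun x => f x * g x).
Proof.
move=> [mf [M fM]] [mg [N gN]]; split; first exact: measurable_funM.
by exists (M * N) => x; rewrite normrM ler_pM.
Qed.

Lemma bounded_measurableZ c f : bounded_measurable f ->
  bounded_measurable (fun x => c * f x).
Proof. exact: bounded_measurableM (bounded_measurable_cst c). Qed.

Lemma bounded_measurableB f g : bounded_measurable f -> bounded_measurable g ->
  bounded_measurable (fun x => f x - g x).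
Proof.
move=> bf bg; rewrite (_ : (fun _ => _) = (fun x => f x + (-1) * g x)).
  exact/bounded_measurableD/bounded_measurableZ.
by apply/funext => x; rewrite mulN1r.
Qed.

Lemma bounded_measurableX f n : bounded_measurable f ->
  bounded_measurable (fun x => f x ^+ n).
Proof.
move=> bf; elim: n => [|n IH].
  by rewrite (_ : (fun _ => _) = fun=> 1)//; exact: bounded_measurable_cst.
rewrite (_ : (fun _ => _) = (fun x => f x * f x ^+ n)).
  exact: bounded_measurableM.
by apply/funext => x; rewrite exprS.
Qed.

Lemma bounded_measurable_sum (I : Type) (s : seq I) (Q : pred I) (F : I -> T -> R) :
  (forall i, Q i -> bounded_measurable (F i)) ->
  bounded_measurable (fun x => \sum_(i <- s | Q i) F i x).
Proof.
move=> bF; elim: s => [|i s IH].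
  rewrite (_ : (fun _ => _) = fun=> 0); first exact: bounded_measurable_cst.
  by apply/funext => x; rewrite big_nil.
case Qi : (Q i).
  rewrite (_ : (fun _ => _) = (fun x => F i x + \sum_(i <- s | Q i) F i x)).
    by apply: bounded_measurableD => //; exact: bF.
  by apply/funext => x; rewrite big_cons Qi.
by rewrite (_ : (fun _ => _) = (fun x => \sum_(i <- s | Q i) F i x))//;
  apply/funext => x; rewrite big_cons Qi.
Qed.

Lemma bounded_measurable_indic (A : set T) : measurable A ->
  bounded_measurable (\1_A : T -> R).
Proof.
move=> mA; split; first exact: measurable_indic.
by exists 1 => x; rewrite indicE; case: (x \in A); rewrite ?normr1 ?normr0.
Qed.

Lemma indic_bool (b : T -> bool) x : \1_[set x | b x] x = (b x)%:R :> R.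
Proof.
rewrite indicE; have [bx|/negP bx] := boolP (b x); first by rewrite mem_set.
by rewrite memNset.
Qed.

Lemma bounded_measurable_comp d' (T' : measurableType d') (h : T' -> T) f :
  measurable_fun setT h -> bounded_measurable f ->
  bounded_measurable (fun x => f (h x)).
Proof.
move=> mh [mf [M fM]]; split; last by exists M.
exact: measurableT_comp.
Qed.

Lemma bounded_measurable_expR f : bounded_measurable f ->
  bounded_measurable (fun x => expR (f x)).
Proof.
move=> [mf [M fM]]; split.
  by apply: measurableT_comp => //; exact: measurable_expR.
exists (expR M) => x; rewrite ger0_norm ?expR_ge0// ler_expR.
exact: le_trans (ler_norm _) (fM x).
Qed.

End BoundedMeasurable.

Section Expectation.
Context (R : realType) d (T : measurableType d) (P : probability T R).
Implicit Types f g : T -> R.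

Definition Ex f : R := \int[P]_w f w.

Lemma bounded_measurable_integrable f : bounded_measurable f ->
  P.-integrable setT (EFin \o f).
Proof.
move=> [mf [M fM]]; apply: measurable_bounded_integrable => //.
  by rewrite (le_lt_trans (probability_le1 _ _))// ltry.
exists `|M|; split; first by rewrite num_real.
move=> x Mx y _ /=; apply: le_trans (fM y) _.
exact: le_trans (ler_norm _) (ltW Mx).
Qed.
Local Notation bint := bounded_measurable_integrable.

Lemma ExD f g : bounded_measurable f -> bounded_measurable g ->
  Ex (fun x => f x + g x) = Ex f + Ex g.
Proof. by move=> bf bg; rewrite /Ex RintegralD//; exact: bint. Qed.

Lemma ExB f g : bounded_measurable f -> bounded_measurable g ->
  Ex (fun x => f x - g x) = Ex f - Ex g.
Proof. by move=> bf bg; rewrite /Ex RintegralB//; exact: bint. Qed.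

Lemma ExZ c f : bounded_measurable f -> Ex (fun x => c * f x) = c * Ex f.
Proof. by move=> bf; rewrite /Ex RintegralZl//; exact: bint. Qed.

Lemma Ex_cst c : Ex (fun _ => c) = c.
Proof. by rewrite /Ex Rintegral_cst// [X in fine X]probability_setT mulr1. Qed.

Lemma le_Ex f g : bounded_measurable f -> bounded_measurable g ->
  (forall x, f x <= g x) -> Ex f <= Ex g.
Proof. by move=> bf bg fg; apply: le_Rintegral => //; exact: bint. Qed.

Lemma Ex_ge0 f : (forall x, 0 <= f x) -> 0 <= Ex f.
Proof. by move=> f0; apply: Rintegral_ge0. Qed.

Lemma Ex_indic A : measurable A -> Ex \1_A = fine (P A).
Proof. by move=> mA; rewrite /Ex /Rintegral integral_indic// setIT. Qed.

Lemma Ex_norm_le f (M : R) : bounded_measurable f -> (forall x, `|f x| <= M) ->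
  `|Ex f| <= M.
Proof.
move=> bf fM; have bM : bounded_measurable (fun _ : T => M) by exact: bounded_measurable_cst.
have bN := bounded_measurableZ (-1) bM.
have h1 : Ex (fun=> -1 * M) <= Ex f.
  by apply: le_Ex => // x; have := fM x; rewrite ler_norml mulN1r => /andP[].
have h2 : Ex f <= Ex (fun=> M).
  by apply: le_Ex => // x; have := fM x; rewrite ler_norml => /andP[].
by rewrite ler_norml -{2}[M]Ex_cst h2 andbT -[leLHS]Ex_cst -mulN1r.
Qed.

Lemma Ex_sum (I : Type) (s : seq I) (F : I -> T -> R) :
  (forall i, bounded_measurable (F i)) ->
  Ex (fun x => \sum_(i <- s) F i x) = \sum_(i <- s) Ex (F i).
Proof.
move=> bF; elim: s => [|i s IH].
  rewrite big_nil -[RHS]Ex_cst; congr Ex.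
  by apply/funext => x; rewrite big_nil.
rewrite big_cons -IH -ExD//; last exact: bounded_measurable_sum.
by congr Ex; apply/funext => x; rewrite big_cons.
Qed.

Lemma markov_Ex f (c : R) : 0 < c -> bounded_measurable f ->
  (forall x, 0 <= f x) -> (P [set x | (c <= f x)%R] <= (Ex f / c)%:E)%E.
Proof.
move=> c0 bf f0.
have mA : measurable [set x | c <= f x].
  by apply: measurable_le_set => //; exact: bf.1.
rewrite -[leLHS]fineK ?fin_num_measure// lee_fin -Ex_indic//.
rewrite ler_pdivlMr// mulrC -ExZ; last exact: bounded_measurable_indic.
apply: le_Ex => //.
  by apply: bounded_measurableZ; exact: bounded_measurable_indic.
move=> x; rewrite indicE; have [/set_mem|] := boolP (x \in _).
  by rewrite mulr1.
by rewrite mulr0.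
Qed.

(** The Cauchy-Schwarz inequality, from the weighted inequality of Young. *)
Lemma Ex_mul_le f g (a c : R) : bounded_measurable f -> bounded_measurable g ->
  0 < a -> 0 < c -> Ex (fun x => f x ^+ 2) <= a ^+ 2 ->
  Ex (fun x => g x ^+ 2) <= c ^+ 2 -> Ex (fun x => f x * g x) <= a * c.
Proof.
move=> bf bg a0 c0 fa gc.
have H : Ex (fun x => f x * g x) <=
    Ex (fun x => (2 * a)^-1 * c * f x ^+ 2 + (2 * c)^-1 * a * g x ^+ 2).
  apply: le_Ex => [||x]; first exact: bounded_measurableM.
    by apply: bounded_measurableD; apply: bounded_measurableZ;
      exact: bounded_measurableX.
  rewrite -subr_ge0.
  have -> : (2 * a)^-1 * c * f x ^+ 2 + (2 * c)^-1 * a * g x ^+ 2 - f x * g x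
    = (2 * a * c)^-1 * (c * f x - a * g x) ^+ 2.
    by field; rewrite !gt_eqF.
  by rewrite mulr_ge0 ?sqr_ge0// invr_ge0 !mulr_ge0// ltW.
apply: le_trans H _.
rewrite ExD; [|by apply: bounded_measurableZ; exact: bounded_measurableX..].
rewrite !ExZ; [|exact: bounded_measurableX..].
have ha : (2 * a)^-1 * c * Ex (fun x => f x ^+ 2) <= (2 * a)^-1 * c * a ^+ 2.
  by rewrite ler_wpM2l// mulr_ge0 ?(ltW c0)// invr_ge0 mulr_ge0// ltW.
have hc : (2 * c)^-1 * a * Ex (fun x => g x ^+ 2) <= (2 * c)^-1 * a * c ^+ 2.
  by rewrite ler_wpM2l// mulr_ge0 ?(ltW a0)// invr_ge0 mulr_ge0// ltW.
apply: le_trans (lerD ha hc) _.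
rewrite le_eqVlt; apply/orP; left; apply/eqP; field; rewrite !gt_eqF//.
Qed.

End Expectation.

(** * Extension from indicators to bounded functions *)

(** The sum counts the integer part of y. *)
Lemma sum_indicators_floor (R : realType) (N : nat) (y : R) : 0 <= y ->
  y <= N%:R -> `|y - \sum_(j < N) (j.+1%:R <= y)%R%:R| <= 1.
Proof.
move=> y0.
have full n : n%:R <= y -> \sum_(j < n) (j.+1%:R <= y)%R%:R = n%:R :> R.
  move=> ny; rewrite (eq_bigr (fun=> 1)) => [|j _].
    by rewrite big_const_ord iter_addr_0.
  by rewrite (le_trans _ ny)// ler_nat.
elim: N => [yN|N IH yN].
  have -> : y = 0 by apply/eqP; rewrite eq_le yN.
  by rewrite big_ord0 subr0 normr0.
have [yN'|Ny] := leP y N%:R.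
  rewrite big_ord_recr/= [_ <= y]lt_geF ?addr0; first exact: IH.
  by rewrite (le_lt_trans yN')// ltr_nat.
rewrite big_ord_recr/= full; last exact: ltW.
rewrite ler_norml; have [h|h] := leP N.+1%:R y.
  by rewrite -natrD addn1; apply/andP; split; lra.
by rewrite addr0; apply/andP; split; move: yN; rewrite -natr1; lra.
Qed.

Section Approximation.
Context (R : realType) d (T : measurableType d).

(** Bounded functions are uniform limits of linear combinations of indicators of
    their superlevel sets, so that a limit which is known on indicators extends
    to them by linearity and uniform continuity. *)
Lemma bounded_measurable_limit (L : nat -> (T -> R) -> R) (C : R) :
  (forall n f g, bounded_measurable f -> bounded_measurable g ->
     L n (fun x => f x + g x) = L n f + L n g) ->
  (forall n c f, bounded_measurable f -> L n (fun x => c * f x) = c * L n f) ->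
  (forall n f (M : R), bounded_measurable f -> (forall x, `|f x| <= M) ->
     `|L n f| <= C * M) ->
  (forall A, measurable A -> L n \1_A @[n --> \oo] --> 0) ->
  forall f, bounded_measurable f -> L n f @[n --> \oo] --> 0.
Proof.
move=> LD LZ LM L0 f bf; have [mf [M fM]] := bf.
have [x0|noT] := pselect (exists x : T, True); last first.
  have -> : f = \1_set0.
    by apply/funext => x; exfalso; apply: noT; exists x.
  exact: L0.
have M0 : 0 <= M by case: x0 => x _; exact: le_trans (fM x).
have C0 : 0 <= C.
  have := LM 0%N (fun=> 1) 1 (bounded_measurable_cst _ _).
  rewrite normr1 mulr1 => /(_ (fun=> lexx _)); exact: le_trans.
apply/cvgrPdist_le => e e0.
(* with N superlevel sets the error of approximation h satisfies C h <= e / 2 *)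
have [N NP] : exists N : nat, C * (2 * (M + 1)) / (e / 2) + 1 <= N%:R.
  have := archi_boundP (_ : 0 <= C * (2 * (M + 1)) / (e / 2) + 1).
  set k := Num.bound _ => h; exists k; apply/ltW/h.
  by rewrite addr_ge0// divr_ge0 ?divr_ge0 ?(ltW e0)// !mulr_ge0// addr_ge0.
have N0 : 0 < N%:R :> R.
  apply: lt_le_trans NP; apply: ltr_wpDl => //.
  by rewrite divr_ge0 ?divr_ge0 ?(ltW e0)// !mulr_ge0// addr_ge0.
pose h := 2 * (M + 1) / N%:R.
have h0 : 0 < h by rewrite divr_gt0// mulr_gt0// ltr_wpDl.
pose A j := [set x | j.+1%:R * h <= f x + (M + 1)].
have mA j : measurable (A j).
  apply: measurable_le_set => //.
  by apply: measurable_funD.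
pose s x := \sum_(j < N) h * \1_(A j) x + (- (M + 1)) * \1_setT x.
have bA j : bounded_measurable (\1_(A j) : T -> R).
  exact: bounded_measurable_indic.
have bT : bounded_measurable (\1_(@setT T) : T -> R).
  exact: bounded_measurable_indic.
have bs1 n : bounded_measurable (fun x => \sum_(j < n) h * \1_(A j) x).
  by apply: bounded_measurable_sum => j _; exact: bounded_measurableZ.
have bs : bounded_measurable s.
  by apply: bounded_measurableD => //; exact: bounded_measurableZ.
have fs x : `|f x - s x| <= h.
  pose y := (f x + (M + 1)) / h.
  have fx := fM x; rewrite ler_norml in fx; case/andP: fx => fx1 fx2.
  have y0 : 0 <= y by rewrite divr_ge0 ?(ltW h0)//; lra.
  have yN : y <= N%:R.
    rewrite ler_pdivrMr// /h mulrCA divff ?gt_eqF// mulr1; lra.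
  have := sum_indicators_floor y0 yN.
  have -> : f x - s x = h * (y - \sum_(j < N) (j.+1%:R <= y)%R%:R).
    have -> : s x = h * \sum_(j < N) (j.+1%:R <= y)%R%:R - (M + 1).
      rewrite /s indicT mulr1 mulr_sumr; congr (_ - _).
      apply: eq_bigr => j _; congr (_ * _).
      by rewrite /A (indic_bool _ (fun x => j.+1%:R * h <= f x + (M + 1))) ler_pdivlMr.
    by rewrite mulrBr /y mulrCA divff ?gt_eqF//; ring.
  by rewrite normrM gtr0_norm// => ?; rewrite -{2}[h]mulr1 ler_wpM2l// ltW.
have Ls1 n k : L n (fun x => \sum_(j < k) h * \1_(A j) x) =
    \sum_(j < k) h * L n \1_(A j).
  elim: k => [|k IH].
    rewrite big_ord0 -[RHS](mul0r (L n \1_setT)) -LZ//; congr L.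
    by apply/funext => x; rewrite big_ord0 mul0r.
  rewrite big_ord_recr/= -IH -LZ// -LD//; last exact: bounded_measurableZ.
  by congr L; apply/funext => x; rewrite big_ord_recr.
have Ls : L n s @[n --> \oo] --> 0.
  have -> : L^~ s = fun n => \sum_(j < N) h * L n \1_(A j) + - (M + 1) * L n \1_setT.
    by apply/funext => n; rewrite LD// ?LZ// ?Ls1//; exact: bounded_measurableZ.
  have cZ (c : R) B : measurable B -> c * L n \1_B @[n --> \oo] --> 0.
    move=> mB; rewrite -(mulr0 c); apply: cvgM; last exact: L0.
    exact: cvg_cst.
  have cs k : \sum_(j < k) h * L n \1_(A j) @[n --> \oo] --> 0.
    elim: k => [|k IH].
      by under eq_fun do rewrite big_ord0; apply: cvg_cst.
    under eq_fun do rewrite big_ord_recr/=.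
    have := cvgD IH (cZ h _ (mA k)); rewrite addr0; exact.
  have := cvgD (cs N) (cZ (- (M + 1)) _ measurableT); rewrite addr0; exact.
have hC : C * h <= e / 2.
  rewrite /h mulrA ler_pdivrMr// mulrAC ler_pdivlMr//.
  have : C * (2 * (M + 1)) / (e / 2) <= N%:R by apply: le_trans NP; rewrite lerDl.
  by rewrite ler_pdivrMr ?divr_gt0//; lra.
have key n : `|L n f - L n s| <= C * h.
  have -> : L n f - L n s = L n (fun x => f x - s x).
    rewrite (_ : (fun x => _) = (fun x => f x + (-1) * s x)).
      by rewrite LD ?LZ ?mulN1r//; exact: bounded_measurableZ.
    by apply/funext => x; rewrite mulN1r.
  by apply: LM => //; exact: bounded_measurableB.
have /cvgrPdist_le/(_ (e / 2) (divr_gt0 e0 (ltr0n _ 2))) := Ls.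
apply: filterS => n; rewrite !sub0r !normrN => hn.
rewrite -[L n f](subrK (L n s)) (le_trans (ler_normD _ _))//.
by rewrite [e]splitr lerD// (le_trans (key n)).
Qed.

End Approximation.

(** * The law of an i.i.d. sequence *)

Section History.
Context (R : realType).

Definition box (N : nat) (B : nat -> set R) : set (history R) :=
  [set u : history R | forall j, (j < N)%N -> B j (u j)].

Definition boxes : set (set (history R)) :=
  [set C | exists N B, (forall j, measurable (B j)) /\ C = box N B].

Lemma measurable_coordinate k : measurable_fun setT (fun u : history R => u k).
Proof.
move=> _ B mB; rewrite setTI; apply: sub_sigma_algebra.
by exists k, B.
Qed.

Lemma measurable_into_history d (T : measurableType d) (g : T -> history R) :
  (forall k, measurable_fun setT (fun w => g w k)) -> measurable_fun setT g.
Proof.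
move=> mg; apply: (@measurability _ _ _ (history R) setT g (@cylinders R)) => //.
move=> _ [_ [k [B [mB ->]] <-]].
rewrite (_ : _ @^-1` _ = (fun w => g w k) @^-1` B)//; exact: mg.
Qed.

Definition reindex (a : nat -> nat) (u : history R) : history R := fun j => u (a j).

Lemma measurable_reindex a : measurable_fun setT (reindex a).
Proof. by apply: measurable_into_history => k; exact: measurable_coordinate. Qed.

Lemma measurable_box N B : (forall j, measurable (B j)) -> measurable (box N B).
Proof.
move=> mB; rewrite (_ : box N B = \bigcap_(j in [set j | (j < N)%N])
    [set u : history R | B j (u j)]) //.
apply: bigcap_measurableType => j _.
by rewrite -[X in measurable X]setTI; exact: measurable_coordinate.
Qed.

Lemma boxI : setI_closed boxes.
Proof.
move=> _ _ [N [B [mB ->]]] [N' [B' [mB' ->]]].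
exists (maxn N N'), (fun j => (if (j < N)%N then B j else setT) `&`
  (if (j < N')%N then B' j else setT)); split.
  by move=> j; apply: measurableI; case: ifP.
apply/seteqP; split => u /=.
  by move=> [h h'] j _; split; case: ifP => // jN; [exact: h | exact: h'].
move=> h; split => j jN.
  have := h j; rewrite leq_max jN => /(_ isT)[]//.
have := h j; rewrite leq_max jN orbT => /(_ isT)[]//.
Qed.

Lemma measurable_boxesE : @measurable _ (history R) = <<s boxes >>.
Proof.
apply/seteqP; split; last first.
  apply: smallest_sub; first exact: sigma_algebra_measurable.
  by move=> _ [N [B [mB ->]]]; exact: measurable_box.
apply: smallest_sub; first exact: smallest_sigma_algebra.
move=> _ [k [B [mB ->]]]; apply: sub_sigma_algebra.
exists k.+1, (fun j => if j == k then B else setT); split.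
  by move=> j; case: ifP.
apply/seteqP; split => u /=; first by move=> h j _; case: eqP => // ->.
by move=> /(_ k (ltnSn k)); rewrite eqxx.
Qed.

(** Boxes over finitely many coordinates are stable under intersection and generate
    the sigma-algebra, unlike cylinders over one coordinate. *)
Lemma history_measure_unique (m1 m2 : {measure set (history R) -> \bar R}) :
  (m1 setT < +oo)%E ->
  (forall N B, (forall j, measurable (B j)) -> m1 (box N B) = m2 (box N B)) ->
  forall A, measurable A -> m1 A = m2 A.
Proof.
move=> fin eqb.
have bT : boxes setT by exists 0%N, (fun=> setT); split => //; apply/seteqP; split.
apply: (@measure_unique _ _ _ boxes (fun=> setT)) => //.
- exact: measurable_boxesE.
- exact: boxI.
- by rewrite bigcup_const.
- by move=> _ [N [B [mB ->]]]; exact: eqb.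
Qed.

End History.

Section IidLaw.
Context (R : realType) d (T : measurableType d) (P : probability T R).
Context (I : eqType) (Y : I -> {RV P >-> R}).
Hypothesis iidY : iid Y.

Definition select (k : nat -> I) (w : T) : history R := fun j => Y (k j) w.

Lemma measurable_select k : measurable_fun setT (select k).
Proof. by apply: measurable_into_history => j; exact: measurable_funP. Qed.

HB.instance Definition _ k :=
  isMeasurableFun.Build _ _ _ _ (select k) (measurable_select k).

Lemma prob_select_box (k : nat -> I) (i0 : I) N B : injective k ->
  (forall j, measurable (B j)) ->
  P (select k @^-1` box N B) = (\prod_(j < N) P (Y i0 @^-1` B j))%E.
Proof.
move=> kinj mB; have [indep ident] := iidY.
pose J := map k (iota 0 N).
have uJ : uniq J by rewrite map_inj_uniq// iota_uniq.
pose B' i := B (index i J).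
have idx j : (j < N)%N -> index (k j) J = j.
  move=> jN; rewrite /J index_map// -[X in index X]add0n.
  by rewrite -[in index _ _](nth_iota 0 0 jN) index_uniq ?size_iota ?iota_uniq.
have := indep J B' uJ (fun i => mB _).
rewrite (_ : \bigcap_(i in [set` J]) _ = select k @^-1` box N B); last first.
  apply/seteqP; split => w /=.
    move=> h j jN; have := h (k j); rewrite /B' /= idx//; apply.
    by rewrite /J; apply/map_f; rewrite mem_iota.
  move=> h i /= /mapP[j]; rewrite mem_iota /= add0n => jN ->.
  by rewrite /B' idx//; exact: h.
move=> ->; rewrite /J big_map -{1}[N]subn0 -/(index_iota 0 N) big_mkord.
by apply: eq_bigr => j _; rewrite (ident _ i0) /B' ?idx.
Qed.

(** Only the injectivity of the selection matters for the law. *)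
Lemma prob_select (k k' : nat -> I) (A : set (history R)) :
  injective k -> injective k' -> measurable A ->
  P (select k @^-1` A) = P (select k' @^-1` A).
Proof.
move=> kinj kinj' mA.
apply: (@history_measure_unique R (pushforward P (select k))
  (pushforward P (select k'))) => //.
  by change (P setT < +oo)%E; rewrite probability_setT ltry.
move=> N B mB; transitivity (\prod_(j < N) P (Y (k 0%N) @^-1` B j))%E.
  exact: prob_select_box.
by apply/esym; exact: prob_select_box.
Qed.

Lemma integral_select (k k' : nat -> I) (F : history R -> \bar R) :
  injective k -> injective k' -> measurable_fun setT F -> (forall u, 0 <= F u)%E ->
  (\int[P]_w F (select k w) = \int[P]_w F (select k' w))%E.
Proof.
move=> kinj kinj' mF F0.
have E (l : nat -> I) : (\int[P]_w F (select l w))%E =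
   (\int[pushforward P (select l)]_u F u)%E.
  by rewrite ge0_integral_pushforward.
rewrite !E; apply: eq_measure_integral => A mA _.
exact: prob_select.
Qed.

Lemma Ex_select (k k' : nat -> I) (F : history R -> R) :
  injective k -> injective k' -> bounded_measurable F ->
  Ex P (fun w => F (select k w)) = Ex P (fun w => F (select k' w)).
Proof.
move=> kinj kinj' bF; have [mF [M FM]] := bF.
have E (l : nat -> I) : Ex P (fun w => F (select l w)) =
    fine (\int[P]_w (F (select l w) + M)%:E) - M.
  have bl : bounded_measurable (fun w => F (select l w)).
    exact: bounded_measurable_comp (measurable_select l) bF.
  have := ExD P bl (bounded_measurable_cst _ M); rewrite Ex_cst /Ex /Rintegral => ->.
  by rewrite addrK.
rewrite !E; congr (fine _ - _).
apply: (integral_select (F := fun u => (F u + M)%:E)) => //.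
  by apply/measurable_EFinP/measurable_funD.
move=> u; rewrite lee_fin; have := FM u; rewrite ler_norml => /andP[]; lra.
Qed.

End IidLaw.

(** * The Efron-Stein inequality for infinitely many variables *)

(** An i.i.d. sequence indexed by nat carries two independent copies of a history:
    one on the even indices, one on the odd indices.  The maps below read, from
    the sequence, the first copy with some of its entries taken from the second. *)
Definition first_copy (j : nat) : nat := (2 * j)%N.
Definition mixed_copy (M j : nat) : nat := if (j < M)%N then (2 * j).+1 else (2 * j)%N.
Definition resampled_copy (M j : nat) : nat := if j == M then (2 * j).+1 else (2 * j)%N.
Definition swap_at (M i : nat) : nat :=
  if i == (2 * M)%N then (2 * M).+1 else if i == (2 * M).+1 then (2 * M)%N else i.
Definition swap_below (M i : nat) : nat :=
  if (i < 2 * M)%N then if odd i then i.-1 else i.+1 else i.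

Lemma first_copy_inj : injective first_copy.
Proof. by move=> i j; rewrite /first_copy; lia. Qed.

Lemma mixed_copy_inj M : injective (mixed_copy M).
Proof. by move=> i j; rewrite /mixed_copy; case: ifP; case: ifP; lia. Qed.

Lemma swap_at_inj M : injective (swap_at M).
Proof.
by move=> i j; rewrite /swap_at; do !case: ifP; lia.
Qed.

Lemma swap_below_inj M : injective (swap_below M).
Proof.
by move=> i j; rewrite /swap_below; do !case: ifP; lia.
Qed.

Section EfronStein.
Context (R : realType) d (T : measurableType d) (P : probability T R).
Context (I : eqType) (Y : I -> {RV P >-> R}).
Hypothesis iidY : iid Y.
Variable k : nat -> I.
Hypothesis k_inj : injective k.
Implicit Types (F H : history R -> R) (a b : nat -> nat).

Local Notation at_ a := (select Y (k \o a)).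

Lemma bounded_at a F : bounded_measurable F -> bounded_measurable (fun w => F (at_ a w)).
Proof. exact/bounded_measurable_comp/measurable_select. Qed.

Lemma Ex_at a F : injective a -> bounded_measurable F ->
  Ex P (fun w => F (at_ a w)) = Ex P (fun w => F (select Y k w)).
Proof. by move=> ai bF; apply: Ex_select => //; exact: inj_comp. Qed.

Lemma Ex_permute (s : nat -> nat) (G : history R -> R) : injective s ->
  bounded_measurable G ->
  Ex P (fun w => G (select Y k w)) = Ex P (fun w => G (reindex s (select Y k w))).
Proof. by move=> si bG; apply: Ex_select => //; exact: inj_comp. Qed.

Lemma Ex_product_permute (s : nat -> nat) a b F H : injective s ->
  bounded_measurable F -> bounded_measurable H ->
  Ex P (fun w => F (at_ a w) * H (at_ b w)) =
  Ex P (fun w => F (at_ (s \o a) w) * H (at_ (s \o b) w)).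
Proof.
move=> si bF bH.
apply: (@Ex_permute s (fun v => F (reindex a v) * H (reindex b v))) => //.
by apply: bounded_measurableM; apply: bounded_measurable_comp => //;
  exact: measurable_reindex.
Qed.

Lemma Ex_sqr_permute (s : nat -> nat) a b F : injective s -> bounded_measurable F ->
  Ex P (fun w => (F (at_ a w) - F (at_ b w)) ^+ 2) =
  Ex P (fun w => (F (at_ (s \o a) w) - F (at_ (s \o b) w)) ^+ 2).
Proof.
move=> si bF.
apply: (@Ex_permute s (fun v => (F (reindex a v) - F (reindex b v)) ^+ 2)) => //.
by apply/bounded_measurableX/bounded_measurableB; apply: bounded_measurable_comp => //;
  exact: measurable_reindex.
Qed.

(** While the box constrains only entries that the mixed copy takes from the other
    copy, the two conditions concern disjoint sets of variables. *)
Lemma prob_box_mixed (n M : nat) (C : nat -> set R) (A : set (history R)) :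
  (n <= M)%N -> (forall j, measurable (C j)) -> measurable A ->
  (P (at_ first_copy @^-1` box n C `&` at_ (mixed_copy M) @^-1` A) =
  P (at_ first_copy @^-1` box n C) * P (at_ (mixed_copy M) @^-1` A))%E.
Proof.
move=> nM mC mA.
have mB : measurable (at_ first_copy @^-1` box n C).
  by rewrite -[X in measurable X]setTI; apply: measurable_select => //;
    exact: measurable_box.
pose m0 := mrestr P mB.
pose m1 := pushforward m0 (at_ (mixed_copy M)).
have p0 : 0 <= fine (P (at_ first_copy @^-1` box n C)) by exact: fine_ge0.
have @m2 : {measure set (history R) -> \bar R}.
  refine (mscale (NngNum p0) (pushforward P (at_ (mixed_copy M)))).
  exact: measurable_select.
have key : m1 A = m2 A.
  apply: history_measure_unique => //.
    apply: (le_lt_trans _ (ltry 1)); rewrite /m1 /pushforward /m0 /mrestr.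
    change (P (at_ (mixed_copy M) @^-1` setT `&` at_ first_copy @^-1` box n C) <= 1)%E.
    by apply: probability_le1; apply: measurableI => //; rewrite preimage_setT.
  move=> N C' mC'.
  change (P (at_ (mixed_copy M) @^-1` box N C' `&` at_ first_copy @^-1` box n C) =
    ((fine (P (at_ first_copy @^-1` box n C)))%:E *
      P (at_ (mixed_copy M) @^-1` box N C'))%E).
  rewrite fineK ?fin_num_measure//.
  (* the variables seen by the two events form one family of distinct variables *)
  pose s j := if (j < n)%N then first_copy j else mixed_copy M (j - n).
  have si : injective (k \o s).
    apply: inj_comp => // i j; rewrite /s /first_copy /mixed_copy.
    by do !case: ifP; lia.
  rewrite setIC.
  have -> : at_ first_copy @^-1` box n C `&` at_ (mixed_copy M) @^-1` box N C' =
      select Y (k \o s) @^-1` box (n + N) (fun j => if (j < n)%N then C j else C' (j - n)%N).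
    apply/seteqP; split => w /=.
      move=> [h h'] j jN; rewrite /select /s /=; case: ifP => jn; first exact: h.
      by apply: h'; lia.
    move=> h; split => j jn.
      by have := h j; rewrite /select /s /= jn; apply; lia.
    have nj : (n + j < n)%N = false by lia.
    by have := h (n + j)%N; rewrite /select /s /= nj addKn; apply; lia.
  rewrite (prob_select_box iidY (k 0%N))//; last by move=> j; case: ifP.
  rewrite (prob_select_box iidY (k 0%N))//; last exact/inj_comp/first_copy_inj.
  rewrite (prob_select_box iidY (k 0%N))//; last exact/inj_comp/mixed_copy_inj.
  rewrite big_split_ord/=; congr (_ * _)%E; apply: eq_bigr => j _.
    by rewrite ltn_ord.
  by rewrite ltnNge leq_addr /= addKn.
have -> : P (at_ first_copy @^-1` box n C `&` at_ (mixed_copy M) @^-1` A) = m1 A.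
  by rewrite setIC.
rewrite key.
change ((fine (P (at_ first_copy @^-1` box n C)))%:E *
  P (at_ (mixed_copy M) @^-1` A) = P (at_ first_copy @^-1` box n C) *
  P (at_ (mixed_copy M) @^-1` A))%E.
by rewrite fineK// fin_num_measure.
Qed.

(** The covariance of F of one copy with H of the copy whose first M entries have
    been renewed. *)
Definition mixing_gap F H (M : nat) : R :=
  Ex P (fun w => F (at_ first_copy w) * H (at_ (mixed_copy M) w)) -
  Ex P (fun w => F (select Y k w)) * Ex P (fun w => H (select Y k w)).

Lemma mixing_gapDl F F' H M : bounded_measurable F -> bounded_measurable F' ->
  bounded_measurable H ->
  mixing_gap (fun u => F u + F' u) H M = mixing_gap F H M + mixing_gap F' H M.
Proof.
move=> bF bF' bH; rewrite /mixing_gap.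
have b1 G : bounded_measurable G -> bounded_measurable (fun w => G (select Y k w)).
  exact/bounded_measurable_comp/measurable_select.
rewrite ExD; [|exact: b1..].
rewrite (_ : (fun w => _) = (fun w => F (at_ first_copy w) * H (at_ (mixed_copy M) w)
   + F' (at_ first_copy w) * H (at_ (mixed_copy M) w))); last first.
  by apply/funext => w; rewrite mulrDl.
rewrite ExD; [|by apply: bounded_measurableM; exact: bounded_at..].
ring.
Qed.

Lemma mixing_gapZl c F H M : bounded_measurable F -> bounded_measurable H ->
  mixing_gap (fun u => c * F u) H M = c * mixing_gap F H M.
Proof.
move=> bF bH; rewrite /mixing_gap.
rewrite ExZ; last exact: bounded_measurable_comp (measurable_select _ _) bF.
rewrite (_ : (fun w => _) =
  (fun w => c * (F (at_ first_copy w) * H (at_ (mixed_copy M) w)))); last first.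
  by apply/funext => w; rewrite mulrA.
rewrite ExZ; last by apply: bounded_measurableM; exact: bounded_at.
ring.
Qed.

Lemma mixing_gapDr F H H' M : bounded_measurable F -> bounded_measurable H ->
  bounded_measurable H' ->
  mixing_gap F (fun u => H u + H' u) M = mixing_gap F H M + mixing_gap F H' M.
Proof.
move=> bF bH bH'; rewrite /mixing_gap.
have b1 G : bounded_measurable G -> bounded_measurable (fun w => G (select Y k w)).
  exact/bounded_measurable_comp/measurable_select.
rewrite ExD; [|exact: b1..].
rewrite (_ : (fun w => _) = (fun w => F (at_ first_copy w) * H (at_ (mixed_copy M) w)
   + F (at_ first_copy w) * H' (at_ (mixed_copy M) w))); last first.
  by apply/funext => w; rewrite mulrDr.
rewrite ExD; [|by apply: bounded_measurableM; exact: bounded_at..].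
ring.
Qed.

Lemma mixing_gapZr c F H M : bounded_measurable F -> bounded_measurable H ->
  mixing_gap F (fun u => c * H u) M = c * mixing_gap F H M.
Proof.
move=> bF bH; rewrite /mixing_gap.
rewrite [X in _ - _ * X]ExZ; last exact: bounded_measurable_comp (measurable_select _ _) bH.
rewrite (_ : (fun w => _) =
  (fun w => c * (F (at_ first_copy w) * H (at_ (mixed_copy M) w)))); last first.
  by apply/funext => w; rewrite mulrCA.
rewrite ExZ; last by apply: bounded_measurableM; exact: bounded_at.
ring.
Qed.

Lemma mixing_gap_bound F H M (c e : R) : bounded_measurable F ->
  bounded_measurable H -> (forall u, `|F u| <= c) -> (forall u, `|H u| <= e) ->
  `|mixing_gap F H M| <= 2 * c * e.
Proof.
move=> bF bH Fc He.
rewrite (le_trans (ler_normB _ _))// normrM.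
rewrite (_ : 2 * c * e = c * e + c * e); last ring.
apply: lerD; first apply: Ex_norm_le.
- by apply: bounded_measurableM; exact: bounded_at.
- by move=> w; rewrite normrM ler_pM.
- by apply: ler_pM => //; apply: Ex_norm_le => //;
    apply: bounded_measurable_comp => //; exact: measurable_select.
Qed.

(** By independence this holds when H is an indicator, and the gap is linear and
    continuous in H. *)
Lemma mixing_gap_box n (C : nat -> set R) H M : (n <= M)%N ->
  (forall j, measurable (C j)) -> bounded_measurable H ->
  mixing_gap \1_(box n C) H M = 0.
Proof.
move=> nM mC bH.
have bC : bounded_measurable (\1_(box n C) : history R -> R).
  by apply: bounded_measurable_indic; exact: measurable_box.
suff h : (fun=> mixing_gap \1_(box n C) H M) @ \oo --> (0 : R).
  by have <- := cvg_lim (@Rhausdorff R) h; rewrite lim_cst.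
apply: (@bounded_measurable_limit R _ (history R)
  (fun=> mixing_gap \1_(box n C) ^~ M) 2) => //.
- by move=> _ f g bf bg; exact: mixing_gapDr.
- by move=> _ c f bf; exact: mixing_gapZr.
- move=> _ f c bf fc; rewrite -[2]mulr1; apply: mixing_gap_bound => // u.
  by rewrite indicE; case: (_ \in _); rewrite ?normr1 ?normr0.
- move=> A mA; rewrite (_ : (fun _ => _) = fun=> 0); first exact: cvg_cst.
  apply/funext => _; rewrite /mixing_gap.
  have mu a B : measurable B -> measurable (at_ a @^-1` B).
    move=> mB; rewrite -[X in measurable X]setTI; exact: measurable_select.
  have mb := measurable_box n mC.
  rewrite -(Ex_at first_copy_inj bC) -(Ex_at (@mixed_copy_inj M)); last first.
    exact: bounded_measurable_indic.
  rewrite (_ : (fun w => _ * _) =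
    \1_(at_ first_copy @^-1` box n C `&` at_ (mixed_copy M) @^-1` A)); last first.
    by apply/funext => w; rewrite indicI.
  rewrite (_ : (fun w => \1_(box n C) _) = \1_(at_ first_copy @^-1` box n C))//.
  rewrite (_ : (fun w => \1_A _) = \1_(at_ (mixed_copy M) @^-1` A))//.
  rewrite !Ex_indic//; [|exact: mu|exact: mu|by apply: measurableI; exact: mu].
  by rewrite prob_box_mixed// fineM ?subrr// fin_num_measure//; exact: mu.
Qed.

(** A monotone class argument: convergence to zero passes to differences, and to
    increasing limits because the gap is controlled, uniformly in M, by the
    probability of the event. *)
Lemma mixing_gap_cvg_indic (A : set (history R)) H : measurable A ->
  bounded_measurable H -> mixing_gap \1_A H M @[M --> \oo] --> 0.
Proof.
move=> mA bH; have [_ [e0 He0]] := bH.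
pose e := `|e0| + 1.
have e_gt0 : 0 < e by rewrite ltr_pwDr.
have He u : `|H u| <= e.
  by rewrite (le_trans (He0 u))// (le_trans (ler_norm _))// lerDl.
pose good := [set A : set (history R) | measurable A /\
   mixing_gap \1_A H M @[M --> \oo] --> 0].
have bi (B : set (history R)) : measurable B ->
    bounded_measurable (\1_B : history R -> R).
  exact: bounded_measurable_indic.
have indD (A1 A2 : set (history R)) : A2 `<=` A1 -> measurable A1 -> measurable A2 ->
    forall M, mixing_gap \1_(A1 `\` A2) H M = mixing_gap \1_A1 H M - mixing_gap \1_A2 H M.
  move=> A21 mA1 mA2 M; rewrite -mulN1r -mixing_gapZl//; last exact: bi.
  rewrite -mixing_gapDl//; [|exact: bi|by apply: bounded_measurableZ; exact: bi].
  congr mixing_gap; apply/funext => u; rewrite !indicE in_setD mulN1r.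
  have [u2|u2] := boolP (u \in A2); last by rewrite andbT subr0.
  by rewrite andbF (mem_set (A21 _ (set_mem u2))) subrr.
suff : good A by case.
have : <<s [set: history R], @boxes R>> `<=` good.
  apply: lambda_system_subset => //; first exact: boxI.
  - split => //.
    + split => //; rewrite (_ : setT = box 0 (fun=> setT)); last first.
        by apply/seteqP; split.
      rewrite (_ : (fun _ => _) = fun=> 0); first exact: cvg_cst.
      by apply/funext => M; apply: mixing_gap_box.
    + move=> A1 A2 A21 [mA1 c1] [mA2 c2]; split; first exact: measurableD.
      rewrite (_ : (fun _ => _) = (fun M => mixing_gap \1_A1 H M - mixing_gap \1_A2 H M)).
        by rewrite -(subr0 (0 : R)); exact: cvgB.
      by apply/funext => M; exact: indD.
    + move=> F ndF gF.
      have mF n : measurable (F n) by case: (gF n).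
      have mU : measurable (\bigcup_n F n) by exact: bigcup_measurable.
      split => //; apply/cvgrPdist_le => e1 e10.
      have mu B : measurable B -> measurable (select Y k @^-1` B).
        by move=> mB; rewrite -[X in measurable X]setTI; exact: measurable_select.
      have cv : P (select Y k @^-1` F n) @[n --> \oo] -->
          P (select Y k @^-1` (\bigcup_n F n)).
        rewrite preimage_bigcup; apply: nondecreasing_cvg_mu => //.
        * by move=> n; exact: mu.
        * by rewrite -preimage_bigcup; exact: mu.
        * by move=> n m nm; apply/subsetPset => w; move/subsetPset: (ndF _ _ nm); exact.
      have {}cv : fine (P (select Y k @^-1` F n)) @[n --> \oo] -->
          fine (P (select Y k @^-1` (\bigcup_n F n))).
        by apply: fine_cvg; rewrite fineK// fin_num_measure//; exact: mu.
      have e4 : 0 < e1 / 2 / (2 * e) by rewrite !divr_gt0// mulr_gt0.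
      have /cvgrPdist_le/(_ _ e4)[n _ /(_ n (leqnn n)) hn] := cv.
      have diff M : `|mixing_gap \1_(\bigcup_n F n) H M - mixing_gap \1_(F n) H M|
          <= e1 / 2.
        rewrite -indD//; last by move=> u Fu; exists n.
        set D := _ `\` _.
        have mD : measurable D by exact: measurableD.
        have PD : fine (P (select Y k @^-1` D)) <= e1 / 2 / (2 * e).
          rewrite (le_trans _ hn)// (_ : select Y k @^-1` D =
            select Y k @^-1` (\bigcup_n F n) `\` select Y k @^-1` F n)// measureD ?fin_num_measure//;
            [|exact: mu|exact: mu|by rewrite ltey_eq fin_num_measure//; exact: mu].
          rewrite setIC setIidl; last by move=> w Fw; exists n.
          by rewrite fineB ?fin_num_measure ?ler_norm//; exact: mu.
        have pD := fine_ge0 (measure_ge0 P (select Y k @^-1` D)).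
        have bD := bi _ mD.
        have i1 a : bounded_measurable (fun w => \1_D (at_ a w) : R).
          exact: bounded_at.
        rewrite (le_trans (ler_normB _ _))// [e1 / 2](_ : _ =
            e1 / 2 / (2 * e) * e + e1 / 2 / (2 * e) * e); last by field; lra.
        have Ei a : injective a -> Ex P (fun w => \1_D (at_ a w)) = fine (P (select Y k @^-1` D)).
          by move=> ai; rewrite Ex_at// -Ex_indic//; exact: mu.
        have EH : `|Ex P (fun w => H (select Y k w))| <= e.
          by apply: Ex_norm_le => //; apply: bounded_measurable_comp.
        apply: lerD.
          apply: (@le_trans _ _ (fine (P (select Y k @^-1` D)) * e)); last first.
            by rewrite ler_wpM2r// ltW.
          rewrite -(Ei _ first_copy_inj) mulrC -ExZ//.
          have bL : bounded_measurable (fun w => \1_D (at_ first_copy w) *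
              H (at_ (mixed_copy M) w)).
            by apply: bounded_measurableM => //; exact: bounded_at.
          have pw w : `|\1_D (at_ first_copy w) * H (at_ (mixed_copy M) w)| <=
              e * \1_D (at_ first_copy w).
            rewrite normrM indicE; case: (_ \in _).
              by rewrite normr1 mul1r mulr1.
            by rewrite normr0 mul0r mulr0.
          rewrite ler_norml; apply/andP; split.
            rewrite -mulN1r -ExZ; last exact: bounded_measurableZ.
            apply: le_Ex => //; first by do 2 apply: bounded_measurableZ.
            by move=> w; have := pw w; rewrite ler_norml mulN1r => /andP[].
          apply: le_Ex => //; first exact: bounded_measurableZ.
          by move=> w; have := pw w; rewrite ler_norml => /andP[].
        rewrite normrM ler_pM//.
        rewrite (_ : Ex P _ = fine (P (select Y k @^-1` D))) ?ger0_norm//.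
        by rewrite -Ex_indic//; exact: mu.
      have e2 : 0 < e1 / 2 by rewrite divr_gt0.
      have /cvgrPdist_le/(_ _ e2) := (gF n).2.
      apply: filterS => M; rewrite !sub0r !normrN => hM.
      rewrite -[mixing_gap _ H M](subrK (mixing_gap \1_(F n) H M)).
      by rewrite (le_trans (ler_normD _ _))// [e1]splitr lerD.
  - move=> _ [n [C [mC ->]]]; split; first exact: measurable_box.
    apply/cvgrPdist_le => e1 e10; exists n => // M nM.
    by rewrite /= mixing_gap_box// subrr normr0 ltW.
by apply; rewrite -measurable_boxesE.
Qed.

Lemma mixing_gap_cvg F H : bounded_measurable F -> bounded_measurable H ->
  mixing_gap F H M @[M --> \oo] --> 0.
Proof.
move=> bF bH; have [_ [e He]] := bH.
apply: (@bounded_measurable_limit R _ (history R)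
  (fun M F => mixing_gap F H M) (2 * e)) => //.
- by move=> M f g bf bg; exact: mixing_gapDl.
- by move=> M c f bf; exact: mixing_gapZl.
- by move=> M f c bf fc; rewrite mulrAC; exact: mixing_gap_bound.
- by move=> A mA; exact: mixing_gap_cvg_indic.
Qed.

(** Half of the sum of the influences bounds the variance of F. *)
Definition influence F (m : nat) : R :=
  Ex P (fun w => (F (at_ first_copy w) - F (at_ (resampled_copy m) w)) ^+ 2).

Lemma swap_at_first M : swap_at M \o first_copy = resampled_copy M.
Proof. by apply/funext => j; rewrite /swap_at /first_copy /resampled_copy /=; do !case: ifP; lia. Qed.

Lemma swap_at_mixed M : swap_at M \o mixed_copy M = mixed_copy M.+1.
Proof. by apply/funext => j; rewrite /swap_at /mixed_copy /=; do !case: ifP; lia. Qed.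

Lemma swap_at_mixedS M : swap_at M \o mixed_copy M.+1 = mixed_copy M.
Proof. by apply/funext => j; rewrite /swap_at /mixed_copy /=; do !case: ifP; lia. Qed.

Lemma swap_below_first M : swap_below M \o first_copy = mixed_copy M.
Proof. by apply/funext => j; rewrite /swap_below /first_copy /mixed_copy /=; do !case: ifP; lia. Qed.

Lemma swap_below_resampled M : swap_below M \o resampled_copy M = mixed_copy M.+1.
Proof. by apply/funext => j; rewrite /swap_below /resampled_copy /mixed_copy /=; do !case: ifP; lia. Qed.

(** Exchanging the two copies of the M-th variable preserves the law and
    interchanges the two mixtures; averaging the difference with its image makes
    the influence appear in both factors. *)
Lemma mixing_step F M : bounded_measurable F ->
  Ex P (fun w => F (at_ first_copy w) * F (at_ (mixed_copy M) w)) -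
  Ex P (fun w => F (at_ first_copy w) * F (at_ (mixed_copy M.+1) w)) <=
  influence F M / 2.
Proof.
move=> bF.
pose f0 w := F (at_ first_copy w); pose f1 w := F (at_ (resampled_copy M) w).
pose g0 w := F (at_ (mixed_copy M) w); pose g1 w := F (at_ (mixed_copy M.+1) w).
have b a : bounded_measurable (fun w => F (at_ a w)) by exact: bounded_at.
have bM a a' : bounded_measurable (fun w => F (at_ a w) * F (at_ a' w)).
  exact: bounded_measurableM.
have E0 : Ex P (fun w => f0 w * g0 w) = Ex P (fun w => f1 w * g1 w).
  rewrite (Ex_product_permute _ _ (@swap_at_inj M))//.
  by rewrite swap_at_first swap_at_mixed.
have E1 : Ex P (fun w => f0 w * g1 w) = Ex P (fun w => f1 w * g0 w).
  rewrite (Ex_product_permute _ _ (@swap_at_inj M))//.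
  by rewrite swap_at_first swap_at_mixedS.
have E2 : Ex P (fun w => (g0 w - g1 w) ^+ 2) = influence F M.
  rewrite /influence (Ex_sqr_permute _ _ (@swap_below_inj M))//.
  by rewrite swap_below_first swap_below_resampled.
have E3 : Ex P (fun w => (f0 w - f1 w) * (g0 w - g1 w)) =
    2 * (Ex P (fun w => f0 w * g0 w) - Ex P (fun w => f0 w * g1 w)).
  rewrite (_ : (fun w => _) = (fun w => (f0 w * g0 w + f1 w * g1 w) -
    (f0 w * g1 w + f1 w * g0 w))); last by apply/funext => w; ring.
  rewrite ExB; [|by apply: bounded_measurableD; exact: bM..].
  rewrite !ExD; [|exact: bM..]; rewrite -E0 -E1; ring.
have E4 : Ex P (fun w => (f0 w - f1 w) * (g0 w - g1 w)) <= influence F M.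
  have bD a a' : bounded_measurable (fun w => (F (at_ a w) - F (at_ a' w)) ^+ 2).
    by apply/bounded_measurableX/bounded_measurableB.
  rewrite (_ : influence F M = 2^-1 * influence F M +
     2^-1 * Ex P (fun w => (g0 w - g1 w) ^+ 2)); last first.
    by rewrite E2; field.
  rewrite -!ExZ; [|exact: bD..].
  rewrite -ExD; [|by apply: bounded_measurableZ; exact: bD..].
  apply: le_Ex.
  - by apply: bounded_measurableM; apply: bounded_measurableB; exact: b.
  - by apply: bounded_measurableD; apply: bounded_measurableZ; exact: bD.
  - move=> w; rewrite -subr_ge0.
    rewrite (_ : _ - _ = 2^-1 * ((f0 w - f1 w) - (g0 w - g1 w)) ^+ 2).
      by rewrite mulr_ge0 ?sqr_ge0.
    by rewrite /f0 /f1; field.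
have : 2 * (Ex P (fun w => f0 w * g0 w) - Ex P (fun w => f0 w * g1 w)) <= influence F M.
  by rewrite -E3.
rewrite /f0 /g0 /g1; lra.
Qed.

(** The Efron-Stein bound: replacing the variables one after the other by
    independent copies turns the second moment of F into the square of its mean,
    each replacement costing at most half an influence. *)
Lemma efron_stein F (S : R) : bounded_measurable F ->
  (forall M, \sum_(m < M) influence F m <= S) ->
  Ex P (fun w => F (select Y k w) ^+ 2) - Ex P (fun w => F (select Y k w)) ^+ 2 <= S / 2.
Proof.
move=> bF hS.
have tele M : Ex P (fun w => F (select Y k w) ^+ 2) -
    Ex P (fun w => F (at_ first_copy w) * F (at_ (mixed_copy M) w)) <= S / 2.
  apply: (@le_trans _ _ ((\sum_(m < M) influence F m) / 2)); last first.
    by rewrite ler_wpM2r.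
  elim: M => [|M IH].
    rewrite big_ord0 mul0r subr_le0 le_eqVlt; apply/orP; left; apply/eqP.
    rewrite -(Ex_at first_copy_inj (bounded_measurableX 2 bF)).
    by congr Ex; apply/funext => w; rewrite expr2.
  rewrite big_ord_recr/= mulrDl; have := mixing_step M bF; lra.
have cv := mixing_gap_cvg bF bF.
have : (fun M => Ex P (fun w => F (select Y k w) ^+ 2) -
    Ex P (fun w => F (select Y k w)) ^+ 2 - mixing_gap F F M) @ \oo -->
   Ex P (fun w => F (select Y k w) ^+ 2) - Ex P (fun w => F (select Y k w)) ^+ 2 - 0.
  by apply: cvgB => //; exact: cvg_cst.
rewrite subr0 => cvS; apply: (ler_cvg_to cvS (cvg_cst (S / 2))).
by near=> M; have := tele M; rewrite /mixing_gap expr2; lra.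
Unshelve. all: by end_near. Qed.

End EfronStein.

(** * Variance of sums of functions of shifted histories *)

Section SquareSums.
Context (R : realType) d (T : measurableType d) (P : probability T R).

(** The degenerate bounds are limits of positive ones. *)
Lemma Ex_mul_le0 (f g : T -> R) (a c : R) : bounded_measurable f -> bounded_measurable g ->
  0 <= a -> 0 <= c -> Ex P (fun x => f x ^+ 2) <= a ^+ 2 ->
  Ex P (fun x => g x ^+ 2) <= c ^+ 2 -> Ex P (fun x => f x * g x) <= a * c.
Proof.
move=> bf bg a0 c0 fa gc.
have H e : 0 < e -> Ex P (fun x => f x * g x) <= (a + e) * (c + e).
  move=> e0; apply: Ex_mul_le => //; try exact: ltr_wpDl.
    by rewrite (le_trans fa)// ler_sqr ?nnegrE//; lra.
  by rewrite (le_trans gc)// ler_sqr ?nnegrE//; lra.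
set E := Ex P _ in H *; rewrite leNgt; apply/negP => h.
pose e := Num.min 1 ((E - a * c) / (2 * (a + c + 1))).
have D0 : 0 < 2 * (a + c + 1) by lra.
have e0 : 0 < e by rewrite lt_min ltr01 divr_gt0// subr_gt0.
have e1 : e <= 1 by rewrite ge_min lexx.
have e2 : e * (2 * (a + c + 1)) <= E - a * c by rewrite -ler_pdivlMr// ge_min lexx orbT.
have := H e e0.
have : e * e <= e by rewrite -[leRHS]mulr1 ler_wpM2l// ltW.
nra.
Qed.

(** Minkowski's inequality for second moments. *)
Lemma Ex_sqr_sum_le n (x : nat -> T -> R) (a : nat -> R) :
  (forall r, bounded_measurable (x r)) -> (forall r, 0 <= a r) ->
  (forall r, Ex P (fun w => x r w ^+ 2) <= a r ^+ 2) ->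
  Ex P (fun w => (\sum_(r < n) x r w) ^+ 2) <= (\sum_(r < n) a r) ^+ 2.
Proof.
move=> bx a0 xa; elim: n => [|n IH].
  rewrite big_ord0 (_ : (fun w => _) = fun=> 0) ?Ex_cst ?expr0n//.
  by apply/funext => w; rewrite big_ord0 expr0n.
have bS : bounded_measurable (fun w => \sum_(r < n) x r w).
  by apply: bounded_measurable_sum => i _; exact: bx.
have A0 : 0 <= \sum_(r < n) a r by exact: sumr_ge0.
rewrite big_ord_recr/= (_ : (fun w => _) = (fun w => (\sum_(r < n) x r w) ^+ 2 +
  x n w ^+ 2 + 2 * ((\sum_(r < n) x r w) * x n w))); last first.
  by apply/funext => w; rewrite big_ord_recr/=; ring.
have bSx : bounded_measurable (fun w => (\sum_(r < n) x r w) * x n w).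
  exact: bounded_measurableM.
have b1 := bounded_measurableX 2 bS; have b2 := bounded_measurableX 2 (bx n).
rewrite ExD; [|exact: bounded_measurableD|exact: bounded_measurableZ].
rewrite ExD// ExZ//.
have := Ex_mul_le0 bS (bx n) A0 (a0 n) IH (xa n); have := xa n.
set A := Ex P _; set B := Ex P _; set C := Ex P _ in IH *.
move: IH; rewrite (_ : (\sum_(r < n) a r + a n) ^+ 2 = (\sum_(r < n) a r) ^+ 2 +
   a n ^+ 2 + 2 * ((\sum_(r < n) a r) * a n)); last ring.
by lra.
Qed.

End SquareSums.

Section ShiftedSums.
Context (R : realType) d (T : measurableType d) (P : probability T R).
Context (I : eqType) (Y : I -> {RV P >-> R}).
Hypothesis iidY : iid Y.
Implicit Types (k : nat -> I) (g : nat -> history R -> R).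

Lemma influence_select k k' (F : history R -> R) m : injective k -> injective k' ->
  bounded_measurable F -> influence Y k F m = influence Y k' F m.
Proof.
move=> ki ki' bF.
apply: (Ex_select iidY (F := fun v => (F (reindex first_copy v) -
  F (reindex (resampled_copy m) v)) ^+ 2)) => //.
by apply/bounded_measurableX/bounded_measurableB; apply: bounded_measurable_comp => //;
  exact: measurable_reindex.
Qed.

Definition shifted_sum (L : nat) g (u : history R) : R :=
  \sum_(r < L) g r (reindex (addn r) u).

Lemma bounded_measurable_shifted_sum L g : (forall r, bounded_measurable (g r)) ->
  bounded_measurable (shifted_sum L g).
Proof.
move=> bg; apply: bounded_measurable_sum => r _.
by apply: bounded_measurable_comp => //; exact: measurable_reindex.
Qed.

Lemma sum_widen_zero (L N : nat) (a : nat -> R) : (forall r, 0 <= a r) ->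
  (forall r, (N <= r)%N -> a r = 0) -> \sum_(r < L) a r <= \sum_(r < N) a r.
Proof.
move=> a0 aN; apply: (@le_trans _ _ (\sum_(r < L + N) a r)).
  by rewrite big_split_ord/= lerDl sumr_ge0.
rewrite addnC big_split_ord/= [X in _ + X]big1 ?addr0// => i _.
by rewrite aN// leq_addr.
Qed.

(** A variable of lag m has lag m - r in the history shifted by r, and none at all
    when r > m. *)
Lemma influence_shifted_sum k L g (dl : nat -> R) (c : R) m : injective k ->
  (forall r, bounded_measurable (g r)) -> 0 <= c -> (forall j, 0 <= dl j) ->
  (forall r j, influence Y k (g r) j <= (c * dl j) ^+ 2) ->
  influence Y k (shifted_sum L g) m <=
  (\sum_(r < L) (if (r <= m)%N then c * dl (m - r)%N else 0)) ^+ 2.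
Proof.
move=> ki bg c0 dl0 hinf.
pose x r w := g r (reindex (addn r) (select Y (k \o first_copy) w)) -
  g r (reindex (addn r) (select Y (k \o resampled_copy m) w)).
have bx r : bounded_measurable (x r).
  apply: bounded_measurableB;
    apply: (bounded_measurable_comp (h := fun w => reindex (addn r) (select Y _ w))) => //;
    apply: measurableT_comp; try exact: measurable_reindex; exact: measurable_select.
rewrite /influence (_ : (fun w => _) = (fun w => (\sum_(r < L) x r w) ^+ 2)); last first.
  by apply/funext => w; rewrite /shifted_sum /x sumrB.
apply: (@Ex_sqr_sum_le _ _ _ P L x
  (fun r => if (r <= m)%N then c * dl (m - r)%N else 0)) => // r.
  by case: ifP => // _; rewrite mulr_ge0.
case: ifPn => [rm|rm]; last first.
  rewrite (_ : (fun w => _) = fun=> 0) ?Ex_cst ?expr0n//.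
  apply/funext => w; rewrite /x (_ : reindex _ _ = reindex (addn r)
    (select Y (k \o resampled_copy m) w)) ?subrr ?expr0n//.
  apply/funext => j; rewrite /reindex /select /= /first_copy /resampled_copy.
  by case: eqP => //; lia.
(* entry j of the history shifted by r has index 2 (j + r) in the first copy *)
pose s i := (i + 2 * r)%N.
have si : injective s by move=> i j; rewrite /s; lia.
apply: le_trans (hinf r (m - r)%N).
rewrite /influence (Ex_sqr_permute iidY ki _ _ si)// le_eqVlt; apply/orP; left; apply/eqP.
congr Ex; apply/funext => w; congr ((g r _ - g r _) ^+ 2); apply/funext => j;
  rewrite /reindex /select /= /s /first_copy /resampled_copy.
  by congr (Y (k _) w); lia.
by congr (Y (k _) w); case: eqP; case: eqP; lia.
Qed.

(** The m-th variable influences the r-th term through dl (m - r).  The square of the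
    sum over r of these coefficients is at most D times the sum itself, and summing
    over m gives D for each r, hence a bound linear in L. *)
Lemma variance_shifted_sum k L g (dl : nat -> R) (c D : R) : injective k ->
  (forall r, bounded_measurable (g r)) -> 0 <= c -> (forall j, 0 <= dl j) ->
  (forall M, \sum_(j < M) dl j <= D) ->
  (forall r j, influence Y k (g r) j <= (c * dl j) ^+ 2) ->
  Ex P (fun w => shifted_sum L g (select Y k w) ^+ 2) -
  Ex P (fun w => shifted_sum L g (select Y k w)) ^+ 2 <= c ^+ 2 * D ^+ 2 * L%:R.
Proof.
move=> ki bg c0 dl0 hD hinf.
have D0 : 0 <= D by have := hD 0%N; rewrite big_ord0.
have inner m : \sum_(r < L) (if (r <= m)%N then dl (m - r)%N else 0) <= D.
  apply: (@le_trans _ _ (\sum_(r < m.+1) (if (r <= m)%N then dl (m - r)%N else 0))).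
    apply: (@sum_widen_zero L m.+1 (fun r => if (r <= m)%N then dl (m - r)%N else 0)).
      by move=> r; case: ifP.
    by move=> r; rewrite leqNgt ltnS => /negbTE ->.
  rewrite (reindex_inj rev_ord_inj)/=; apply: le_trans (hD m.+1).
  apply: ler_sum => j _; rewrite subSS leq_subr.
  by have /ltnSE jm := ltn_ord j; rewrite subKn.
have outer r M : \sum_(m < M) (if (r <= m)%N then dl (m - r)%N else 0) <= D.
  apply: (@le_trans _ _ (\sum_(m < r + M) (if (r <= m)%N then dl (m - r)%N else 0))).
    by rewrite addnC big_split_ord/= lerDl sumr_ge0// => i _; case: ifP.
  rewrite big_split_ord/= big1 ?add0r; last first.
    by move=> i _; rewrite leqNgt ltn_ord.
  apply: le_trans (hD M); apply: ler_sum => j _.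
  by rewrite leq_addr addKn.
apply: (@le_trans _ _ (2 * (c ^+ 2 * D ^+ 2 * L%:R) / 2)); last first.
  by rewrite le_eqVlt; apply/orP; left; apply/eqP; field.
apply: efron_stein => //; first exact: bounded_measurable_shifted_sum.
move=> M; apply: (@le_trans _ _ (\sum_(m < M) c ^+ 2 * D *
    \sum_(r < L) (if (r <= m)%N then dl (m - r)%N else 0))).
  apply: ler_sum => m _.
  apply: le_trans (influence_shifted_sum L m ki bg c0 dl0 hinf) _.
  rewrite (_ : \sum_(r < L) _ = c * \sum_(r < L) (if (r <= m)%N then dl (m - r)%N else 0)).
    rewrite exprMn -mulrA ler_wpM2l ?sqr_ge0// expr2 ler_wpM2r ?inner//.
    by rewrite sumr_ge0// => r _; case: ifP.
  by rewrite mulr_sumr; apply: eq_bigr => r _; case: ifP; rewrite ?mulr0.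
rewrite -mulr_sumr exchange_big/=.
apply: (@le_trans _ _ (c ^+ 2 * D * (D * L%:R))); last first.
  rewrite (_ : 2 * _ = c ^+ 2 * D * (D * L%:R) + c ^+ 2 * D * (D * L%:R)); last ring.
  by rewrite lerDl !mulr_ge0// sqr_ge0.
rewrite ler_wpM2l ?mulr_ge0 ?sqr_ge0//.
apply: (@le_trans _ _ (\sum_(r < L) D)); first by apply: ler_sum => r _; exact: outer.
by rewrite sumr_const card_ord mulr_natr.
Qed.

End ShiftedSums.

(** * A maximal inequality for partial sums *)

Section Dyadic.
Context (R : realType).
Implicit Types x : nat -> R.

Definition block x (a n : nat) : R := \sum_(i < n) x (a + i)%N.

Lemma blockD x a n m : block x a (n + m) = block x a n + block x (a + n) m.
Proof.
rewrite /block big_split_ord/=; congr (_ + _).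
by apply: eq_bigr => i _; rewrite addnA.
Qed.

(** The quadratic form that dominates the squares of all partial sums of x over
    initial segments of [a, a + 2^k). *)
Fixpoint dyadic_squares x (k a : nat) : R :=
  if k is k'.+1 then
    dyadic_squares x k' a + dyadic_squares x k' (a + 2 ^ k')%N + block x a (2 ^ k) ^+ 2
  else block x a 1 ^+ 2.

Lemma dyadic_squares_ge x k a : block x a (2 ^ k) ^+ 2 <= dyadic_squares x k a.
Proof.
elim: k a => [|k IH] a //=.
by rewrite lerDr addr_ge0// (le_trans _ (IH _))// sqr_ge0.
Qed.

(** An initial segment is a disjoint union of dyadic blocks, at most one of each
    size, whence the Rademacher-Menshov bound. *)
Lemma block_sqr_le x k a j : (j <= 2 ^ k)%N ->
  block x a j ^+ 2 <= k.+1%:R * dyadic_squares x k a.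
Proof.
have Q0 l b : 0 <= dyadic_squares x l b.
  by rewrite (le_trans _ (dyadic_squares_ge _ _ _))// sqr_ge0.
elim: k a j => [|k IH] a j.
  rewrite expn0 leq_eqVlt ltnS leqn0 => /orP[/eqP ->|/eqP ->]; rewrite mul1r//.
  by rewrite /block big_ord0 expr0n/= sqr_ge0.
move=> jk; rewrite /=.
have h1 : (0 : R) < k.+1%:R by rewrite ltr0n.
have [jk'|kj] := leqP j (2 ^ k).
  apply: le_trans (IH a j jk') _.
  apply: ler_pM => //; first by rewrite ler_nat.
  by rewrite -addrA lerDl addr_ge0// sqr_ge0.
have -> : j = (2 ^ k + (j - 2 ^ k))%N by lia.
rewrite blockD; set X := block x a _; set Z := block x _ _.
have hZ : Z ^+ 2 <= k.+1%:R * dyadic_squares x k (a + 2 ^ k)%N.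
  by apply: IH; move: jk; rewrite expnS; lia.
have hX : X ^+ 2 <= dyadic_squares x k a by exact: dyadic_squares_ge.
have hW := sqr_ge0 (block x a (2 ^ k.+1)).
have hXZ : (X + Z) ^+ 2 <= k.+2%:R * (X ^+ 2 + k.+1%:R^-1 * Z ^+ 2).
  rewrite -subr_ge0 (_ : _ - _ = k.+1%:R^-1 * (k.+1%:R * X - Z) ^+ 2).
    by rewrite mulr_ge0 ?sqr_ge0// invr_ge0 ltW.
  by rewrite -(natr1 k.+1); field; rewrite gt_eqF.
apply: le_trans hXZ _; rewrite ler_wpM2l//.
have : k.+1%:R^-1 * Z ^+ 2 <= dyadic_squares x k (a + 2 ^ k)%N.
  by rewrite mulrC ler_pdivrMr// mulrC.
by move=> hz; rewrite -[leLHS]addr0 lerD// lerD.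
Qed.

End Dyadic.

Lemma Ex_dyadic_squares (R : realType) d (T : measurableType d) (P : probability T R)
    (x : nat -> T -> R) (c : R) k a : (forall i, bounded_measurable (x i)) ->
  (forall b n, Ex P (fun w => block (x ^~ w) b n ^+ 2) <= c * n%:R) ->
  Ex P (fun w => dyadic_squares (x ^~ w) k a) <= k.+1%:R * (c * (2 ^ k)%:R) /\
  bounded_measurable (fun w => dyadic_squares (x ^~ w) k a).
Proof.
move=> bx hc.
have bb b n : bounded_measurable (fun w => block (x ^~ w) b n ^+ 2).
  by apply/bounded_measurableX/bounded_measurable_sum.
elim: k a => [|k IH] a; first by rewrite mul1r expn0; split; [exact: hc|exact: bb].
have [h1 b1] := IH a; have [h2 b2] := IH (a + 2 ^ k)%N.
split => /=; last by do 2!apply: bounded_measurableD => //.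
rewrite ExD//; last exact: bounded_measurableD.
rewrite ExD//; have := hc a (2 ^ k.+1)%N.
rewrite expnS natrM -(natr1 k.+1) => h3.
have := lerD (lerD h1 h2) h3; rewrite /= => h; apply: le_trans h _.
rewrite le_eqVlt; apply/orP; left; apply/eqP; ring.
Qed.

(** * Pasts of the innovations *)

Section Past.
Context (R : realType) d (T : measurableType d) (P : probability T R).
Variables (eps : int -> {RV P >-> R}) (eps' : {RV P >-> R}).
Hypothesis eps_iid : iid (innovations eps eps').
Local Notation innov := (innovations eps eps').
Local Notation past := (past eps).
Local Notation coupled_past := (coupled_past eps eps').

Definition past_index (i : int) (j : nat) : option int := Some (i - j%:Z).

Lemma past_index_inj i : injective (past_index i).
Proof. by move=> j j' [] /addrI /oppr_inj []. Qed.

Lemma past_select i : past i = select innov (past_index i).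
Proof. by []. Qed.

Lemma measurable_past i : measurable_fun setT (past i).
Proof. by apply: measurable_into_history => j; exact: measurable_funP. Qed.

Definition coupled_index (k j : nat) : option int :=
  if j == k then None else Some (k%:Z - j%:Z).

Lemma coupled_index_inj k : injective (coupled_index k).
Proof.
move=> j j'; rewrite /coupled_index; case: eqP => [->|_]; case: eqP => [->|_] //.
by case=> /addrI /oppr_inj [].
Qed.

Lemma coupled_past_select k : coupled_past k = select innov (coupled_index k).
Proof.
by apply/funext => w; apply/funext => j; rewrite /select /coupled_index /coupled_past;
  case: eqP.
Qed.

Lemma measurable_coupled_past k : measurable_fun setT (coupled_past k).
Proof. by rewrite coupled_past_select; exact: measurable_select. Qed.

(** The coupling between the past at time m and the past with the innovation of
    time 0 renewed has the law of a history and of its resampling at lag m. *)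
Lemma influence_coupled k (F : history R -> R) m : injective k -> bounded_measurable F ->
  influence innov k F m =
  Ex P (fun w => (F (past m%:Z w) - F (coupled_past m w)) ^+ 2).
Proof.
move=> ki bF.
(* even indices read the past of time m; the odd ones are innovations after m, except
   for the copy at lag m, which is the one that coupled_past uses *)
pose k' i := if i == (2 * m).+1 then None else
  if odd i then Some (m.+1 + i)%:Z else Some (m%:Z - i./2%:Z).
have k'i : injective k'.
  move=> i j; rewrite /k'.
  case: eqP => [->|im]; case: eqP => [->|jm] //; do !case: ifP => //; move=> oi oj [];
  lia.
rewrite (influence_select eps_iid m ki k'i bF) /influence coupled_past_select past_select.
congr Ex; apply/funext => w; congr ((F _ - F _) ^+ 2); apply/funext => j;
  rewrite /select /= /k' /first_copy /resampled_copy.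
  case: eqP => [|_]; first lia.
  by rewrite mul2n odd_double doubleK.
rewrite /coupled_index; case: (j =P m) => [->|jm]; first by rewrite eqxx.
case: eqP => [|_]; first lia.
by rewrite mul2n odd_double doubleK.
Qed.

Lemma past_pred i w : past (i - 1) w = reindex succn (past i w).
Proof.
by apply/funext => j; rewrite /reindex /Defs.past; congr (eps _ w); lia.
Qed.

Lemma past_shift i r w : past (i - r%:Z) w = reindex (addn r) (past i w).
Proof.
by apply/funext => j; rewrite /reindex /Defs.past; congr (eps _ w); lia.
Qed.

End Past.

(** * Exponential inequality for sums of centred indicators *)

Section ExpBounds.
Context (R : realType).
Implicit Types x p : R.

Lemma expR_le_quadratic x : `|x| <= 2^-1 -> expR x <= 1 + x + 2 * x ^+ 2.
Proof.
rewrite ler_norml => /andP[x1 x2].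
have x3 : 0 < 1 - x by lra.
have h : expR x <= (1 - x)^-1.
  rewrite -[expR x]invrK -expRN lef_pV2 ?posrE ?expR_gt0//.
  exact: expR_ge1Dx.
apply: le_trans h _; rewrite -[_^-1]mul1r ler_pdivrMr//.
have : 0 <= x ^+ 2 * (1 - 2 * x) by rewrite mulr_ge0 ?sqr_ge0//; lra.
lra.
Qed.

(** The exponential moment of a centred Bernoulli variable of parameter p, whose
    variance is at most p. *)
Lemma exp_bernoulli_le (x p v : R) : `|x| <= 2^-1 -> 0 <= p -> p <= v ->
  expR (- (x * p)) * (1 + (expR x - 1) * p) <= expR (2 * x ^+ 2 * v).
Proof.
move=> hx p0 pv.
have h1 : 1 + (expR x - 1) * p <= expR ((expR x - 1) * p) by exact: expR_ge1Dx.
apply: (@le_trans _ _ (expR (- (x * p)) * expR ((expR x - 1) * p))).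
  by rewrite ler_wpM2l// expR_ge0.
rewrite -expRD ler_expR.
have h2 := expR_le_quadratic hx.
have h3 : 0 <= 2 * x ^+ 2 by rewrite mulr_ge0// sqr_ge0.
apply: (@le_trans _ _ (2 * x ^+ 2 * p)); last by rewrite ler_wpM2l.
have : (expR x - 1 - x) * p <= 2 * x ^+ 2 * p by rewrite ler_wpM2r//; lra.
lra.
Qed.

End ExpBounds.

Section Predictor.
Context (R : realType) d (T : measurableType d) (P : probability T R).
Variables (eps : int -> {RV P >-> R}) (eps' : {RV P >-> R}).
Hypothesis eps_iid : iid (innovations eps eps').
Local Notation innov := (innovations eps eps').
Local Notation past := (past eps).

(** The same version p serves at all times and has values in [0, v] everywhere; v
    plays the role of a bound for the conditional variances. *)
Definition predictor (E : set (history R)) (p : history R -> R) (v : R) : Prop :=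
  [/\ measurable E, measurable_fun setT p, forall u, 0 <= p u, forall u, p u <= v &
      forall i : int, is_cond_prob P (past i @^-1` E) (past (i - 1)) p].

Variables (E : set (history R)) (p : history R -> R) (v : R).
Hypothesis pE : predictor E p v.

Lemma predictor_bounded : bounded_measurable p.
Proof.
have [_ mp p0 pv _] := pE; split => //; exists v => u.
by rewrite ger0_norm.
Qed.

Lemma bounded_measurable_past i (F : history R -> R) : bounded_measurable F ->
  bounded_measurable (fun w => F (past i w)).
Proof. exact/bounded_measurable_comp/measurable_past. Qed.

Lemma measurable_past_preimage i B : measurable B -> measurable (past i @^-1` B).
Proof. by move=> mB; rewrite -[X in measurable X]setTI; exact: measurable_past. Qed.

(** The defining property of conditional probabilities, extended from events of the
    past to bounded functions of the past. *)
Lemma Ex_predictor i (F : history R -> R) : bounded_measurable F ->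
  Ex P (fun w => \1_E (past i w) * F (past (i - 1) w)) =
  Ex P (fun w => p (past (i - 1) w) * F (past (i - 1) w)).
Proof.
move=> bF; have [mE mp p0 pv cp] := pE.
have bp := predictor_bounded.
have b1 : bounded_measurable (\1_E : history R -> R) by exact: bounded_measurable_indic.
have bl (G : history R -> R) : bounded_measurable G ->
    bounded_measurable (fun w => \1_E (past i w) * G (past (i - 1) w)).
  by move=> bG; apply: bounded_measurableM; exact: bounded_measurable_past.
have br (G : history R -> R) : bounded_measurable G ->
    bounded_measurable (fun w => p (past (i - 1) w) * G (past (i - 1) w)).
  by move=> bG; apply: bounded_measurableM; exact: bounded_measurable_past.
pose L (G : history R -> R) := Ex P (fun w => \1_E (past i w) * G (past (i - 1) w)) -
  Ex P (fun w => p (past (i - 1) w) * G (past (i - 1) w)).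
suff : (fun _ : nat => L F) @ \oo --> (0 : R).
  by move=> /(cvg_lim (@Rhausdorff R)); rewrite lim_cst// => /eqP; rewrite subr_eq0 => /eqP.
have v0 : 0 <= v by exact: le_trans (p0 (fun=> 0)) (pv _).
apply: (@bounded_measurable_limit R _ (history R) (fun=> L) (1 + v)) => //.
- move=> _ f g bf bg; rewrite /L.
  under [X in Ex P X - _]eq_fun do rewrite mulrDr.
  under [X in _ - Ex P X]eq_fun do rewrite mulrDr.
  by rewrite !ExD; [ring|exact: br|exact: br|exact: bl|exact: bl].
- move=> _ c f bf; rewrite /L.
  under [X in Ex P X - _]eq_fun do rewrite mulrCA.
  under [X in _ - Ex P X]eq_fun do rewrite mulrCA.
  by rewrite !ExZ; [ring|exact: br|exact: bl].
- move=> _ f M bf fM; rewrite (le_trans (ler_normB _ _))// mulrDl.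
  apply: lerD; apply: Ex_norm_le; rewrite ?mul1r; [exact: bl| |exact: br|].
    move=> w; rewrite normrM indicE.
    by case: (_ \in _); rewrite ?normr1 ?normr0 ?mul1r ?mul0r// (le_trans _ (fM (fun=> 0))).
  by move=> w; rewrite normrM ler_pM// ger0_norm.
- move=> B mB; rewrite (_ : (fun _ => _) = fun=> 0); first exact: cvg_cst.
  apply/funext => _; rewrite /L.
  have [_ /(_ B mB)] := cp i.
  rewrite (_ : (fun w => \1_E (past i w) * _) =
    \1_(past i @^-1` E `&` past (i - 1) @^-1` B)); last first.
    by apply/funext => w; rewrite indicI.
  rewrite Ex_indic; last by apply: measurableI; exact: measurable_past_preimage.
  move=> ->; rewrite integral_mkcond /Ex /Rintegral.
  apply/eqP; rewrite subr_eq0; apply/eqP; congr fine; apply: eq_integral => w _.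
  have eB : (past (i - 1) w \in B) = (w \in past (i - 1) @^-1` B) by [].
  by rewrite patchE indicE eB; case: ifP; rewrite ?mulr1 ?mulr0.
Qed.

Lemma Ex_exp_step i (F : history R -> R) (x : R) : `|x| <= 2^-1 ->
  bounded_measurable F -> (forall u, 0 <= F u) ->
  Ex P (fun w => F (past (i - 1) w) *
    expR (x * (\1_E (past i w) - p (past (i - 1) w)))) <=
  expR (2 * x ^+ 2 * v) * Ex P (fun w => F (past (i - 1) w)).
Proof.
move=> hx bF F0; have [mE mp p0 pv cp] := pE.
have bp := predictor_bounded.
pose F' u := expR (- (x * p u)) * F u.
have bF' : bounded_measurable F'.
  apply: bounded_measurableM => //.
  rewrite (_ : (fun u => _) = (fun u => expR ((- x) * p u))).
    by apply: bounded_measurable_expR; exact: bounded_measurableZ.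
  by apply/funext => u; rewrite mulNr.
have b1 : bounded_measurable (fun w => F' (past (i - 1) w)).
  exact: bounded_measurable_past.
have b2 : bounded_measurable (fun w => \1_E (past i w) * F' (past (i - 1) w)).
  apply: bounded_measurableM => //.
  apply: (bounded_measurable_comp (f := \1_E) (h := past i)).
    exact: measurable_past.
  exact: bounded_measurable_indic.
have b3 : bounded_measurable (fun w => p (past (i - 1) w) * F' (past (i - 1) w)).
  by apply: bounded_measurableM => //; exact: bounded_measurable_past.
rewrite (_ : (fun w => _ * expR _) = (fun w => F' (past (i - 1) w) +
   (expR x - 1) * (\1_E (past i w) * F' (past (i - 1) w)))); last first.
  apply/funext => w; rewrite /F' indicE mulrBr.
  case: (_ \in _); rewrite ?mulr1 ?mulr0 ?mul1r ?mul0r ?mulr0 ?addr0 ?sub0r.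
    by rewrite expRD; ring.
  by rewrite mulrC.
rewrite ExD//; last exact: bounded_measurableZ.
rewrite ExZ// Ex_predictor// -ExZ// -ExD//; last exact: bounded_measurableZ.
rewrite -ExZ; last exact: bounded_measurable_past.
apply: le_Ex.
- by apply: bounded_measurableD => //; exact: bounded_measurableZ.
- by apply: bounded_measurableZ; exact: bounded_measurable_past.
move=> w; rewrite /F'; set u := past (i - 1) w.
rewrite (_ : _ + _ = expR (- (x * p u)) * (1 + (expR x - 1) * p u) * F u); last ring.
by rewrite ler_wpM2r// exp_bernoulli_le.
Qed.

End Predictor.

Section ExponentialInequality.
Context (R : realType) d (T : measurableType d) (P : probability T R).
Variables (eps : int -> {RV P >-> R}) (eps' : {RV P >-> R}).
Hypothesis eps_iid : iid (innovations eps eps').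
Local Notation past := (past eps).
Variables (E : nat -> set (history R)) (p : nat -> history R -> R) (v : R).
Hypothesis pE : forall i, predictor eps (E i) (p i) v.
Variable c : nat -> R.
Hypothesis c1 : forall i, `|c i| <= 1.

Definition innovation_term (i : nat) (w : T) : R :=
  c i * (\1_(E i) (past i%:Z w) - p i (past (i%:Z - 1) w)).

(** Exponential moments multiply along the sequence because each term is centred
    given the past.  The induction carries the fact that the partial sum is itself
    a function of the past, as conditioning on the past requires. *)
Lemma Ex_exp_sum (a m : nat) (x : R) : `|x| <= 2^-1 ->
  (exists F : history R -> R, [/\ bounded_measurable F, forall u, 0 <= F u &
    forall w, expR (x * block (innovation_term ^~ w) a m) =
      F (past ((a + m)%:Z - 1) w)]) /\
  Ex P (fun w => expR (x * block (innovation_term ^~ w) a m)) <=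
  expR (2 * x ^+ 2 * v * m%:R).
Proof.
move=> hx.
have v0 : 0 <= v.
  by have [_ _ p0 pv _] := pE 0; exact: le_trans (p0 (fun=> 0)) (pv _).
elim: m => [|m [[F [bF F0 eF]] IH]].
  rewrite /block; split.
    exists (fun=> 1); split => //; first exact: bounded_measurable_cst.
    by move=> w; rewrite big_ord0 mulr0 expR0.
  rewrite (_ : (fun w => _) = fun=> 1) ?Ex_cst ?mulr0 ?expR0//.
  by apply/funext => w; rewrite big_ord0 mulr0 expR0.
pose j := (a + m)%N.
have hcx : `|x * c j| <= 2^-1.
  by rewrite normrM -[leRHS]mulr1 ler_pM.
have eS w : expR (x * block (innovation_term ^~ w) a m.+1) = F (past (j%:Z - 1) w) *
    expR ((x * c j) * (\1_(E j) (past j%:Z w) - p j (past (j%:Z - 1) w))).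
  rewrite /block big_ord_recr/= mulrDr expRD eF; congr (_ * expR _).
  by rewrite /innovation_term mulrA.
split.
  exists (fun u => F (reindex succn u) *
    expR ((x * c j) * (\1_(E j) u - p j (reindex succn u)))); split.
  - have bR (G : history R -> R) : bounded_measurable G -> bounded_measurable (fun u : history R => G (reindex succn u)).
      move=> bG; apply: (bounded_measurable_comp (h := reindex succn) (f := G)) => //.
      exact: measurable_reindex.
    apply: bounded_measurableM; first exact: bR.
    apply/bounded_measurable_expR/bounded_measurableZ/bounded_measurableB.
      by apply: bounded_measurable_indic; have [] := pE j.
    exact/bR/(predictor_bounded (pE j)).
  - by move=> u; rewrite mulr_ge0// expR_ge0.
  - move=> w; rewrite eS -!past_pred.
    by rewrite (_ : (a + m.+1)%:Z - 1 = j%:Z :> int)// /j; lia.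
under eq_fun do rewrite eS.
apply: (le_trans (Ex_exp_step (pE j) _ hcx bF F0)).
under eq_fun do rewrite -eF.
rewrite (_ : 2 * x ^+ 2 * v * m.+1%:R = 2 * x ^+ 2 * v + 2 * x ^+ 2 * v * m%:R); last first.
  by rewrite -natr1; ring.
rewrite expRD ler_pM ?expR_ge0//.
  by apply: Ex_ge0 => w; exact: expR_ge0.
rewrite ler_expR ler_wpM2r// ler_wpM2l// exprMn -[leRHS]mulr1 ler_wpM2l ?sqr_ge0//.
by rewrite -[_ ^+ 2]ger0_norm ?sqr_ge0// normrX expr_le1.
Qed.

Lemma bounded_measurable_innovation_sum a m :
  bounded_measurable (fun w => block (innovation_term ^~ w) a m).
Proof.
apply: bounded_measurable_sum => i _; apply/bounded_measurableZ/bounded_measurableB.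
  apply: (bounded_measurable_comp (f := \1_(E (a + i))) (h := past (a + i)%N)).
    exact: measurable_past.
  by apply: bounded_measurable_indic; have [] := pE (a + i).
exact/bounded_measurable_past/(predictor_bounded (pE _)).
Qed.

(** Chernoff's bound for the sum and for its opposite. *)
Lemma innovation_sum_tail a m (x l : R) : 0 < x -> x <= 2^-1 ->
  (P [set w | (l <= `|block (innovation_term ^~ w) a m|)%R] <=
  (2 * expR (2 * x ^+ 2 * v * m%:R - x * l))%:E)%E.
Proof.
move=> x0 hx; pose S w := block (innovation_term ^~ w) a m.
have bS : bounded_measurable S by exact: bounded_measurable_innovation_sum.
have half (y : R) : `|y| <= 2^-1 -> (P [set w | (expR (x * l) <= expR (y * S w))%R] <=
    (expR (2 * y ^+ 2 * v * m%:R - x * l))%:E)%E.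
  move=> hy; have [_ h] := Ex_exp_sum a m hy.
  have b : bounded_measurable (fun w => expR (y * S w)).
    exact/bounded_measurable_expR/bounded_measurableZ.
  apply: le_trans (markov_Ex P (expR_gt0 _) b (fun w => expR_ge0 _)) _.
  by rewrite lee_fin expRD expRN ler_wpM2r// invr_ge0 expR_ge0.
have hx1 : `|x| <= 2^-1 by rewrite gtr0_norm.
have hx2 : `|- x| <= 2^-1 by rewrite normrN.
have mh y : measurable [set w | expR (x * l) <= expR (y * S w)].
  apply: measurable_le_set => //.
  exact: (bounded_measurable_expR (bounded_measurableZ y bS)).1.
apply: (@le_trans _ _ (P ([set w | expR (x * l) <= expR (x * S w)] `|`
    [set w | expR (x * l) <= expR ((- x) * S w)]))).
  apply: le_measure; rewrite ?inE.
  - apply: measurable_le_set => //.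
    by apply: measurableT_comp => //; exact: bS.1.
  - exact: measurableU.
  move=> w /=; rewrite !ler_expR mulNr -mulrN !ler_pM2l//.
  by rewrite ler_normr => /orP.
apply: le_trans (measureU2 _ _ _) _ => //.
rewrite mulr2n mulrDl mul1r EFinD; apply: leeD; first exact: half.
by have := half _ hx2; rewrite sqrrN.
Qed.

End ExponentialInequality.

Section PartialSums.
Context (R : realType) d (T : measurableType d) (P : probability T R).
Variables (eps : int -> {RV P >-> R}) (eps' : {RV P >-> R}).
Hypothesis eps_iid : iid (innovations eps eps').
Local Notation innov := (innovations eps eps').
Local Notation past := (past eps).
Variables (E : nat -> set (history R)) (p : nat -> history R -> R) (v : R).
Hypothesis pE : forall i, predictor eps (E i) (p i) v.
Variable c : nat -> R.
Hypothesis c1 : forall i, `|c i| <= 1.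
Variables (dl : nat -> R) (h D : R).
Hypothesis h0 : 0 <= h.
Hypothesis dl0 : forall j, 0 <= dl j.
Hypothesis dlD : forall M, \sum_(j < M) dl j <= D.
Hypothesis p_stable : forall i k,
  Ex P (fun w => (p i (past k%:Z w) - p i (coupled_past eps eps' k w)) ^+ 2) <=
  (h * dl k) ^+ 2.

Definition prediction_term (i : nat) (w : T) : R :=
  c i * (p i (past (i%:Z - 1) w) - fine (P (past i%:Z @^-1` E i))).

Definition centred_term (i : nat) (w : T) : R :=
  c i * (\1_(E i) (past i%:Z w) - fine (P (past i%:Z @^-1` E i))).

Lemma Ex_prediction i : Ex P (fun w => p i (past (i%:Z - 1) w)) =
  fine (P (past i%:Z @^-1` E i)).
Proof.
have [mE _ _ _ _] := pE i.
have := Ex_predictor (pE i) i%:Z (bounded_measurable_cst _ 1).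
under eq_fun do rewrite mulr1.
under [X in _ = Ex P X]eq_fun do rewrite mulr1.
by move=> <-; rewrite -Ex_indic//; exact: measurable_past_preimage.
Qed.

Lemma bounded_measurable_prediction_term i : bounded_measurable (prediction_term i).
Proof.
apply/bounded_measurableZ/bounded_measurableB; last exact: bounded_measurable_cst.
exact/bounded_measurable_past/(predictor_bounded (pE i)).
Qed.

(** Read from its last index backwards, the block is a sum of functions of shifts
    of one history. *)
Lemma Ex_sqr_prediction_block a n :
  Ex P (fun w => block (prediction_term ^~ w) a n ^+ 2) <= h ^+ 2 * D ^+ 2 * n%:R.
Proof.
pose q i u := c i * p i u.
pose g r := q (a + n - r.+1)%N.
have bq i : bounded_measurable (q i).
  exact/bounded_measurableZ/(predictor_bounded (pE i)).
have bg r : bounded_measurable (g r) by exact: bq.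
pose top : int := (a + n)%:Z - 2.
have eS w : \sum_(i < n) q (a + i)%N (past ((a + i)%:Z - 1) w) =
    shifted_sum n g (select innov (past_index top) w).
  rewrite /shifted_sum (reindex_inj rev_ord_inj)/=; apply: eq_bigr => r _.
  rewrite /g (_ : (a + (n - r.+1) = a + n - r.+1)%N); last by have := ltn_ord r; lia.
  congr (q _ _); rewrite -past_select -past_shift; congr (past _ w).
  by rewrite /top; have := ltn_ord r; lia.
have eN w : block (prediction_term ^~ w) a n =
    shifted_sum n g (select innov (past_index top) w) -
    Ex P (fun w => shifted_sum n g (select innov (past_index top) w)).
  under [X in _ - Ex P X]eq_fun do rewrite -eS.
  rewrite -eS Ex_sum; last by move=> i; exact: bounded_measurable_past.
  rewrite /block -sumrB; apply: eq_bigr => i _.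
  rewrite /prediction_term mulrBr; congr (_ - _).
  by rewrite ExZ ?Ex_prediction//; exact/bounded_measurable_past/(predictor_bounded (pE _)).
under eq_fun do rewrite eN.
set Z := fun w => shifted_sum n g (select innov (past_index top) w).
have bZ : bounded_measurable Z.
  apply: (bounded_measurable_comp (h := select innov (past_index top))).
    exact: measurable_select.
  exact: bounded_measurable_shifted_sum.
have -> : Ex P (fun w => (Z w - Ex P Z) ^+ 2) = Ex P (fun w => Z w ^+ 2) - Ex P Z ^+ 2.
  rewrite (_ : (fun w => _) = (fun w => Z w ^+ 2 + ((- (2 * Ex P Z)) * Z w + Ex P Z ^+ 2))).
    have bc := bounded_measurable_cst T (Ex P Z ^+ 2).
    rewrite ExD; [|exact: bounded_measurableX|].
      rewrite ExD//; last exact: bounded_measurableZ.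
      by rewrite ExZ// Ex_cst; ring.
    by apply: bounded_measurableD => //; exact: bounded_measurableZ.
  by apply/funext => w; ring.
apply: (@variance_shifted_sum _ _ _ P _ innov eps_iid (past_index top) n g dl h D
  (@past_index_inj top) bg h0 dl0 dlD) => r k.
rewrite (influence_coupled eps_iid _ (@past_index_inj top) (bg r)).
apply: le_trans (p_stable (a + n - r.+1)%N k).
have bp := predictor_bounded (pE (a + n - r.+1)).
have bd : bounded_measurable (fun w => p (a + n - r.+1)%N (past k%:Z w) -
    p (a + n - r.+1)%N (coupled_past eps eps' k w)).
  apply: bounded_measurableB; first exact: bounded_measurable_past.
  by apply: bounded_measurable_comp bp; exact: measurable_coupled_past.
apply: le_Ex; [|exact: bounded_measurableX|].
  apply/bounded_measurableX/bounded_measurableB; first exact: bounded_measurable_past.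
  by apply: bounded_measurable_comp (bg r); exact: measurable_coupled_past.
move=> w; rewrite /g /q -mulrBr exprMn -[leRHS]mul1r ler_wpM2r ?sqr_ge0//.
by rewrite -[_ ^+ 2]ger0_norm ?sqr_ge0// normrX expr_le1.
Qed.

(** An indicator minus its probability is an innovation plus a prediction error;
    the innovations are controlled by the exponential inequality at each endpoint,
    the predictions by their second moments at all endpoints at once. *)
Lemma partial_sums_tail (a m k : nat) (x l1 l2 : R) : 0 < x -> x <= 2^-1 ->
  0 < l2 -> (m <= 2 ^ k)%N ->
  exists B : set T, [/\ measurable B,
    (P B <= (m.+1%:R * (2 * expR (2 * x ^+ 2 * v * m%:R - x * l1)) +
      k.+1%:R ^+ 2 * (h ^+ 2 * D ^+ 2) * (2 ^ k)%:R / l2 ^+ 2)%:E)%E &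
    forall w, ~ B w -> forall j, (j <= m)%N ->
      `|block (centred_term ^~ w) a j| <= l1 + l2].
Proof.
move=> x0 hx l20 mk.
have v0 : 0 <= v.
  by have [_ _ p0 pv _] := pE 0; exact: le_trans (p0 (fun=> 0)) (pv _).
pose M j w := block (innovation_term eps E p c ^~ w) a j.
pose Q w := dyadic_squares (prediction_term ^~ w) k a.
have [hQ bQ] := Ex_dyadic_squares k a bounded_measurable_prediction_term
  Ex_sqr_prediction_block.
have bM j : bounded_measurable (M j) by exact: bounded_measurable_innovation_sum.
have mge (f : T -> R) (y : R) : bounded_measurable f -> measurable [set w | y <= f w].
  move=> bf; apply: measurable_le_set => //.
  exact: bf.1.
pose BM j := [set w | l1 <= `|M j w|].
have mBM j : measurable (BM j).
  apply: mge; have [mf [N MN]] := bM j; split; first exact: measurableT_comp.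
  by exists N => w; rewrite normr_id.
pose BQ := [set w | l2 ^+ 2 / k.+1%:R <= Q w].
have mBQ : measurable BQ by exact: mge.
have Q0 w : 0 <= Q w.
  by rewrite (le_trans _ (dyadic_squares_ge _ _ _))// sqr_ge0.
exists (\big[setU/set0]_(j < m.+1) BM j `|` BQ); split.
- by apply: measurableU => //; apply: bigsetU_measurable.
- apply: (le_trans (measureU2 _ _ _)) => //; first exact: bigsetU_measurable.
  rewrite EFinD; apply: leeD.
    apply: (le_trans (Boole_inequality P (fun i _ => mBM i))).
    apply: (@le_trans _ _ (\sum_(j < m.+1) (2 * expR (2 * x ^+ 2 * v * m%:R - x * l1))%:E)%E).
      apply: lee_sum => j _.
      apply: (@le_trans _ _ (2 * expR (2 * x ^+ 2 * v * j%:R - x * l1))%:E).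
        exact: (innovation_sum_tail pE c1).
      rewrite lee_fin ler_wpM2l// ler_expR lerD2r ler_wpM2l//.
        by rewrite mulr_ge0// mulr_ge0// sqr_ge0.
      by rewrite ler_nat -ltnS ltn_ord.
    by rewrite sumEFin sumr_const card_ord -[_ *+ m.+1]mulr_natl.
  have k0 : (0 : R) < k.+1%:R by rewrite ltr0n.
  have y0 : 0 < l2 ^+ 2 / k.+1%:R by rewrite divr_gt0// exprn_gt0.
  apply: (le_trans (markov_Ex P y0 bQ Q0)); rewrite lee_fin.
  rewrite ler_pdivrMr//; apply: le_trans hQ _.
  rewrite le_eqVlt; apply/orP; left; apply/eqP; field.
  by rewrite gt_eqF// gt_eqF.
- move=> w nB j jm.
  have h1 : `|M j w| < l1.
    rewrite ltNge; apply/negP => hj; apply: nB; left.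
    by rewrite -bigcup_mkord; exists j => //=.
  have h2 : Q w < l2 ^+ 2 / k.+1%:R.
    by rewrite ltNge; apply/negP => hj; apply: nB; right.
  have eD : block (centred_term ^~ w) a j = M j w + block (prediction_term ^~ w) a j.
    rewrite /M /block -big_split/=; apply: eq_bigr => i _.
    by rewrite /centred_term /innovation_term /prediction_term; ring.
  rewrite eD (le_trans (ler_normD _ _))// lerD// ?(ltW h1)//.
  rewrite -(@ler_pXn2r _ 2) ?nnegrE ?(ltW l20)// real_normK ?num_real//.
  apply: le_trans (block_sqr_le _ a (leq_trans jm mk)) _.
  rewrite mulrC -ler_pdivlMr ?ltr0n//; exact: ltW.
Qed.

End PartialSums.

(** * Conditional probabilities *)

Definition clamp (R : realType) (a b x : R) : R := Num.max a (Num.min b x).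

Section Clamp.
Context (R : realType).
Implicit Types a b x y : R.

Lemma clamp_ge a b x : a <= clamp a b x.
Proof. by rewrite le_max lexx. Qed.

Lemma clamp_le a b x : a <= b -> clamp a b x <= b.
Proof. by move=> ab; rewrite ge_max ab ge_min lexx. Qed.

Lemma clamp_id a b x : a <= x -> x <= b -> clamp a b x = x.
Proof. by move=> ax xb; rewrite /clamp (min_idPr xb) (max_idPr ax). Qed.

Lemma clamp_dist a b x y : `|clamp a b x - clamp a b y| <= `|x - y|.
Proof.
wlog xy : x y / x <= y.
  by move=> h; have [/h//|/ltW/h] := leP x y; rewrite distrC [leRHS]distrC.
rewrite [`|x - y|]distrC [leLHS]distrC [leRHS]ger0_norm ?subr_ge0//.
rewrite /clamp; have [?|?] := leP b x; have [?|?] := leP b y;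
  (try have [?|?] := leP a b); (try have [?|?] := leP a x);
  (try have [?|?] := leP a y); rewrite ?subrr ?normr0 ?subr_ge0//; try lra;
  rewrite ger0_norm; lra.
Qed.

Lemma measurable_clamp d (T : measurableType d) a b (f : T -> R) :
  measurable_fun setT f -> measurable_fun setT (fun u => clamp a b (f u)).
Proof. by move=> mf; apply: measurable_maxr => //; exact: measurable_minr. Qed.

End Clamp.

Section CondProb.
Context (R : realType) d (T : measurableType d) (P : probability T R).

Lemma integral_pos_eq0 (A : set T) (h : T -> R) : measurable A ->
  measurable_fun setT h -> (forall w, A w -> 0 < h w) ->
  (\int[P]_(w in A) (h w)%:E = 0)%E -> P A = 0%E.
Proof.
move=> mA mh hpos h0.
have mhA : measurable_fun A (EFin \o h).
  by apply/measurable_EFinP; apply: measurable_funTS.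
have /(ae_eq_integral_abs P mA mhA) : (\int[P]_(w in A) `|(EFin \o h) w| = 0)%E.
  rewrite -[RHS]h0; apply: eq_integral => w /set_mem Aw /=.
  by rewrite ger0_norm// ltW// hpos.
move=> [N [mN N0 AN]].
apply/eqP; rewrite eq_le measure_ge0 andbT -N0; apply: le_measure; rewrite ?inE//.
move=> w Aw; apply: AN => /= h1; have := hpos w Aw.
by have := h1 Aw; case=> ->; rewrite ltxx.
Qed.

Context d' (U : measurableType d') (Y : T -> U).
Hypothesis mY : measurable_fun setT Y.
Implicit Types (E : set T) (g : U -> R).

Let mpre B : measurable B -> measurable (Y @^-1` B).
Proof. by move=> mB; rewrite -[X in measurable X]setTI; exact: mY. Qed.

Let mgY g : measurable_fun setT g -> measurable_fun setT (fun w => g (Y w)).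
Proof. by move=> mg; exact: measurableT_comp. Qed.

Let mneq g g' : measurable_fun setT g -> measurable_fun setT g' ->
  measurable [set u | g u != g' u].
Proof.
move=> mg mg'.
have /measurable_EFinP mg1 := mg; have /measurable_EFinP mg2 := mg'.
have := measurable_neqe measurableT mg1 mg2.
rewrite setTI (_ : [set x | _ != _] = [set u | g u != g' u])//.
Qed.

Lemma cond_prob_ae_eq E g g' : is_cond_prob P E Y g -> measurable_fun setT g' ->
  P (Y @^-1` [set u | g u != g' u]) = 0%E -> is_cond_prob P E Y g'.
Proof.
move=> [mg hg] mg' gg'; split => // B mB; rewrite hg//.
apply: ae_eq_integral; first exact: mpre.
- by apply/measurable_EFinP; apply: measurable_funTS; exact: mgY.
- by apply/measurable_EFinP; apply: measurable_funTS; exact: mgY.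
- exists (Y @^-1` [set u | g u != g' u]); split => //; first exact/mpre/mneq.
  by move=> w /= h; apply/eqP => gw; apply: h => _; rewrite gw.
Qed.

Lemma cond_prob_neg E g : measurable E -> is_cond_prob P E Y g ->
  P (Y @^-1` [set u | g u < 0]) = 0%E.
Proof.
move=> mE [mg hg].
have mB : measurable [set u | g u < 0] by exact: measurable_lt_set.
have mA := mpre mB.
apply: (@integral_pos_eq0 _ (fun w => - g (Y w))) => //.
- by apply: measurable_funN; exact: mgY.
- by move=> w /=; rewrite oppr_gt0.
have h1 : (0 <= \int[P]_(w in Y @^-1` [set u | (g u < 0)%R]) (- g (Y w))%:E)%E.
  by apply: integral_ge0 => w /= Aw; rewrite lee_fin oppr_ge0 ltW.
apply/eqP; rewrite eq_le h1 andbT -oppe_ge0 -integral_ge0N; last first.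
  by move=> w /= Aw; rewrite lee_fin oppr_ge0 ltW.
under eq_integral do rewrite EFinN oppeK.
by rewrite -hg//.
Qed.

Lemma cond_prob_gt1 E g : measurable E -> is_cond_prob P E Y g ->
  P (Y @^-1` [set u | 1 < g u]) = 0%E.
Proof.
move=> mE [mg hg].
have mB : measurable [set u | 1 < g u] by exact: measurable_lt_set.
have mA := mpre mB.
have mg1 : measurable_fun setT (fun w => g (Y w) - 1).
  by apply: measurable_funB => //; exact: mgY.
apply: (@integral_pos_eq0 _ (fun w => g (Y w) - 1)) => //.
- by move=> w /=; rewrite subr_gt0.
have h1 : (0 <= \int[P]_(w in Y @^-1` [set u | (1 < g u)%R]) (g (Y w) - 1)%:E)%E.
  by apply: integral_ge0 => w /= Aw; rewrite lee_fin subr_ge0 ltW.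
apply/eqP; rewrite eq_le h1 andbT.
have : (P (E `&` Y @^-1` [set u | (1 < g u)%R]) <= P (Y @^-1` [set u | (1 < g u)%R]))%E.
  by apply: le_measure; rewrite ?inE//; exact: measurableI.
rewrite hg//.
rewrite (eq_integral (fun w => 1%:E + (g (Y w) - 1)%:E)%E); last first.
  by move=> w _; rewrite -EFinD addrC subrK.
rewrite ge0_integralD//.
- rewrite integral_cst// mul1e -[leRHS]adde0 leeD2lE// fin_num_measure//.
- by move=> w /= Aw; rewrite lee_fin subr_ge0 ltW.
- by apply/measurable_EFinP; exact: measurable_funTS.
Qed.

(** The values of a version lie outside [0, 1] with probability 0 only. *)
Lemma cond_prob_clamp E g : measurable E -> is_cond_prob P E Y g ->
  is_cond_prob P E Y (fun u => clamp 0 1 (g u)).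
Proof.
move=> mE cg; apply: (cond_prob_ae_eq cg).
  exact/measurable_clamp/cg.1.
have n1 := cond_prob_neg mE cg; have n2 := cond_prob_gt1 mE cg.
have mc := measurable_clamp 0 1 cg.1.
have m1 : measurable [set u | g u < 0] by apply: measurable_lt_set => //; exact: cg.1.
have m2 : measurable [set u | 1 < g u] by apply: measurable_lt_set => //; exact: cg.1.
apply/eqP; rewrite eq_le measure_ge0 andbT.
apply: (@le_trans _ _ (P (Y @^-1` [set u | g u < 0] `|` Y @^-1` [set u | 1 < g u]))).
  apply: le_measure; rewrite ?inE.
  - by apply/mpre/mneq => //; exact: cg.1.
  - by apply: measurableU; exact: mpre.
  move=> w /= h; apply/orP; rewrite -[_ || _]negbK negb_or -!leNgt.
  by apply/negP => /andP[h1 h2]; move: h; rewrite clamp_id ?eqxx.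
rewrite (measureU0 (mpre m1) (mpre m2) n2) le_eqVlt; apply/orP; left; apply/eqP.
exact: n1.
Qed.

Lemma cond_prob_diff E1 E2 g1 g2 : measurable E1 -> measurable E2 -> E1 `<=` E2 ->
  bounded_measurable g1 -> bounded_measurable g2 ->
  is_cond_prob P E1 Y g1 -> is_cond_prob P E2 Y g2 ->
  is_cond_prob P (E2 `\` E1) Y (fun u => g2 u - g1 u).
Proof.
move=> m1 m2 E12 b1 b2 [mg1 h1] [mg2 h2]; split; first exact: measurable_funB.
move=> B mB; have mB' := mpre mB.
have bi g : bounded_measurable g -> P.-integrable (Y @^-1` B) (EFin \o (fun w => g (Y w))).
  move=> bg; apply: (@integrableS _ _ _ _ setT) => //.
  by apply: bounded_measurable_integrable; exact: bounded_measurable_comp bg.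
rewrite (eq_integral (fun w => (g2 (Y w))%:E - (g1 (Y w))%:E)%E); last first.
  by move=> w _; rewrite EFinB.
rewrite integralB_EFin//; [|exact: bi..].
rewrite -h1// -h2//.
rewrite (_ : _ `&` _ = (E2 `&` Y @^-1` B) `\` (E1 `&` Y @^-1` B)); last first.
  apply/seteqP; split => w /=; first by move=> [[e2 e1] Bw]; split => // -[].
  by move=> [[e2 Bw] ne]; split => //; split => // e1; apply: ne.
have mI E : measurable E -> measurable (E `&` Y @^-1` B) by move=> mE; exact: measurableI.
rewrite measureD; [|exact: mI|exact: mI|by rewrite ltey_eq fin_num_measure//; exact: mI].
rewrite (_ : E2 `&` _ `&` _ = E1 `&` Y @^-1` B)//.
apply/seteqP; split => w /=; first by move=> [].
by move=> [e1 Bw]; split; split => //; exact: E12.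
Qed.

End CondProb.

(** * Regularity of functions known on the rationals *)

Section RationalBounds.
Context (R : realType).
Implicit Types (f : R -> R) (x y C : R).

Lemma rat_approx f x e : {for x, continuous f} -> 0 < e ->
  exists q : rat, [/\ x < ratr q, ratr q < x + e & `|f x - f (ratr q)| <= e].
Proof.
move=> cf e0.
have /cvgrPdist_le/(_ e e0) := cf; rewrite near_nbhs.
move=> /nbhs_ballP[r /= r0 hr].
have me : 0 < Num.min r e by rewrite lt_min r0.
have xm : x < x + Num.min r e by rewrite ltrDl.
have [q] := rat_in_itvoo xm.
rewrite in_itv/= => /andP[q1 q2]; exists q; split => //.
  by rewrite (lt_le_trans q2)// lerD2l ge_min lexx orbT.
apply: hr; rewrite /ball/= ltr_norml; apply/andP; split.
  rewrite ltrBrDl ltrBlDr (lt_le_trans q2)//.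
  by rewrite lerD2l ge_min lexx.
by rewrite (@lt_trans _ _ 0)// subr_lt0.
Qed.

Lemma rat_range f : (forall x, {for x, continuous f}) ->
  (forall q : rat, 0 <= f (ratr q) <= 1) -> forall x, 0 <= f x <= 1.
Proof.
move=> cf fq x; apply/andP; split; apply/ler_addgt0Pr => e e0;
  have [q [_ _]] := rat_approx (cf x) e0; have /andP[] := fq q;
  rewrite ler_norml => h1 h2 /andP[]; lra.
Qed.

(** Continuity transfers to real arguments an inequality which is known for
    countably many pairs, and which therefore holds off one null event. *)
Lemma rat_lipschitz f C : 0 <= C -> (forall x, {for x, continuous f}) ->
  (forall q r : rat, q <= r ->
     0 <= f (ratr r) - f (ratr q) <= C * (ratr r - ratr q)) ->
  forall x y, x <= y -> 0 <= f y - f x <= C * (y - x).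
Proof.
move=> C0 cf fqr x y; rewrite le_eqVlt => /predU1P[->|xy].
  by rewrite !subrr mulr0 lexx.
have key e : 0 < e -> - e <= f y - f x <= C * (y - x) + e.
  move=> e0; pose e1 := Num.min (y - x) (e / (2 + C)).
  have c2 : 0 < 2 + C by lra.
  have e10 : 0 < e1 by rewrite lt_min subr_gt0 xy divr_gt0.
  have e1y : e1 <= y - x by rewrite ge_min lexx.
  have e1e : e1 * (2 + C) <= e by rewrite -ler_pdivlMr// ge_min lexx orbT.
  have Ce : 0 <= C * e1 by rewrite mulr_ge0// ltW.
  have [q [q1 q2]] := rat_approx (cf x) e10.
  have [r [r1 r2]] := rat_approx (cf y) e10.
  rewrite !ler_norml => /andP[r3 r4] /andP[q3 q4].
  have qr : q <= r by rewrite -(ler_rat R); lra.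
  have /andP[h1 h2] := fqr q r qr.
  have : C * (ratr r - ratr q) <= C * (y - x + e1) by rewrite ler_wpM2l//; lra.
  by rewrite mulrDr => h3; apply/andP; split; nra.
apply/andP; split.
  apply/ler_addgt0Pr => e /key /andP[]; lra.
by apply/ler_addgt0Pr => e /key /andP[].
Qed.

Lemma derive1_bounds f C : (forall x, derivable f x 1) ->
  (forall x y, x <= y -> 0 <= f y - f x <= C * (y - x)) ->
  forall x, 0 <= derive1 f x <= C.
Proof.
move=> df fC x; rewrite derive1E.
have dfx : cvg ((fun h => h^-1 *: ((f \o shift x) (h *: 1) - f x)) @ 0^') by exact: df.
have q h : h != 0 -> 0 <= h^-1 *: ((f \o shift x) (h *: 1) - f x) <= C.
  move=> h0; rewrite /= /shift /GRing.scale/= mulr1.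
  case: (ltgtP h 0) h0 => // hs _.
    have hx : h + x <= x by lra.
    have /andP[h1 h2] := fC _ _ hx.
    have hn : 0 < - h by lra.
    rewrite -[h^-1]opprK -invrN mulNr -mulrN opprB mulrC.
    by rewrite divr_ge0 ?(ltW hn)//= ler_pdivrMr//; lra.
  have hx : x <= h + x by lra.
  have /andP[h1 h2] := fC _ _ hx; rewrite mulrC divr_ge0 ?(ltW hs)//= ler_pdivrMr//; lra.
apply/andP; split.
  apply: limr_ge => //; near=> h.
  have /q/andP[]// : h != 0 by near: h; exact: nbhs_dnbhs_neq.
apply: limr_le => //; near=> h.
have /q/andP[]// : h != 0 by near: h; exact: nbhs_dnbhs_neq.
Unshelve. all: by end_near. Qed.

Lemma derivable_continuous_at f x : derivable f x 1 -> {for x, continuous f}.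
Proof. by move=> /derivable1_diffP/differentiable_continuous. Qed.

(** A sequence of difference quotients, so that a derivative with respect to a
    parameter is measurable. *)
Lemma derivable_newton_cvg f x : derivable f x 1 ->
  (fun n : nat => n.+1%:R * (f (x + n.+1%:R^-1) - f x)) @ \oo --> derive1 f x.
Proof.
move=> df; rewrite derive1E.
have dfx : (fun h => h^-1 *: ((f \o shift x) (h *: 1) - f x)) @ 0^' --> 'D_1 f x by exact: df.
have := (cvgr_dnbhsP _ _ _).1 dfx (fun n => n.+1%:R^-1).
move=> h.
have {}h : (fun n : nat => (n.+1%:R^-1)^-1 *:
    ((f \o shift x) (n.+1%:R^-1 *: 1) - f x)) @ \oo --> 'D_1 f x.
  by apply: h; split; [move=> n; rewrite invr_neq0// | exact: cvg_harmonic].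
rewrite (_ : (fun n => _) = (fun n : nat => (n.+1%:R^-1)^-1 *:
    ((f \o shift x) (n.+1%:R^-1 *: 1) - f x)))//.
by apply/funext => n; rewrite /= /GRing.scale/= mulr1 invrK [x + _]addrC.
Qed.

Lemma derivable_le_increment f C x y : (forall x, derivable f x 1) ->
  (forall x, derive1 f x <= C) -> x <= y -> f y - f x <= C * (y - x).
Proof.
move=> df fC xy.
have [||c _ ->] := @MVT_segment R f (derive1 f) x y xy.
- by move=> z _; rewrite derive1E; exact/derivableP.
- by apply: continuous_subspaceT => z; exact: derivable_continuous_at.
- by rewrite ler_wpM2r ?subr_ge0.
Qed.

End RationalBounds.

(** * Predictors given by the conditional distribution functions *)

Section ConditionalCdf.
Context (R : realType) d (T : measurableType d) (P : probability T R).
Variables (eps : int -> {RV P >-> R}) (eps' : {RV P >-> R}).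
Hypothesis eps_iid : iid (innovations eps eps').
Local Notation innov := (innovations eps eps').
Local Notation past := (past eps).
Local Notation coupled_past := (coupled_past eps eps').
Variables (G : R -> history R -> R) (Fc : R -> R -> history R -> R).
Hypothesis G_meas : measurable_model G.
Hypothesis Fc_cond : is_cond_cdf eps G Fc.

Lemma measurable_response t : 0 <= t <= 1 -> measurable_fun setT (G t).
Proof.
move=> t01.
rewrite (_ : G t = (fun z : R * history R => G z.1 z.2) \o (fun u => (t, u)))//.
apply: (@measurable_comp _ _ _ (history R) (R * history R)%type R
  (`[0, 1]%classic `*` [set: history R]) (fun z => G z.1 z.2) setT (fun u => (t, u))) => //.
- by apply: measurableX => //; exact: measurable_itv.
- by move=> _ [u _ <-]; split => //=; rewrite in_itv.
- exact: measurable_fun_pair.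
Qed.

Definition below t x : set (history R) := [set u | G t u <= x].

Lemma measurable_below t x : 0 <= t <= 1 -> measurable (below t x).
Proof.
move=> t01; apply: measurable_le_set => //.
exact: measurable_response.
Qed.

Lemma cond_prob_below i t x : 0 <= t <= 1 ->
  is_cond_prob P (past i @^-1` below t x) (past (i - 1)) (Fc t x).
Proof. by move=> t01; have := Fc_cond (i - 1) x t01; rewrite subrK. Qed.

Lemma measurable_Fc t x : 0 <= t <= 1 -> measurable_fun setT (Fc t x).
Proof. by move=> t01; have [] := cond_prob_below 0 x t01. Qed.

(** All pasts, coupled or not, have the same law. *)
Lemma null_past i (N : set (history R)) : measurable N ->
  P (past i @^-1` N) = 0%E -> forall j, P (past j @^-1` N) = 0%E.
Proof.
move=> mN <- j.
by apply: (prob_select eps_iid (k := past_index j) (k' := past_index i)) => //;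
  exact: past_index_inj.
Qed.

Lemma null_coupled_past i (N : set (history R)) : measurable N ->
  P (past i @^-1` N) = 0%E -> forall k, P (coupled_past k @^-1` N) = 0%E.
Proof.
move=> mN <- k; rewrite coupled_past_select.
apply: (prob_select eps_iid (k := coupled_index k) (k' := past_index i)) => //.
  exact: coupled_index_inj.
exact: past_index_inj.
Qed.

Definition below_predictor t x (u : history R) := clamp 0 1 (Fc t x u).

Lemma below_predictorP t x : 0 <= t <= 1 ->
  predictor eps (below t x) (below_predictor t x) 1.
Proof.
move=> t01; split.
- exact: measurable_below.
- by apply: measurable_clamp; exact: measurable_Fc.
- by move=> u; exact: clamp_ge.
- by move=> u; exact: clamp_le.
- move=> i; apply: cond_prob_clamp; first exact: measurable_past.
    by apply: measurable_past_preimage; exact: measurable_below.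
  exact: cond_prob_below.
Qed.

Lemma bounded_below_predictor t x : 0 <= t <= 1 ->
  bounded_measurable (below_predictor t x).
Proof. by move=> t01; exact: predictor_bounded (below_predictorP x t01). Qed.

(** The integral of a non-negative function is a supremum over the simple functions
    below it.  The larger function may be non-measurable, as the derivatives of the
    conditional distribution functions may be. *)
Lemma le_integral_nonmeasurable (g h : T -> \bar R) : (forall w, 0 <= g w)%E ->
  (forall w, g w <= h w)%E -> (\int[P]_w g w <= \int[P]_w h w)%E.
Proof.
move=> g0 gh; have h0 w : (0 <= h w)%E by exact: le_trans (gh w).
rewrite !ge0_integralTE//; apply: ereal_sup_le => _ [s sg <-].
exists s => // w.
exact: le_trans (sg w) (gh w).
Qed.

Lemma Ex_sqr_le_Lnorm (g h : T -> R) (c : R) : bounded_measurable g -> 0 <= c ->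
  (forall w, `|g w| <= `|h w|) -> (Lnorm P 2%:E (fun w => (h w)%:E) <= c%:E)%E ->
  Ex P (fun w => g w ^+ 2) <= c ^+ 2.
Proof.
move=> bg c0 gh hc.
have e2 : (\int[P]_w (g w ^+ 2)%:E <= (c ^+ 2)%:E)%E.
  apply: (@le_trans _ _ (\int[P]_w (`|(h w)%:E| `^ 2)%E)%E).
    apply: le_integral_nonmeasurable => w; first by rewrite lee_fin sqr_ge0.
    rewrite /= lee_fin powR_mulrn// -[leLHS]real_normK ?num_real//.
    by rewrite ler_sqr ?nnegrE.
  rewrite -powR_Lnorm// -powR_mulrn// -poweR_EFin.
  by apply: gt0_ler_poweR => //; rewrite in_itv/= ?leey ?Lnorm_ge0 ?lee_fin ?c0.
rewrite -lee_fin; apply: le_trans e2.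
rewrite /Ex /Rintegral fineK//; apply: integrable_fin_num => //.
exact/bounded_measurable_integrable/bounded_measurableX.
Qed.

Lemma delta_ub H k t x : 0 <= t <= 1 ->
  (Lnorm P 2%:E (fun w => (H t x (past k%:Z w) - H t x (coupled_past k w))%:E) <=
   delta eps eps' H k)%E.
Proof.
move=> t01; apply: ereal_sup_ubound; by exists (t, x) => //; split => //=; rewrite in_itv.
Qed.

Lemma delta_ge0 H k : (0 <= delta eps eps' H k)%E.
Proof.
by apply: le_trans (@delta_ub H k 0 0 _); rewrite ?Lnorm_ge0// lexx ler01.
Qed.

Section Stable.
Variable H : R -> R -> history R -> R.
Hypothesis H_stable : stable eps eps' H.

Lemma delta_fin_num k : delta eps eps' H k \is a fin_num.
Proof.
rewrite ge0_fin_numE ?delta_ge0//; apply: le_lt_trans H_stable.2.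
apply: (@le_trans _ _ (\sum_(0 <= i < k.+1) delta eps eps' H i)%E).
  by rewrite big_nat_recr//= leeDr// sume_ge0// => i _; exact: delta_ge0.
by apply: nneseries_lim_ge => n _ _; exact: delta_ge0.
Qed.

Definition rdelta k : R := fine (delta eps eps' H k).

Lemma rdelta_ge0 k : 0 <= rdelta k.
Proof. exact/fine_ge0/delta_ge0. Qed.

Lemma rdelta_summable : exists D : R, forall M, \sum_(j < M) rdelta j <= D.
Proof.
exists (fine (\sum_(0 <= k <oo) delta eps eps' H k)%E) => M.
have s0 : (0 <= \sum_(0 <= k <oo) delta eps eps' H k)%E.
  by apply: nneseries_ge0 => n _ _; exact: delta_ge0.
rewrite -lee_fin fineK; last by rewrite ge0_fin_numE// H_stable.2.
rewrite -sumEFin.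
apply: (@le_trans _ _ (\sum_(0 <= i < M) delta eps eps' H i)%E).
  by rewrite big_mkord; apply: lee_sum => j _; rewrite fineK// delta_fin_num.
by apply: nneseries_lim_ge => n _ _; exact: delta_ge0.
Qed.

Lemma rdelta_ub k t x : 0 <= t <= 1 ->
  (Lnorm P 2%:E (fun w => (H t x (past k%:Z w) - H t x (coupled_past k w))%:E) <=
   (rdelta k)%:E)%E.
Proof. by move=> t01; rewrite fineK ?delta_fin_num//; exact: delta_ub. Qed.

End Stable.

Lemma bounded_measurable_coupling (F : history R -> R) k : bounded_measurable F ->
  bounded_measurable (fun w => F (past k%:Z w) - F (coupled_past k w)).
Proof.
move=> bF; apply: bounded_measurableB; first exact: bounded_measurable_past.
by apply: bounded_measurable_comp bF; exact: measurable_coupled_past.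
Qed.

Lemma below_predictor_stable t x k : 0 <= t <= 1 -> stable eps eps' (dFc Fc 0) ->
  Ex P (fun w => (below_predictor t x (past k%:Z w) -
    below_predictor t x (coupled_past k w)) ^+ 2) <= rdelta (dFc Fc 0) k ^+ 2.
Proof.
move=> t01 st.
have bd := bounded_measurable_coupling k (bounded_below_predictor x t01).
apply: Ex_sqr_le_Lnorm bd (rdelta_ge0 _ _) _ (rdelta_ub st k x t01) => w.
exact: clamp_dist.
Qed.

(** For a fixed t, the path of the conditional distribution function along a
    history outside a null event is a C0-Lipschitz differentiable distribution
    function.  The null event has to be one of the history space, so that it is
    also null for the coupled pasts; this is why the uncountable supremum of the
    derivatives is used only through increments between rational points. *)
Definition regular_path (C0 t : R) (u : history R) : Prop :=
  [/\ forall x, derivable (Fc t ^~ u) x 1, forall x, 0 <= Fc t x u <= 1 &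
      forall x y, x <= y -> 0 <= Fc t y u - Fc t x u <= C0 * (y - x)].

Lemma negligible_Fc_range t x : 0 <= t <= 1 ->
  P.-negligible (past 0 @^-1` [set u | ~ 0 <= Fc t x u <= 1]).
Proof.
move=> t01.
have c := cond_prob_below 1 x t01.
have mb1 : measurable (past 1 @^-1` below t x).
  by apply: measurable_past_preimage; exact: measurable_below.
have n1 := cond_prob_neg (measurable_past eps _) mb1 c.
have n2 := cond_prob_gt1 (measurable_past eps _) mb1 c.
have mF := measurable_Fc x t01.
apply: (@negligibleS _ _ _ _ (past 0 @^-1` [set u | Fc t x u < 0] `|`
   past 0 @^-1` [set u | 1 < Fc t x u])).
  move=> w /= /negP; rewrite negb_and -!ltNge => /orP[]; by [left|right].
apply: negligibleU; apply/negligibleP => //; try (by apply: measurable_past_preimage;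
  apply: measurable_lt_set).
Qed.

Lemma cond_prob_slab i t x y : 0 <= t <= 1 -> x <= y ->
  is_cond_prob P (past i @^-1` (below t y `\` below t x)) (past (i - 1))
    (fun u => below_predictor t y u - below_predictor t x u).
Proof.
move=> t01 xy.
have mB z : measurable (past i @^-1` below t z).
  by apply: measurable_past_preimage; exact: measurable_below.
apply: (@cond_prob_diff _ _ _ _ _ _ _ (measurable_past eps (i - 1))
  (past i @^-1` below t x) (past i @^-1` below t y)) => //.
- by move=> w; rewrite /below /= => h; exact: le_trans xy.
- exact: bounded_below_predictor.
- exact: bounded_below_predictor.
- by have [] := below_predictorP x t01.
- by have [] := below_predictorP y t01.
Qed.

Lemma negligible_Fc_decreasing t x y : 0 <= t <= 1 -> x <= y ->
  P.-negligible (past 0 @^-1` [set u | Fc t y u < Fc t x u]).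
Proof.
move=> t01 xy.
have mB : measurable (past 1 @^-1` (below t y `\` below t x)).
  by apply: measurable_past_preimage; apply: measurableD; exact: measurable_below.
have n1 := cond_prob_neg (measurable_past eps _) mB (cond_prob_slab 1 t01 xy).
set N := [set u | _ < 0] in n1.
have mN : measurable N.
  apply: measurable_lt_set => //; apply: measurable_funB;
    exact: (bounded_below_predictor _ t01).1.
apply: (@negligibleS _ _ _ _ (past 0 @^-1` N `|`
   (past 0 @^-1` [set u | ~ 0 <= Fc t x u <= 1] `|`
    past 0 @^-1` [set u | ~ 0 <= Fc t y u <= 1]))).
  move=> w /= h.
  have [h1|h1] := pselect (0 <= Fc t x (past 0 w) <= 1); last by right; left.
  have [h2|h2] := pselect (0 <= Fc t y (past 0 w) <= 1); last by right; right.
  left; rewrite /N /= /below_predictor; case/andP: h1 => *; case/andP: h2 => *.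
  by rewrite !clamp_id// subr_lt0.
apply: negligibleU; last by apply: negligibleU; exact: negligible_Fc_range.
by apply/negligibleP => //; apply: measurable_past_preimage.
Qed.

Hypothesis B1 : condB1 eps eps' Fc.

Lemma negligible_Fc_nonderivable t : 0 <= t <= 1 ->
  exists N : set (history R), [/\ measurable N, P (past 0 @^-1` N) = 0%E &
    forall u, ~ N u -> forall x, derivable (Fc t ^~ u) x 1].
Proof.
move=> t01; have [/(_ 0 t t01) [N [mN N0 hN]] _] := B1 (isT : (1 <= 3)%N).
exists N; split => // u Nu x; apply: contrapT => nd; apply: Nu; apply: hN => /=.
by move=> h; apply: nd; exact: (h x 0%N isT).
Qed.

Lemma negligible_Fc_steep C0 : (forall i : int,
    {ae P, forall w : T, (ereal_sup [set (dFc Fc 1 z.1 z.2 (past i w))%:E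
                  | z in unit_strip] < C0%:E)%E}) ->
  forall t x y, 0 <= t <= 1 -> x <= y ->
  P.-negligible (past 0 @^-1` [set u | C0 * (y - x) < Fc t y u - Fc t x u]).
Proof.
move=> hC t x y t01 xy.
have [N [mN N0 hN]] := negligible_Fc_nonderivable t01.
apply: (@negligibleS _ _ _ _ (past 0 @^-1` N `|` ~` [set w |
   (ereal_sup [set (dFc Fc 1 z.1 z.2 (past 0 w))%:E | z in unit_strip] < C0%:E)%E])).
  move=> w /= h; apply: contrapT => /not_orP[Nw /contrapT sw].
  have inc : Fc t y (past 0 w) - Fc t x (past 0 w) <= C0 * (y - x).
    apply: (@derivable_le_increment R (Fc t ^~ (past 0 w)) C0 x y (hN _ Nw)) => // z.
    rewrite -lee_fin; apply/ltW/(le_lt_trans _ sw); apply: ereal_sup_ubound.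
    by exists (t, z) => //; split => //=; rewrite in_itv.
  by move: h; rewrite /= ltNge inc.
apply: negligibleU; last exact: hC.
by apply/negligibleP => //; exact: measurable_past_preimage.
Qed.

Lemma regular_path_ae C0 : 0 <= C0 -> (forall i : int,
    {ae P, forall w : T, (ereal_sup [set (dFc Fc 1 z.1 z.2 (past i w))%:E
                  | z in unit_strip] < C0%:E)%E}) ->
  forall t, 0 <= t <= 1 ->
  exists N : set (history R), [/\ measurable N, P (past 0 @^-1` N) = 0%E &
    forall u, ~ N u -> regular_path C0 t u].
Proof.
move=> C00 hC t t01.
have [N [mN N0 hN]] := negligible_Fc_nonderivable t01.
pose bad (qr : rat * rat) : set (history R) := [set u | ~ 0 <= Fc t (ratr qr.1) u <= 1] `|`
  (if qr.1 <= qr.2 then [set u | Fc t (ratr qr.2) u < Fc t (ratr qr.1) u] `|`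
    [set u | C0 * (ratr qr.2 - ratr qr.1) < Fc t (ratr qr.2) u - Fc t (ratr qr.1) u]
   else set0).
have nbad qr : P.-negligible (past 0 @^-1` bad qr).
  apply: negligibleU; first exact: negligible_Fc_range.
  case: ifPn => qr12; last exact: negligible_set0.
  have qr' : ratr qr.1 <= ratr qr.2 :> R by rewrite ler_rat.
  apply: negligibleU; first exact: negligible_Fc_decreasing.
  exact: (negligible_Fc_steep hC).
have mF x := measurable_Fc x t01.
have mbad qr : measurable (bad qr).
  apply: measurableU.
    rewrite (_ : [set u | _] = [set u | Fc t (ratr qr.1) u < 0] `|`
      [set u | 1 < Fc t (ratr qr.1) u]); first by apply: measurableU; exact: measurable_lt_set.
    apply/seteqP; split => u /=.
      by move=> /negP; rewrite negb_and -!ltNge => /orP.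
    by move=> h; apply/negP; rewrite negb_and -!ltNge; apply/orP.
  case: ifP => // _; apply: measurableU; first exact: measurable_lt_set.
  by apply: measurable_lt_set => //; exact: measurable_funB.
pose badn n : set (history R) := if @unpickle (rat * rat)%type n is Some qr then bad qr else set0.
have mbadn n : measurable (badn n) by rewrite /badn; case: unpickle.
exists (N `|` \bigcup_n badn n); split.
- by apply: measurableU => //; exact: bigcup_measurable.
- apply/negligibleP.
    by apply: measurable_past_preimage; apply: measurableU => //; exact: bigcup_measurable.
  rewrite preimage_setU preimage_bigcup; apply: negligibleU.
    by apply/negligibleP => //; exact: measurable_past_preimage.
  apply: negligible_bigcup => n; rewrite /badn; case: unpickle => [qr|]; first exact: nbad.
  by rewrite preimage_set0; exact: negligible_set0.
- move=> u /not_orP[Nu nbu].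
  have cu x : {for x, continuous (Fc t ^~ u)}.
    exact/derivable_continuous_at/hN.
  have nb qr : ~ bad qr u.
    move=> bu; apply: nbu; have e : badn (pickle qr) = bad qr by rewrite /badn pickleK.
    by exists (pickle qr); [exact: I | rewrite e].
  split; first exact: hN.
    apply: rat_range => // q; apply: contrapT => nq; apply: (nb (q, q)); left.
    exact: nq.
  apply: rat_lipschitz => // q r qr; apply: contrapT => nqr; apply: (nb (q, r)); right.
  rewrite /= qr; move/negP: nqr; rewrite negb_and -!ltNge subr_lt0 => /orP[]; by [left|right].
Qed.

Variable C0 : R.
Hypothesis C0_ge0 : 0 <= C0.
Hypothesis steep : forall i : int,
    {ae P, forall w : T, (ereal_sup [set (dFc Fc 1 z.1 z.2 (past i w))%:E
                  | z in unit_strip] < C0%:E)%E}.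

(** The clamp makes the bound on the conditional density hold along all histories
    rather than almost all of them. *)
Definition slab_predictor t x y (u : history R) :=
  clamp 0 (C0 * (y - x)) (below_predictor t y u - below_predictor t x u).

Lemma regular_below t x u : regular_path C0 t u -> below_predictor t x u = Fc t x u.
Proof. by move=> [_ /(_ x)/andP[h1 h2] _]; exact: clamp_id. Qed.

Lemma regular_slab t x y u : x <= y -> regular_path C0 t u ->
  slab_predictor t x y u = Fc t y u - Fc t x u.
Proof.
move=> xy ru; rewrite /slab_predictor !regular_below//.
by have [_ _ /(_ _ _ xy)/andP[h1 h2]] := ru; exact: clamp_id.
Qed.

Lemma slab_predictorP t x y : 0 <= t <= 1 -> x <= y ->
  predictor eps (below t y `\` below t x) (slab_predictor t x y) (C0 * (y - x)).
Proof.
move=> t01 xy.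
have md : measurable_fun setT (fun u => below_predictor t y u - below_predictor t x u).
  by apply: measurable_funB; exact: (bounded_below_predictor _ t01).1.
split.
- by apply: measurableD; exact: measurable_below.
- exact: measurable_clamp.
- by move=> u; exact: clamp_ge.
- by move=> u; apply: clamp_le; rewrite mulr_ge0// subr_ge0.
- move=> i; apply: (cond_prob_ae_eq (measurable_past eps _) (cond_prob_slab i t01 xy)).
    exact: measurable_clamp.
  have [N [mN N0 hN]] := regular_path_ae C0_ge0 steep t01.
  have Ni := null_past mN N0 (i - 1).
  apply/eqP; rewrite eq_le measure_ge0 andbT -Ni; apply: le_measure; rewrite ?inE.
  + apply: measurable_past_preimage.
    have /measurable_EFinP m1 := md.
    have /measurable_EFinP m2 := measurable_clamp 0 (C0 * (y - x)) md.
    have := measurable_neqe measurableT m1 m2.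
    by rewrite setTI (_ : [set x | _ != _] = [set u |
      below_predictor t y u - below_predictor t x u != slab_predictor t x y u]).
  + exact: measurable_past_preimage.
  move=> w /= h; apply: contrapT => /hN ru.
  by move: h; rewrite regular_slab// !regular_below// eqxx.
Qed.

(** With V the coupling difference of the predictor, the map
    z |-> E(V (F(t, z, past) - F(t, z, coupled past))) is differentiable with a
    derivative at most ||V|| delta(k) by the Cauchy-Schwarz inequality, and it
    increases by E(V^2) over the interval. *)
Lemma slab_predictor_stable t x y k : 0 <= t <= 1 -> x <= y ->
  Ex P (fun w => (slab_predictor t x y (past k%:Z w) -
    slab_predictor t x y (coupled_past k w)) ^+ 2) <=
  ((y - x) * rdelta (dFc Fc 1) k) ^+ 2.
Proof.
move=> t01 xy.
have st : stable eps eps' (dFc Fc 1) by case: (B1 (isT : (1 <= 3)%N)).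
have [N [mN N0 hN]] := regular_path_ae C0_ge0 steep t01.
pose NB := past k%:Z @^-1` N `|` coupled_past k @^-1` N.
have mNc : measurable (coupled_past k @^-1` N).
  by rewrite -[X in measurable X]setTI; exact: measurable_coupled_past.
have mNB : measurable NB by apply: measurableU => //; exact: measurable_past_preimage.
have NB0 : P NB = 0%E.
  apply/negligibleP => //; apply: negligibleU; apply/negligibleP => //.
  - exact: measurable_past_preimage.
  - exact: null_past N0 _.
  - exact: null_coupled_past N0 _.
pose B := ~` NB.
have mB : measurable B by exact: measurableC.
have reg1 w : B w -> regular_path C0 t (past k%:Z w).
  by move=> Bw; apply: hN => h; apply: Bw; left.
have reg2 w : B w -> regular_path C0 t (coupled_past k w).
  by move=> Bw; apply: hN => h; apply: Bw; right.
pose V w := slab_predictor t x y (past k%:Z w) - slab_predictor t x y (coupled_past k w).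
have bV : bounded_measurable V.
  exact/bounded_measurable_coupling/(predictor_bounded (slab_predictorP t01 xy)).
pose v := C0 * (y - x).
have v0 : 0 <= v by rewrite mulr_ge0// subr_ge0.
have Vv w : `|V w| <= v.
  have h u : 0 <= slab_predictor t x y u <= v by rewrite clamp_ge clamp_le.
  have := h (past k%:Z w); have := h (coupled_past k w); rewrite /V ler_norml.
  by move=> /andP[? ?] /andP[? ?]; apply/andP; split; lra.
pose g z w := below_predictor t z (past k%:Z w) - below_predictor t z (coupled_past k w).
have bg z : bounded_measurable (g z).
  exact/bounded_measurable_coupling/bounded_below_predictor.
pose f z w := V w * g z w.
have bf z : bounded_measurable (f z) by exact: bounded_measurableM.
pose W z w := dFc Fc 1 t z (past k%:Z w) - dFc Fc 1 t z (coupled_past k w).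
have gB w : B w -> g ^~ w = (Fc t ^~ (past k%:Z w)) - (Fc t ^~ (coupled_past k w)).
  move=> Bw; apply/funext => z; rewrite /g !regular_below//; [exact: reg2|exact: reg1].
have fD w (z : R) : B w -> is_derive z (1 : R) (f ^~ w) (V w * W z w).
  move=> Bw; have [d1 _ _] := reg1 w Bw; have [d2 _ _] := reg2 w Bw.
  have h1 : is_derive z (1 : R) (Fc t ^~ (past k%:Z w)) (dFc Fc 1 t z (past k%:Z w)).
    by rewrite /dFc/= derive1E; exact/derivableP.
  have h2 : is_derive z (1 : R) (Fc t ^~ (coupled_past k w)) (dFc Fc 1 t z (coupled_past k w)).
    by rewrite /dFc/= derive1E; exact/derivableP.
  have e : f ^~ w = V w \*: ((Fc t ^~ (past k%:Z w)) - (Fc t ^~ (coupled_past k w))).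
    by apply/funext => z'; rewrite /f -[g z' w]/((g ^~ w) z') gB.
  by rewrite e; exact: (is_deriveZ (V w) (is_deriveB h1 h2)).
have WC w (z : R) : B w -> `|W z w| <= C0.
  move=> Bw; have [d1 _ l1] := reg1 w Bw; have [d2 _ l2] := reg2 w Bw.
  have /andP[? ?] := derive1_bounds d1 l1 z; have /andP[? ?] := derive1_bounds d2 l2 z.
  by rewrite /W /dFc/= ler_norml; apply/andP; split; lra.
have p1 w (z : R) : B w -> partial1of2 f z w = V w * W z w.
  by move=> Bw; rewrite /partial1of2 derive1E; exact: (@derive_val _ _ _ _ _ _ _ (fD w z Bw)).
have bfB z : P.-integrable B (EFin \o f z).
  apply: (@integrableS _ _ _ _ setT) => //; exact: bounded_measurable_integrable.
pose phi z := \int[P]_(w in B) f z w.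
have II (z : R) : z \in `[x, y] -> `]x - 1, y + 1[%classic z.
  by rewrite /= !in_itv/= => /andP[? ?]; apply/andP; split; lra.
have derf (z : R) w : `]x - 1, y + 1[%classic z -> B w -> derivable (f ^~ w) z 1.
  by move=> _ Bw; exact: (@ex_derive _ _ _ _ _ _ _ (fD w z Bw)).
have G0 : forall w : T, 0 <= cst (v * C0) w by move=> w; rewrite mulr_ge0.
have intG : P.-integrable B (EFin \o cst (v * C0)).
  apply: (@integrableS _ _ _ _ setT) => //.
  exact/bounded_measurable_integrable/bounded_measurable_cst.
have Gub z w : `]x - 1, y + 1[%classic z -> B w -> `|partial1of2 f z w| <= cst (v * C0) w.
  by move=> _ Bw; rewrite p1// normrM ler_pM//; exact: WC.
have dphi (z : R) : z \in `[x, y] -> derivable phi z 1.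
  move=> zxy.
  exact: (derivable_under_integral mB (II z zxy) (fun z _ => bfB z) derf G0 intG Gub).
have ephi (z : R) : z \in `[x, y] -> phi^`()%classic z = \int[P]_(w in B) (V w * W z w).
  move=> zxy.
  rewrite (differentiation_under_integral mB (II z zxy) (fun z _ => bfB z) derf G0 intG Gub).
  by apply: eq_Rintegral => w /set_mem Bw; exact: p1.
have [||c cxy ephi'] := @MVT_segment R phi (phi^`()%classic) x y xy.
- move=> z zxy; rewrite derive1E; apply/derivableP/dphi.
  by apply: subset_itv_oo_cc zxy.
- apply: continuous_in_subspaceT => z /set_mem zxy.
  exact/derivable_continuous_at/dphi.
have BT h : bounded_measurable h -> \int[P]_(w in B) h w = Ex P h.
  move=> bh; rewrite /Ex /Rintegral; congr fine.
  rewrite [RHS](negligible_integral mNB) ?setTD//.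
  exact: bounded_measurable_integrable.
have eV : phi y - phi x = Ex P (fun w => V w ^+ 2).
  rewrite /phi !BT//; rewrite -ExB// -BT; last exact: bounded_measurableB.
  rewrite -BT; last exact: bounded_measurableX.
  apply: eq_Rintegral => w /set_mem Bw.
  rewrite /f -mulrBr expr2; congr (_ * _).
  rewrite /V !regular_slab//; [|exact: reg2|exact: reg1].
  rewrite /g !regular_below//; [|exact: reg2|exact: reg1..|exact: reg2|exact: reg1].
  ring.
pose W' := (W c) \_ B.
have mW : measurable_fun B (W c).
  apply: (@measurable_fun_cvg _ _ _ B (fun n w => n.+1%:R * (g (c + n.+1%:R^-1) w - g c w))).
    move=> n; apply: measurable_funTS.
    by have [] := bounded_measurableZ n.+1%:R (bounded_measurableB (bg (c + n.+1%:R^-1)) (bg c)).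
  move=> w Bw; have [d1 _ _] := reg1 w Bw; have [d2 _ _] := reg2 w Bw.
  have e z : g z w = Fc t z (past k%:Z w) - Fc t z (coupled_past k w).
    by rewrite -[LHS]/((g ^~ w) z) gB.
  have cW := cvgB (derivable_newton_cvg (d1 c)) (derivable_newton_cvg (d2 c)).
  suff -> : (fun n : nat => n.+1%:R * (g (c + n.+1%:R^-1) w - g c w)) =
     (fun n : nat => n.+1%:R * (Fc t (c + n.+1%:R^-1) (past k%:Z w) - Fc t c (past k%:Z w))) -
     (fun n : nat => n.+1%:R * (Fc t (c + n.+1%:R^-1) (coupled_past k w) -
       Fc t c (coupled_past k w))) by exact: cW.
  by apply/funext => n; rewrite !e !fctE; ring.
have bW' : bounded_measurable W'.
  split; first by apply/(measurable_restrictT _ mB).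
  exists C0 => w; rewrite /W' patchE; case: ifP => [/set_mem|_]; first exact: WC.
  by rewrite normr0.
have hW' : Ex P (fun w => W' w ^+ 2) <= rdelta (dFc Fc 1) k ^+ 2.
  apply: Ex_sqr_le_Lnorm bW' (rdelta_ge0 _ _) _ (rdelta_ub st k c t01) => w.
  by rewrite /W' patchE; case: ifP => // _; rewrite normr0.
have S0 : 0 <= Ex P (fun w => V w ^+ 2) by apply: Ex_ge0 => w; exact: sqr_ge0.
set S := Ex P (fun w => V w ^+ 2) in S0 eV *.
have key : S <= Num.sqrt S * rdelta (dFc Fc 1) k * (y - x).
  rewrite -[leLHS]eV ephi' ler_wpM2r ?subr_ge0// ephi//.
  rewrite Rintegral_mkcond (_ : (fun _ => _) \_ B = (fun w => V w * W' w)); last first.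
    by apply/funext => w; rewrite /W' !patchE; case: ifP; rewrite ?mulr0.
  apply: Ex_mul_le0 => //; first exact: rdelta_ge0.
  by rewrite sqr_sqrtr.
have [S00|Sn0] := eqVneq S 0; first by rewrite S00 sqr_ge0.
have sS : 0 < Num.sqrt S by rewrite sqrtr_gt0 lt_neqAle eq_sym Sn0.
have : Num.sqrt S <= (y - x) * rdelta (dFc Fc 1) k.
  rewrite -(ler_pM2l sS) -expr2 sqr_sqrtr//; apply: le_trans key _.
  by rewrite -mulrA [rdelta _ _ * _]mulrC.
move=> h; rewrite -[leLHS](sqr_sqrtr S0) ler_sqr ?nnegrE ?(ltW sS)//.
exact: le_trans (ltW sS) h.
Qed.

End ConditionalCdf.

(** * Functions of class C1 on a segment *)

Section SegmentC1.
Context (R : realType).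
Variables (a b : R) (f : R -> R).
Hypothesis ab : a < b.
Hypothesis f_C1 : C1_on `[a, b] f.
Local Notation df := (derive_in `[a, b] f).

Lemma diff_quot_in_cvg x : a <= x <= b ->
  (fun s => (f s - f x) / (s - x)) @ within `[a, b] x^' --> df x.
Proof. by move=> xab; apply: (f_C1.1 x); rewrite /= in_itv. Qed.

Lemma C1_interior_derive x : a < x < b -> is_derive x (1 : R) f (df x).
Proof.
move=> /andP[ax xb].
have c : (fun s => (f s - f x) / (s - x)) @ x^' --> df x.
  have := @diff_quot_in_cvg x; rewrite !ltW// => /(_ isT).
  apply: cvg_trans; apply: cvg_app.
  move=> A hA; change (\forall s \near x^', A s).
  have {}hA : \forall s \near x^', `[a, b]%classic s -> A s by exact: hA.
  have hx : \forall s \near x^', `[a, b]%classic s.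
    apply: nbhs_dnbhs.
    have : \forall s \near x, s \in `]a, b[.
      by apply: near_in_itvoo; rewrite in_itv/= ax.
    by apply: filterS => s; rewrite /= !in_itv/= => /andP[h1 h2]; rewrite !ltW.
  by apply: filterS2 hA hx => s; apply.
have c2 : (fun h => h^-1 *: ((f \o shift x) (h *: 1) - f x)) @ 0^' --> df x.
  apply/cvgr_dnbhsP => u [u0 ucv].
  have := (cvgr_dnbhsP _ _ _).1 c (fun n => u n + x).
  have H : (forall n, u n + x != x) /\ (u n + x @[n --> \oo] --> x).
    split; first by move=> n; rewrite -subr_eq0 addrK.
    rewrite -[X in _ --> X]add0r; apply: cvgD => //; exact: cvg_cst.
  move=> /(_ H); rewrite (_ : (fun n => _) = (fun n => (u n)^-1 *: ((f \o shift x) (u n *: 1) - f x)))//.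
  by apply/funext => n; rewrite /= /GRing.scale/= mulr1 addrK mulrC.
apply: DeriveDef; first by apply/cvg_ex; exists (df x); exact: c2.
exact: (cvg_lim _ c2).
Qed.

Lemma C1_continuous : {within `[a, b], continuous f}.
Proof.
apply/subspace_continuousP => x xab.
have xab' : a <= x <= b by move: xab; rewrite /= in_itv.
have c := diff_quot_in_cvg xab'.
apply/cvgrPdist_le => e e0.
pose D := `|df x| + 1.
have D0 : 0 < D by rewrite ltr_wpDl.
have /cvgrPdist_le/(_ 1 ltr01) := c.
move=> hq.
have hs : \forall s \near x, s != x -> `[a, b]%classic s -> `|df x - (f s - f x) / (s - x)| <= 1.
  exact: hq.
have hd : \forall s \near x, `|x - s| <= e / D.
  have : x @[x --> x] --> x by exact: cvg_id.
  by move=> /cvgrPdist_le/(_ (e / D)); apply; rewrite divr_gt0.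
apply: filterS2 hs hd => s h1 h2 sab.
have [->|sx] := eqVneq s x; first by rewrite subrr normr0 ltW.
have {h1} := h1 sx sab.
rewrite distrC => h.
have hfs : `|(f s - f x) / (s - x)| <= D.
  rewrite -[X in `|X|](subrK (df x)) (le_trans (ler_normD _ _))// addrC lerD2l//.
have sx0 : s - x != 0 by rewrite subr_eq0.
rewrite distrC -[f s - f x](divfK sx0) normrM.
apply: (@le_trans _ _ (D * (e / D))); last by rewrite mulrCA divff ?gt_eqF// mulr1.
by rewrite ler_pM// distrC.
Qed.

Lemma C1_mean_value x y : a <= x -> x <= y -> y <= b ->
  exists2 c : R, x <= c <= y & f y - f x = df c * (y - x).
Proof.
move=> ax xy yb.
have [||c] := @MVT_segment R f df x y xy.
- move=> z; rewrite in_itv/= => /andP[xz zy]; apply: C1_interior_derive.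
  by rewrite (le_lt_trans ax)//= (lt_le_trans zy).
- apply: continuous_subspaceW C1_continuous => z /=; rewrite !in_itv/= => /andP[h1 h2].
  by rewrite (le_trans ax)//= (le_trans h2).
- by rewrite in_itv/= => cxy h; exists c.
Qed.

Lemma C1_derive_bounded : exists2 M : R, 0 <= M & forall x, a <= x <= b -> `|df x| <= M.
Proof.
have [_ cdf] := f_C1.
have := compact_bounded (continuous_compact cdf (@segment_compact R a b)).
move=> [M [_ hM]]; exists (`|M| + 1); first by rewrite addr_ge0.
move=> x xab; apply: (hM (`|M| + 1)); first by rewrite (le_lt_trans (ler_norm _))// ltrDl.
by exists x => //=; rewrite in_itv.
Qed.

Lemma C1_lipschitz : exists2 M : R, 0 <= M &
  forall x y, a <= x <= b -> a <= y <= b -> `|f y - f x| <= M * `|y - x|.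
Proof.
have [M M0 hM] := C1_derive_bounded; exists M => // x y.
wlog xy : x y / x <= y.
  by move=> h hx hy; have [xy|/ltW yx] := leP x y; [|rewrite distrC [`|y - x|]distrC];
    exact: h.
move=> /andP[ax xb] /andP[ay yb].
have [c /andP[xc cy] ->] := C1_mean_value ax xy yb.
by rewrite normrM ler_wpM2r// hM// (le_trans ax xc) (le_trans cy yb).
Qed.

End SegmentC1.

(** The mean value theorem, and the Lipschitz continuity of the derivative. *)
Lemma C2_taylor (R : realType) (a b : R) (f : R -> R) : a < b -> C2_on `[a, b] f ->
  exists2 M : R, 0 <= M & forall x s, a <= x <= b -> a <= s <= b ->
    `|f x - f s - (x - s) * derive_in `[a, b] f s| <= M * (x - s) ^+ 2.
Proof.
move=> ab [df c1].
have fC1 : C1_on `[a, b] f.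
  by split; [exact: df | exact: (C1_continuous c1)].
have [M M0 hM] := C1_lipschitz c1; exists M => // x s hx hs.
have hsq : (x - s) ^+ 2 = `|x - s| * `|x - s| by rewrite -normrM -expr2 ger0_norm ?sqr_ge0.
have [sx|xs] := leP s x.
  have /andP[sa sb] := hs; have /andP[xa xb] := hx.
  have [c /andP[sc cx] ->] := C1_mean_value fC1 sa sx xb.
  rewrite [_ * (x - s)]mulrC -mulrBr normrM hsq mulrCA ler_wpM2l//.
  have hc : a <= c <= b by rewrite (le_trans sa sc) (le_trans cx xb).
  apply: le_trans (hM s c hs hc) _; rewrite ler_wpM2l//.
  by rewrite !ger0_norm ?subr_ge0// lerB.
have /andP[sa sb] := hs; have /andP[xa xb] := hx.
have [c /andP[xc cs] e] := C1_mean_value fC1 xa (ltW xs) sb.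
rewrite (_ : f x - f s = derive_in `[a, b] f c * (x - s)); last first.
  by rewrite -opprB e -mulrN opprB.
rewrite [_ * (x - s)]mulrC -mulrBr normrM hsq mulrCA ler_wpM2l//.
have hc : a <= c <= b by rewrite (le_trans xa xc) (le_trans cs sb).
apply: le_trans (hM s c hs hc) _; rewrite ler_wpM2l//.
by rewrite distrC [leRHS]distrC !ger0_norm ?subr_ge0 ?(ltW xs)// lerB.
Qed.

(** * Summation by parts *)

Section Abel.
Context (R : realType).
Implicit Types (w x : nat -> R).

Lemma abel_summation w x n : \sum_(i < n.+1) w i * x i =
  w n * (\sum_(i < n.+1) x i) - \sum_(j < n) (w j.+1 - w j) * (\sum_(i < j.+1) x i).
Proof.
elim: n => [|n IH]; first by rewrite !big_ord_recr !big_ord0/= !add0r subr0.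
have e : \sum_(i < n.+2) x i = \sum_(i < n.+1) x i + x n.+1 by rewrite big_ord_recr.
rewrite big_ord_recr/= IH [X in _ = _ - X]big_ord_recr/= e.
ring.
Qed.

(** Summation by parts moves the differences from the sums to the weights. *)
Lemma abel_bound w x n (A B V : R) : 0 <= A ->
  (forall j, (j <= n)%N -> `|\sum_(i < j) x i| <= A) ->
  (forall i, `|w i| <= B) -> \sum_(j < n) `|w j.+1 - w j| <= V ->
  `|\sum_(i < n) w i * x i| <= (B + V) * A.
Proof.
move=> A0 hA hB hV.
have B0 : 0 <= B by exact: le_trans (hB 0%N).
have V0 : 0 <= V by apply: le_trans hV; exact: sumr_ge0.
case: n hA hV => [|n] hA hV; first by rewrite big_ord0 normr0 mulr_ge0// addr_ge0.
rewrite abel_summation (le_trans (ler_normB _ _))// mulrDl lerD//.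
  by rewrite normrM ler_pM// hA.
apply: (le_trans (ler_norm_sum _ _ _)).
apply: (@le_trans _ _ (\sum_(j < n) `|w j.+1 - w j| * A)).
  apply: ler_sum => j _; rewrite normrM ler_wpM2l// hA//.
  by rewrite ltnS ltnW// ltnS ltn_ord.
rewrite -mulr_suml ler_wpM2r//; apply: le_trans hV.
by rewrite big_ord_recr/= lerDl.
Qed.

End Abel.

(** * Sums of a kernel over a regular grid *)

(** The weights are products of powers of u with a kernel of class C1 on its
    support, which is allowed to jump at the two endpoints. *)
Definition lipschitz_bump (R : realType) (k : R -> R) (L B : R) : Prop :=
  [/\ 0 <= L, forall u, `|k u| <= B, forall u, 1 < `|u| -> k u = 0,
      forall x y, `|x| <= 1 -> `|y| <= 1 -> `|k y - k x| <= L * `|y - x| &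
      measurable_fun setT k].

Section Bump.
Context (R : realType).
Variables (k : R -> R) (L B : R).
Hypothesis bk : lipschitz_bump k L B.
Local Notation mu := (@lebesgue_measure R).

Let L0 : 0 <= L. Proof. by case: bk. Qed.
Let kB u : `|k u| <= B. Proof. by case: bk. Qed.
Let B0 : 0 <= B. Proof. exact: le_trans (kB 0). Qed.

Lemma lipschitz_bumpX : lipschitz_bump (fun u => u * k u) (L + B) B.
Proof.
have [_ _ kz kL mk] := bk; split.
- exact: addr_ge0.
- move=> u; have [h|h] := leP `|u| 1; last by rewrite kz// mulr0 normr0.
  by rewrite normrM -[leRHS]mul1r ler_pM.
- by move=> u h; rewrite kz// mulr0.
- move=> x y hx hy; rewrite (_ : _ - _ = y * (k y - k x) + k x * (y - x)); last ring.
  rewrite (le_trans (ler_normD _ _))// !normrM mulrDl lerD//.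
    by rewrite -[leRHS]mul1r ler_pM// kL.
  by rewrite ler_wpM2r.
- exact: measurable_funM.
Qed.

Definition crossings (x y : R) : R :=
  ((-1 <= y)%R%:R - (-1 <= x)%R%:R) + ((1 < y)%R%:R - (1 < x)%R%:R).

(** Away from the endpoints the increments are Lipschitz; each endpoint
    contributes at most one jump. *)
Lemma bump_increment x y : x <= y -> `|k y - k x| <= L * (y - x) + B * crossings x y.
Proof.
move=> xy; have [_ _ kz kL _] := bk; rewrite /crossings.
have Lxy : 0 <= L * (y - x) by rewrite mulr_ge0// subr_ge0.
have kzn u : u < -1 -> k u = 0.
  by move=> h; apply: kz; rewrite ler0_norm; lra.
have kzp u : 1 < u -> k u = 0.
  by move=> h; apply: kz; rewrite ger0_norm; lra.
have Bx := kB x; have By := kB y.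
have [y1|y1] := ltP y (-1).
  have e1 : (-1 <= x) = false by apply/negbTE; rewrite -ltNge; lra.
  have e2 : (1 < y) = false by apply/negbTE; rewrite -leNgt; lra.
  have e3 : (1 < x) = false by apply/negbTE; rewrite -leNgt; lra.
  have -> : k y = 0 by exact: kzn.
  have -> : k x = 0 by apply: kzn; lra.
  by rewrite e1 e2 e3 !subrr normr0 addr0 mulr0 addr0.
have [x1|x1] := ltP 1 x.
  have e1 : (-1 <= x) = true by lra.
  have e2 : (1 < y) = true by lra.
  have -> : k x = 0 by exact: kzp.
  have -> : k y = 0 by apply: kzp; lra.
  by rewrite e1 e2 !subrr normr0 addr0 mulr0 addr0.
rewrite [(false%:R : R)]/(0 : R) subr0.
have [x2|x2] := ltP x (-1).
  have -> : k x = 0 by exact: kzn.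
  rewrite [(true%:R : R)]/(1 : R) [(false%:R : R)]/(0 : R) !subr0 [B * _]mulrDr mulr1.
  apply: (@le_trans _ _ B) => //.
  by rewrite addrCA lerDl addr_ge0// mulr_ge0.
have [y2|y2] := ltP 1 y.
  have -> : k y = 0 by exact: kzp.
  rewrite [(true%:R : R)]/(1 : R) sub0r normrN subrr add0r mulr1; apply: (@le_trans _ _ B) => //.
  by rewrite lerDr.
rewrite subrr addr0 mulr0 addr0.
have := kL x y; rewrite [`|y - x|]ger0_norm ?subr_ge0//; apply;
  by rewrite ler_norml; apply/andP; split; lra.
Qed.

Lemma crossings_le x y z : y <= z -> crossings x y <= crossings x z.
Proof.
move=> yz; rewrite /crossings lerD// lerD2r ler_nat.
  by have [h|] := boolP (-1 <= y) => //; rewrite (le_trans h yz).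
by have [h|] := boolP (1 < y) => //; rewrite (lt_le_trans h yz).
Qed.

Variables (u0 h : R).
Hypothesis h0 : 0 < h.
Definition grid (j : nat) : R := u0 + h * j%:R.

Lemma grid_step j : grid j.+1 = grid j + h.
Proof. by rewrite /grid -natr1 mulrDr mulr1 addrA. Qed.

(** The sum telescopes: a grid crosses each endpoint at most once. *)
Lemma sum_crossings n : \sum_(j < n) crossings (grid j) (grid j.+1) <= 2.
Proof.
pose c (x : R) : R := (-1 <= x)%R%:R + (1 < x)%R%:R.
have -> : \sum_(j < n) crossings (grid j) (grid j.+1) = c (grid n) - c (grid 0).
  elim: n => [|n IH]; first by rewrite big_ord0 subrr.
  by rewrite big_ord_recr/= IH /crossings /c; ring.
have b01 (b : bool) : ((0 : R) <= (b%:R : R)) /\ ((b%:R : R) <= 1).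
  by case: b; split; rewrite ?lexx ?ler01.
have := b01 (-1 <= grid n); have := b01 (1 < grid n).
have := b01 (-1 <= grid 0); have := b01 (1 < grid 0).
rewrite /c => -[? ?] [? ?] [? ?] [? ?]; lra.
Qed.

Lemma bump_variation n : \sum_(j < n) `|k (grid j.+1) - k (grid j)| <= L * h * n%:R + 2 * B.
Proof.
apply: (@le_trans _ _ (\sum_(j < n) (L * h + B * crossings (grid j) (grid j.+1)))).
  apply: ler_sum => j _.
  have gj : grid j <= grid j.+1 by rewrite grid_step lerDl ltW.
  apply: le_trans (bump_increment gj) _.
  by rewrite grid_step addrAC subrr add0r.
have eL : \sum_(j < n) L * h = L * h * n%:R by rewrite sumr_const card_ord mulr_natr.
rewrite big_split/= eL lerD2l -mulr_sumr mulrC ler_wpM2r//.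
exact: sum_crossings.
Qed.

Lemma lebesgue_co_finite (x y : R) : (mu `[x, y[%classic < +oo)%E.
Proof.
by rewrite lebesgue_measure_itv/=; case: ifP => _; rewrite ?ltry// -EFinB ltry.
Qed.

Lemma bump_bounded_integrable x y : mu.-integrable `[x, y[ (EFin \o k).
Proof.
have [_ _ _ _ mk] := bk.
apply: measurable_bounded_integrable => //.
- exact: lebesgue_co_finite.
- exact: measurable_funTS.
- exists B; split; first by rewrite num_real.
  by move=> M BM z _ /=; exact: le_trans (kB z) (ltW BM).
Qed.

Lemma bump_cell j : `|h * k (grid j) - \int[mu]_(v in `[grid j, grid j.+1[) k v| <=
  h * (L * h + B * crossings (grid j) (grid j.+1)).
Proof.
have gj : grid j < grid j.+1 by rewrite grid_step ltrDl.
have mI : measurable (`[grid j, grid j.+1[%classic : set R) by exact: measurable_itv.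
have lI : fine (mu `[grid j, grid j.+1[%classic) = h.
  by rewrite lebesgue_measure_itv/= lte_fin gj -EFinB/= grid_step addrAC subrr add0r.
have ci (c : R) : mu.-integrable `[grid j, grid j.+1[ (EFin \o (fun=> c)).
  apply: measurable_bounded_integrable => //.
    exact: lebesgue_co_finite.
  exists `|c|; split; first by rewrite num_real.
  by move=> M cM z _ /=; exact: ltW.
have -> : h * k (grid j) = \int[mu]_(v in `[grid j, grid j.+1[) k (grid j).
  by rewrite Rintegral_cst// lI mulrC.
rewrite -RintegralB//; last exact: bump_bounded_integrable.
apply: (le_trans (le_normr_Rintegral _ _)) => //.
  rewrite (_ : _ \o _ = (EFin \o (fun=> k (grid j))) \- (EFin \o k))%E//.
  by apply: integrableB => //; exact: bump_bounded_integrable.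
have -> : h * (L * h + B * crossings (grid j) (grid j.+1)) =
    \int[mu]_(v in `[grid j, grid j.+1[) (L * h + B * crossings (grid j) (grid j.+1)).
  by rewrite Rintegral_cst// lI mulrC.
apply: le_Rintegral => //.
- rewrite (_ : EFin \o _ = (abse \o ((EFin \o (fun=> k (grid j))) \- (EFin \o k))))%E//.
  apply: integrable_abse => //.
  by apply: integrableB => //; exact: bump_bounded_integrable.
move=> v; rewrite /= in_itv/= => /andP[v1 v2]; rewrite distrC.
apply: le_trans (bump_increment v1) _; apply: lerD.
  by rewrite ler_wpM2l// lerBlDl -grid_step ltW.
by rewrite ler_wpM2l// crossings_le// ltW.
Qed.

(** Each cell contributes an error of order h^2, except for the at most two cells
    that contain a jump of k. *)
Lemma bump_riemann_sum n :
  `|h * \sum_(j < n) k (grid j) - \int[mu]_(v in `[grid 0, grid n[) k v| <=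
  h * (L * h * n%:R + 2 * B).
Proof.
have mI x y : measurable (`[x, y[%classic : set R) by exact: measurable_itv.
have gle i : grid 0 <= grid i.
  by rewrite /grid mulr0 addr0 lerDl mulr_ge0// ltW.
have split_int : \int[mu]_(v in `[grid 0, grid n[) k v =
    \sum_(j < n) \int[mu]_(v in `[grid j, grid j.+1[) k v.
  elim: n => [|n IH].
    rewrite big_ord0 (_ : `[grid 0, grid 0[%classic = set0) ?Rintegral_set0//.
    by apply/seteqP; split => v //=; rewrite in_itv/= => /andP[h1 /(le_lt_trans h1)]; rewrite ltxx.
  rewrite big_ord_recr/= -IH.
  have gn : grid n <= grid n.+1 by rewrite grid_step lerDl ltW.
  have e : `[grid 0, grid n.+1[%classic = `[grid 0, grid n[%classic `|` `[grid n, grid n.+1[%classic.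
    apply/seteqP; split => v /=; rewrite !in_itv/=.
      move=> /andP[h1 h2]; have [h3|h3] := ltP v (grid n); first by left; rewrite h1.
      by right; rewrite h2.
    move=> [/andP[h1 h2]|/andP[h1 h2]]; first by rewrite h1 (lt_le_trans h2).
    by rewrite h2 (le_trans (gle n)).
  rewrite e Rintegral_setU//; first by rewrite -e; exact: bump_bounded_integrable.
  apply/disj_setPS => v [] /=; rewrite !in_itv/= => /andP[_ h1] /andP[h2 _].
  by have := lt_le_trans h1 h2; rewrite ltxx.
rewrite split_int mulr_sumr -sumrB; apply: (le_trans (ler_norm_sum _ _ _)).
apply: (@le_trans _ _ (\sum_(j < n) h * (L * h + B * crossings (grid j) (grid j.+1)))).
  by apply: ler_sum => j _; exact: bump_cell.
rewrite -mulr_sumr ler_wpM2l ?(ltW h0)//.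
have eL : \sum_(j < n) L * h = L * h * n%:R by rewrite sumr_const card_ord mulr_natr.
rewrite big_split/= eL lerD2l -mulr_sumr mulrC ler_wpM2r//.
exact: sum_crossings.
Qed.

Lemma bump_integral_support n : grid 0 <= -1 -> 1 < grid n ->
  \int[mu]_(v in `[grid 0, grid n[) k v = \int[mu]_(v in `[-1, 1]) k v.
Proof.
move=> g0 gn; have [_ _ kz _ _] := bk.
rewrite Rintegral_mkcond [RHS]Rintegral_mkcond; congr Rintegral.
apply/funext => v; rewrite !patchE.
have [v1|v1] := leP `|v| 1.
  rewrite !mem_set//=; rewrite in_itv/=; move: v1; rewrite ler_norml => /andP[v1 v2].
    by rewrite v1.
  by rewrite (le_trans g0 v1) (le_lt_trans v2).
by rewrite kz//; case: ifP; case: ifP.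
Qed.

End Bump.

(** * The moments of the kernel *)

Section Kernel.
Context (R : realType).
Variable K : R -> R.
Hypothesis K_kernel : is_kernel K.
Local Notation mu := (@lebesgue_measure R).

Lemma kernel_support u : 1 < `|u| -> K u = 0.
Proof.
have [_ _ _ cK _] := K_kernel => u1; apply/eqP/negP => /negP Ku.
have : closure [set u | K u != 0] u by exact: subset_closure.
by rewrite cK/= in_itv/= -ler_norml leNgt u1.
Qed.

Lemma kernel_restrict : K = K \_ `[-1, 1].
Proof.
apply/funext => u; rewrite patchE; case: ifPn => // /negP h.
apply: kernel_support; rewrite ltNge; apply/negP => h1; apply: h.
by apply/mem_set; rewrite /= in_itv/= -ler_norml.
Qed.

Lemma kernel_within_continuous : {within `[-1, 1], continuous K}.
Proof. by have [_ _ _ _ KC1] := K_kernel; exact: (C1_continuous KC1). Qed.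

Lemma measurable_kernel : measurable_fun setT K.
Proof.
rewrite kernel_restrict; have mI : measurable (`[-1, 1]%classic : set R) by exact: measurable_itv.
apply/(measurable_restrictT _ mI); apply: subspace_continuous_measurable_fun => //.
exact: kernel_within_continuous.
Qed.

Lemma kernel_bump : exists L B, 0 < B /\ lipschitz_bump K L B.
Proof.
have [_ _ _ _ KC1] := K_kernel.
have n11 : (-1 : R) < 1 by rewrite gtrN.
have [L L0 hL] := C1_lipschitz KC1.
pose B := `|K 0| + L + 1.
have B0 : 0 < B by rewrite ltr_wpDl// addr_ge0.
exists L, B; split => //; split => //.
- move=> u; have [h|h] := leP `|u| 1; last by rewrite kernel_support// normr0 ltW.
  have := hL 0 u; rewrite -!ler_norml normr0 subr0 => /(_ ler01 h) hu.
  rewrite -[K u](subrK (K 0)) (le_trans (ler_normD _ _))//.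
  have : L * `|u| <= L by rewrite -[leRHS]mulr1 ler_wpM2l.
  rewrite /B; lra.
- exact: kernel_support.
- by move=> x y hx hy; apply: hL; rewrite -ler_norml.
- exact: measurable_kernel.
Qed.

Lemma kernel_mass : \int[mu]_(u in `[-1, 1]) K u = 1.
Proof.
have [_ K1 _ _ _] := K_kernel.
by rewrite Rintegral_mkcond -kernel_restrict /Rintegral K1.
Qed.

Lemma bump_integrable (k : R -> R) (L B : R) : lipschitz_bump k L B ->
  mu.-integrable `[-1, 1] (EFin \o k).
Proof.
move=> [_ kB _ _ mk]; apply: measurable_bounded_integrable => //.
- by rewrite [X in (X < _)%E]lebesgue_measure_itv/=; case: ifP => _; rewrite ?ltry// -EFinB ltry.
- exact: measurable_funTS.
- exists B; split; first by rewrite num_real.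
  by move=> M BM z _ /=; exact: le_trans (kB z) (ltW BM).
Qed.

(** By symmetry. *)
Lemma kernel_first_moment : \int[mu]_(u in `[-1, 1]) (u * K u) = 0.
Proof.
have [_ _ Ksym _ _] := K_kernel.
have c : {within `[- 1, - (-1)], continuous (fun u : R => u * K u)}.
  rewrite opprK => u.
  apply: cvgM; last exact: kernel_within_continuous.
  by apply: continuous_subspaceT => v; exact: cvg_id.
have n11 : (-1 : R) <= 1 by lra.
have := integration_by_substitution_oppr n11 c; rewrite opprK => h.
have {}h : \int[mu]_(u in `[-1, 1]) (u * K u) = \int[mu]_(u in `[-1, 1]) (-1 * (u * K u)).
  rewrite /Rintegral h; congr fine; apply: eq_integral => u _ /=.
  by rewrite Ksym mulN1r mulNr.
have [L [B [B0 bk]]] := kernel_bump.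
have bk1 := lipschitz_bumpX bk.
have aux (x y : R) : x = y -> y = -1 * x -> x = 0 by lra.
apply: (aux _ _ h).
by apply: RintegralZl; [exact: measurable_itv|exact: bump_integrable bk1].
Qed.

(** The mass of K cannot concentrate near 0, since K is bounded. *)
Lemma mu2_gt0 : 0 < mu2 K.
Proof.
have [K0 _ _ _ _] := K_kernel.
have [L [B [B0 bk]]] := kernel_bump.
have bk2 := lipschitz_bumpX (lipschitz_bumpX bk).
have mK : mu2 K = \int[mu]_(u in `[-1, 1]) (u * (u * K u)).
  by apply: eq_Rintegral => u _; rewrite expr2 mulrA.
pose eta := (4 * B)^-1.
have e0 : 0 < eta by rewrite invr_gt0 mulr_gt0.
pose A : set R := `[- eta, eta]%classic.
have mA : measurable A by exact: measurable_itv.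
have mI : measurable (`[-1, 1]%classic : set R) by exact: measurable_itv.
pose I1 : set R := `[-1, 1]%classic.
have muA : fine (mu (A `&` I1)) <= 2 * eta.
  have muAe : mu A = (2 * eta)%:E.
    have ee : - eta < eta by lra.
    rewrite lebesgue_measure_itv/= lte_fin ee.
    by rewrite -EFinB opprK; congr EFin; ring.
  have le : (mu (A `&` I1) <= mu A)%E.
    by apply: le_measure; rewrite ?inE//; exact: measurableI.
  rewrite -lee_fin fineK -?muAe// ge0_fin_numE//.
  by apply: le_lt_trans le _; rewrite muAe ltry.
have iA : mu.-integrable `[-1, 1] (EFin \o (\1_A : R -> R)).
  apply: measurable_bounded_integrable => //.
  - by rewrite [X in (X < _)%E]lebesgue_measure_itv/=; case: ifP => _; rewrite ?ltry// -EFinB ltry.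
  - exists 1; split; first by rewrite num_real.
    move=> M M1 z _ /=; rewrite indicE; apply: ltW; apply: le_lt_trans M1.
    by case: (_ \in _); rewrite ?normr1 ?normr0.
have iK := bump_integrable bk.
have i1 : mu.-integrable `[-1, 1] (EFin \o (fun u => eta ^+ 2 * K u)).
  rewrite (_ : _ \o _ = (fun u => (eta ^+ 2)%:E * (EFin \o K) u)%E); last first.
    by apply/funext => u /=; rewrite EFinM.
  exact: integrableZl.
have i2 : mu.-integrable `[-1, 1] (EFin \o (fun u => eta ^+ 2 * B * \1_A u)).
  rewrite (_ : _ \o _ = (fun u => (eta ^+ 2 * B)%:E * (EFin \o \1_A) u)%E); last first.
    by apply/funext => u /=; rewrite EFinM.
  exact: integrableZl.
have h : \int[mu]_(u in `[-1, 1]) (eta ^+ 2 * K u - eta ^+ 2 * B * \1_A u) <= mu2 K.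
  rewrite mK; apply: le_Rintegral => //.
  - have e : (EFin \o (fun u => eta ^+ 2 * K u - eta ^+ 2 * B * \1_A u))%R =
        ((EFin \o (fun u => eta ^+ 2 * K u)%R) \- (EFin \o (fun u => eta ^+ 2 * B * \1_A u)%R))%E.
      by apply/funext => u /=; rewrite EFinB.
    rewrite [X in _.-integrable _ X]e.
    exact: integrableB.
  - exact: (bump_integrable bk2).
  move=> u _; rewrite mulrA -expr2 indicE; have [/set_mem|/negP uA] := boolP (u \in A).
    rewrite mulr1 => _.
    have Kb : K u <= B by have [_ kB _ _ _] := bk; exact: le_trans (ler_norm _) (kB u).
    apply: (@le_trans _ _ 0); last by rewrite mulr_ge0// sqr_ge0.
    by rewrite subr_le0 ler_wpM2l// sqr_ge0.
  rewrite mulr0 subr0 ler_wpM2r//.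
  rewrite -[leRHS]real_normK ?num_real// ler_sqr ?nnegrE ?(ltW e0)//.
  rewrite leNgt; apply/negP => ue; apply: uA; apply/mem_set.
  by rewrite /A/= in_itv/= -ler_norml ltW.
apply: lt_le_trans h; rewrite RintegralB// !RintegralZl// kernel_mass mulr1.
rewrite (_ : \int[mu]_(_ in _) \1_A _ = fine (mu (A `&` I1))); last first.
  by rewrite /Rintegral integral_indic.
apply: (@lt_le_trans _ _ (eta ^+ 2 - eta ^+ 2 * B * (2 * eta))); last first.
  by rewrite lerD2l lerN2 ler_wpM2l// mulr_ge0 ?sqr_ge0// ltW.
rewrite (_ : _ - _ = eta ^+ 2 / 2); first by rewrite divr_gt0// exprn_gt0.
by rewrite /eta; field; rewrite gt_eqF.
Qed.

End Kernel.

(** * Distribution functions and quantiles *)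

Section Quantile.
Context (R : realType) d (T : measurableType d) (P : probability T R).
Variables (eps : int -> {RV P >-> R}) (eps' : {RV P >-> R}).
Hypothesis eps_iid : iid (innovations eps eps').
Local Notation past := (past eps).
Variables (G : R -> history R -> R) (f : R -> R -> R).
Hypothesis G_meas : measurable_model G.
Hypothesis f_density : is_density eps G f.
Local Notation F := (mcdf eps G).
Local Notation mu := (@lebesgue_measure R).

Lemma mcdf_past i t x : 0 <= t <= 1 -> fine (P (past i @^-1` below G t x)) = F t x.
Proof.
move=> t01; congr fine.
have mB := measurable_below G_meas x t01.
by apply: (prob_select eps_iid (k := past_index i) (k' := past_index 0)) => //;
  exact: past_index_inj.
Qed.

Lemma mcdf_slab i t x y : 0 <= t <= 1 -> x <= y ->
  fine (P (past i @^-1` (below G t y `\` below G t x))) = F t y - F t x.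
Proof.
move=> t01 xy; rewrite -!(mcdf_past i)//.
have mB z : measurable (past i @^-1` below G t z).
  by apply: measurable_past_preimage; exact: measurable_below.
rewrite (_ : past i @^-1` _ = past i @^-1` below G t y `\` past i @^-1` below G t x)//.
rewrite measureD//; last by rewrite ltey_eq fin_num_measure.
rewrite setIidr; last by move=> w; rewrite /below /= => h; exact: le_trans xy.
by rewrite fineB// fin_num_measure.
Qed.

Lemma mcdf_integral t x y : 0 <= t <= 1 -> x <= y ->
  (F t y - F t x)%:E = (\int[mu]_(z in `]x, y]) (f t z)%:E)%E.
Proof.
move=> t01 xy; rewrite -(mcdf_slab 0)//.
have [_ _ /(_ 0 `]x, y]%classic (measurable_itv _)) <-] := f_density t01.
rewrite fineK; last first.
  rewrite fin_num_measure//; apply: measurable_past_preimage.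
  by apply: measurableD; exact: measurable_below.
congr (P _); apply/seteqP; split => w; rewrite /below /zeta /= in_itv/=.
  by move=> [h1 /negP]; rewrite -ltNge => h2; rewrite h2.
by move=> /andP[h1 h2]; split => //; apply/negP; rewrite -ltNge.
Qed.

Lemma mcdf_nondecreasing t x y : 0 <= t <= 1 -> x <= y -> F t x <= F t y.
Proof.
move=> t01 xy; rewrite -subr_ge0 -lee_fin mcdf_integral//.
by apply: integral_ge0 => z _; have [_ h _] := f_density t01; rewrite lee_fin.
Qed.

Lemma mcdf_increment_bounds t x y m M : 0 <= t <= 1 -> x <= y -> 0 <= m ->
  (forall z, x <= z <= y -> m <= f t z <= M) ->
  m * (y - x) <= F t y - F t x <= M * (y - x).
Proof.
move=> t01 xy m0 hf; have [mf f0 _] := f_density t01.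
have M0 : 0 <= M.
  by have /andP[h1 h2] := hf x (introT andP (conj (lexx x) xy)); exact: le_trans m0 (le_trans h1 h2).
have mI : measurable (`]x, y]%classic : set R) by exact: measurable_itv.
have mfE : measurable_fun (`]x, y]%classic : set R) (EFin \o f t).
  by apply/measurable_EFinP; exact: measurable_funTS.
have ci (c : R) : (\int[mu]_(z in `]x, y]) c%:E)%E = (c * (y - x))%:E.
  rewrite integral_cst// [X in (_ * X)%E]lebesgue_measure_itv/= lte_fin.
  case: ltP => [_|yx]; first by rewrite -EFinB -EFinM.
  by rewrite (_ : y = x) ?subrr ?mulr0 ?mule0//; apply/eqP; rewrite eq_le yx.
have hz z : `]x, y]%classic z -> m <= f t z <= M.
  by rewrite /= in_itv/= => /andP[h1 h2]; apply: hf; rewrite (ltW h1).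
rewrite -!lee_fin mcdf_integral// -!ci; apply/andP; split; apply: ge0_le_integral => //.
- by move=> z /hz/andP[h1 _]; rewrite lee_fin.
- by move=> z _; rewrite lee_fin.
- by move=> z /hz/andP[_ h1]; rewrite lee_fin.
Qed.

Hypothesis B3 : condB3 f.

Lemma density_lipschitz : exists2 L : R, 0 < L & forall s t x y, 0 <= s <= 1 ->
  0 <= t <= 1 -> `|f s x - f t y| <= L * (`|s - t| + `|x - y|).
Proof.
have [L [_ hL]] := B3.
exists (`|L| + 1); first by rewrite ltr_wpDl.
move=> s t x y s01 t01.
have := hL (`|L| + 1) _ ((s, x), (t, y)).
have -> : L < `|L| + 1 by rewrite (le_lt_trans (ler_norm _))// ltrDl.
move=> /(_ isT) /=.
have hst : (unit_strip `*` unit_strip) ((s, x), (t, y)).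
  by split; split => //=; rewrite in_itv.
move=> /(_ hst) h; apply: (le_trans h); rewrite ler_wpM2l ?addr_ge0//.
by rewrite ge_max /= lerDl lerDr !normr_ge0.
Qed.

(** Between x and y the density at time t differs from f s z by at most L times the
    sum of the three distances. *)
Lemma mcdf_linear (L : R) s t x y z : 0 < L ->
  (forall s t x y, 0 <= s <= 1 -> 0 <= t <= 1 ->
     `|f s x - f t y| <= L * (`|s - t| + `|x - y|)) ->
  0 <= s <= 1 -> 0 <= t <= 1 ->
  `|F t y - F t x - f s z * (y - x)| <=
  L * (`|t - s| + `|x - z| + `|y - x|) * `|y - x|.
Proof.
move=> L0 hL s01 t01.
have [_ ft0 _] := f_density t01; have [_ fs0 _] := f_density s01.
have key x' y' e : x' <= y' ->
    (forall v, x' <= v <= y' -> `|f t v - f s z| <= e) ->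
    `|F t y' - F t x' - f s z * (y' - x')| <= e * (y' - x').
  move=> xy he.
  have e0 : 0 <= e by apply: le_trans (he x' _) => //; rewrite lexx.
  have := @mcdf_increment_bounds t x' y' (Num.max 0 (f s z - e)) (f s z + e) t01 xy.
  have m0 : 0 <= Num.max 0 (f s z - e) by rewrite le_max lexx.
  have hb v : x' <= v <= y' -> Num.max 0 (f s z - e) <= f t v <= f s z + e.
    move=> hv; have := he v hv; rewrite ler_norml => /andP[h1 h2].
    by rewrite ge_max ft0/=; apply/andP; split; lra.
  move=> /(_ m0 hb)/andP[h1 h2].
  have h3 : (f s z - e) * (y' - x') <= F t y' - F t x'.
    by apply: le_trans h1; rewrite ler_wpM2r ?subr_ge0// le_max lexx orbT.
  by rewrite ler_norml; apply/andP; split; lra.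
have [xy|/ltW yx] := leP x y.
  rewrite [`|y - x|]ger0_norm ?subr_ge0//; apply: key => // v /andP[xv vy].
  apply: le_trans (hL t s v z t01 s01) _; rewrite ler_wpM2l ?(ltW L0)//.
  rewrite -addrA lerD2l; have := ler_normD (v - x) (x - z).
  by rewrite subrKA [`|v - x|]ger0_norm ?subr_ge0//; lra.
rewrite (_ : _ - _ = - (F t x - F t y - f s z * (x - y))); last ring.
rewrite normrN distrC [`|y - x|]distrC [X in _ <= _ * X]ger0_norm ?subr_ge0//.
rewrite distrC; apply: key => // v /andP[xv vy].
apply: le_trans (hL t s v z t01 s01) _; rewrite ler_wpM2l ?(ltW L0)//.
rewrite -addrA lerD2l; have := ler_normD (v - x) (x - z).
by rewrite subrKA [`|v - x|]ler0_norm ?subr_le0// [`|x - y|]ger0_norm ?subr_ge0//; lra.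
Qed.

Let zeta_rv t (t01 : 0 <= t <= 1) : measurable_fun setT (zeta eps G 0 t).
Proof.
by apply: (measurableT_comp (f := G t)); [exact: measurable_response|exact: measurable_past].
Qed.

Let mcdfE t (t01 : 0 <= t <= 1) :
  F t = fine \o cdf (mfun_Sub (mem_set (zeta_rv t01)) : {RV P >-> R}).
Proof.
apply/funext => x; rewrite /mcdf /= /cdf /distribution /pushforward/=; congr (fine (P _)).
Qed.

Lemma mcdf_near1 t e : 0 <= t <= 1 -> 0 < e -> exists x, 1 - e < F t x.
Proof.
move=> t01 e0.
have : F t x @[x --> +oo] --> (1 : R) by rewrite (mcdfE t01); exact/fine_cvg/cvg_cdfy1.
move=> /cvgrPdist_lt/(_ e e0) h; have [x /ltr_distlBl hx] := filter_ex h.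
by exists x.
Qed.

Lemma mcdf_near0 t e : 0 <= t <= 1 -> 0 < e -> exists x, F t x < e.
Proof.
move=> t01 e0.
have : F t x @[x --> -oo] --> (0 : R) by rewrite (mcdfE t01); exact/fine_cvg/cvg_cdfNy0.
move=> /cvgrPdist_lt/(_ e e0) h; have [x hx] := filter_ex h.
exists x; move: hx; rewrite sub0r normrN => /ltr_normlW; exact.
Qed.

Lemma mcdf_continuous t : 0 <= t <= 1 -> continuous (F t).
Proof.
move=> t01 x; have [L L0 hL] := density_lipschitz.
pose M := f t x + L * 2.
have fx0 : 0 <= f t x by have [_ h _] := f_density t01.
have M0 : 0 < M by rewrite ltr_wpDl// mulr_gt0.
apply/cvgrPdist_le => e e0.
have h1 : \forall y \near x, `|x - y| <= Num.min 1 (e / M).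
  have : y @[y --> x] --> x by exact: cvg_id.
  by move=> /cvgrPdist_le/(_ (Num.min 1 (e / M))); apply; rewrite lt_min ltr01 divr_gt0.
near=> y; have : `|x - y| <= Num.min 1 (e / M) by near: y.
rewrite le_min distrC => /andP[h2 h3].
have := @mcdf_linear L t t x y x L0 hL t01 t01.
rewrite !subrr !normr0 !add0r => h4.
have h5 : `|F t y - F t x| <= (f t x + L * `|y - x|) * `|y - x|.
  have := ler_normD (F t y - F t x - f t x * (y - x)) (f t x * (y - x)).
  rewrite subrK normrM (ger0_norm fx0) => h; apply: (le_trans h); rewrite mulrDl addrC.
  by rewrite lerD2l.
rewrite distrC; apply: (le_trans h5); apply: (@le_trans _ _ (M * (e / M))).
  apply: ler_pM => //; first by rewrite addr_ge0// mulr_ge0// ltW.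
  by rewrite /M lerD2l ler_wpM2l ?(ltW L0)// (le_trans h2)// ler1n.
by rewrite mulrCA divff ?gt_eqF// mulr1.
Unshelve. all: by end_near. Qed.

(** A continuous distribution function takes its quantile back to the level. *)
Lemma mcdf_quantile alpha t : 0 < alpha < 1 -> 0 <= t <= 1 ->
  F t (quantile eps G alpha t) = alpha.
Proof.
move=> /andP[a0 a1] t01; rewrite /quantile.
set S := [set x | alpha <= F t x].
have [x0 hx0] : exists x, F t x < alpha by exact: mcdf_near0.
have [x1] : exists x, 1 - (1 - alpha) < F t x by apply: mcdf_near1 => //; rewrite subr_gt0.
rewrite subKr => hx1.
have x01 : x0 <= x1.
  rewrite leNgt; apply/negP => /ltW/(mcdf_nondecreasing t01) h.
  by have := lt_trans hx0 (lt_le_trans hx1 h); rewrite ltxx.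
have [z _ hz] : exists2 z, z \in `[x0, x1] & F t z = alpha.
  apply: IVT => //; first exact/continuous_subspaceT/mcdf_continuous.
  by rewrite ge_min le_max (ltW hx0) (ltW hx1) orbT.
have Sz : S z by rewrite /S /= hz.
have lbS : lbound S x0.
  move=> y; rewrite /S/= => hy; rewrite leNgt; apply/negP => /ltW/(mcdf_nondecreasing t01) h.
  by have := le_lt_trans (le_trans hy h) hx0; rewrite ltxx.
have hS : has_inf S by split; [exists z|exists x0].
apply/eqP; rewrite eq_le; apply/andP; split.
  by rewrite -hz; apply: mcdf_nondecreasing => //; apply: ge_inf => //; exists x0.
rewrite leNgt; apply/negP => lt.
have := mcdf_continuous t01; move=> /(_ (inf S))/cvgrPdist_lt.
have e0 : 0 < alpha - F t (inf S) by rewrite subr_gt0.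
move=> /(_ _ e0) => /nbhs_ballP[e1 /= e10 he].
have [y Sy hy] := inf_adherent e10 hS.
have hy' : inf S <= y by apply: ge_inf => //; exists x0.
have := he y; rewrite /ball/= distrC ger0_norm ?subr_ge0// ltrBlDl => /(_ hy).
have h6 := mcdf_nondecreasing t01 hy'.
rewrite distrC ger0_norm ?subr_ge0// ltrD2r => h7.
by have := lt_le_trans h7 Sy; rewrite ltxx.
Qed.

End Quantile.

(** * The rates of convergence *)

Section Rates.
Context (R : realType).
Variables (b : nat -> R) (n : nat).
Local Notation L := (ln n%:R : R).
Local Notation S := (n%:R * b n).
Local Notation r := (L / Num.sqrt S).
Local Notation rho := (rho b n).
Local Notation rate := (rate b n).

(** Inequalities that hold for all large n, and from which all the comparisons
    between the rates follow. *)
Definition regime : Prop :=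
  [/\ 0 < b n, b n <= 1, 1 <= L, L ^+ 2 <= S & rho <= 1].

Hypothesis reg : regime.

Let b0 : 0 < b n. Proof. by case: reg. Qed.
Let b1 : b n <= 1. Proof. by case: reg. Qed.
Let L1 : 1 <= L. Proof. by case: reg. Qed.
Let LS : L ^+ 2 <= S. Proof. by case: reg. Qed.
Let rho1 : rho <= 1. Proof. by case: reg. Qed.
Let L0 : 0 < L. Proof. exact: lt_le_trans L1. Qed.

Lemma effective_size_ge1 : 1 <= S.
Proof. by apply: le_trans LS; exact: exprn_ege1. Qed.

Let S0 : 0 < S. Proof. exact: lt_le_trans effective_size_ge1. Qed.

Lemma effective_size_le : S <= n%:R.
Proof. by rewrite -[leRHS]mulr1 ler_wpM2l. Qed.

Lemma regime_n_gt0 : (0 < n)%N.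
Proof. by rewrite lt0n; apply/eqP => n0; move: S0; rewrite n0 mul0r ltxx. Qed.

Lemma noise_gt0 : 0 < r.
Proof. by rewrite divr_gt0// sqrtr_gt0. Qed.

Lemma noise_sqr : S * r ^+ 2 = L ^+ 2.
Proof. by rewrite exprMn exprVn sqr_sqrtr ?(ltW S0)// mulrCA divff ?gt_eqF// mulr1. Qed.

Lemma noise_le_rho : r <= rho.
Proof. by rewrite lerDl sqr_ge0. Qed.

Lemma rho_gt0 : 0 < rho.
Proof. exact: lt_le_trans noise_gt0 noise_le_rho. Qed.

Lemma sqr_bandwidth_le_rho : b n ^+ 2 <= rho.
Proof. by rewrite lerDr ltW// noise_gt0. Qed.

Lemma inv_effective_size_le : S^-1 <= r ^+ 2.
Proof. by rewrite -(ler_pM2l S0) noise_sqr divff ?gt_eqF// exprn_ege1. Qed.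

Lemma inv_effective_size_le_rho : S^-1 <= rho.
Proof.
apply: le_trans inv_effective_size_le _; apply: le_trans noise_le_rho.
by rewrite expr2 ler_piMl ?(ltW noise_gt0)// (le_trans noise_le_rho).
Qed.

Lemma sqrt_rho_noise : S * (Num.sqrt rho * r) = Num.sqrt (S * rho) * L.
Proof.
rewrite [Num.sqrt (S * rho)]sqrtrM ?(ltW S0)//; set a := Num.sqrt rho; set q := Num.sqrt S.
have q0 : q != 0 by rewrite gt_eqF// sqrtr_gt0.
have -> : S = q ^+ 2 by rewrite sqr_sqrtr// ltW.
by field.
Qed.

Let rateE : rate = Num.sqrt rho * r + b n * rho + rho ^+ 2.
Proof. by rewrite /Defs.rate mulrA. Qed.

Let sr0 : 0 <= Num.sqrt rho * r.
Proof. by rewrite mulr_ge0 ?sqrtr_ge0// ltW// noise_gt0. Qed.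
Let br0 : 0 <= b n * rho.
Proof. by rewrite mulr_ge0// ltW// rho_gt0. Qed.

Lemma sqrt_rho_noise_le_rate : Num.sqrt rho * r <= rate.
Proof. by rewrite rateE -addrA lerDl addr_ge0// sqr_ge0. Qed.

Lemma bandwidth_rho_le_rate : b n * rho <= rate.
Proof. by rewrite rateE addrAC lerDr addr_ge0// sqr_ge0. Qed.

Lemma sqr_rho_le_rate : rho ^+ 2 <= rate.
Proof. by rewrite rateE lerDr addr_ge0. Qed.

Lemma rate_gt0 : 0 < rate.
Proof. by apply: lt_le_trans sqr_rho_le_rate; rewrite exprn_gt0// rho_gt0. Qed.

Lemma rate_le : rate <= 3 * rho.
Proof.
have r0 := noise_gt0; have p0 := rho_gt0; have rp := noise_le_rho.
have h1 : Num.sqrt rho * r <= rho.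
  apply: le_trans rp; rewrite ler_piMl ?(ltW r0)// -sqrtr1 ler_wsqrtr//.
have h2 : b n * rho <= rho by rewrite ler_piMl// ltW.
have h3 : rho ^+ 2 <= rho by rewrite expr2 ler_piMl// ltW.
rewrite rateE; lra.
Qed.

(** A grid of mesh rate over a square of side rho thus has of the order of 1 / r
    points at most, which is less than sqrt(n b). *)
Lemma rate_sqr_ge : rho ^+ 2 * r <= rate ^+ 2.
Proof.
have r0 := noise_gt0; have p0 := rho_gt0.
apply: (@le_trans _ _ ((Num.sqrt rho * r) ^+ 2 + (b n * rho) ^+ 2)).
  rewrite [(Num.sqrt rho * _) ^+ 2]exprMn [(b n * _) ^+ 2]exprMn sqr_sqrtr ?(ltW p0)// {1}expr2.
  rewrite [X in X * _ * r]/(Defs.rho b n) -/(Defs.rho b n).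
  have h : b n ^+ 2 * r * rho <= b n ^+ 2 * rho ^+ 2.
    rewrite -mulrA ler_wpM2l ?sqr_ge0// expr2 ler_wpM2r ?(ltW p0)//.
    exact: noise_le_rho.
  have -> : (r + b n ^+ 2) * rho * r = rho * r ^+ 2 + b n ^+ 2 * r * rho by ring.
  by rewrite lerD2l.
have h : Num.sqrt rho * r + b n * rho <= rate by rewrite rateE lerDl sqr_ge0.
have h2 : 0 <= 2 * (Num.sqrt rho * r) * (b n * rho).
  by apply: mulr_ge0 => //; exact: mulr_ge0.
apply: (@le_trans _ _ ((Num.sqrt rho * r + b n * rho) ^+ 2)).
  have -> : (Num.sqrt rho * r + b n * rho) ^+ 2 = (Num.sqrt rho * r) ^+ 2 + (b n * rho) ^+ 2 +
      2 * (Num.sqrt rho * r) * (b n * rho) by ring.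
  by rewrite lerDl.
by rewrite ler_sqr ?nnegrE ?(ltW rate_gt0)// addr_ge0.
Qed.

Lemma expR_log : expR (- (3 * L)) = (n%:R ^+ 3)^-1.
Proof.
have n0 : (0 : R) < n%:R by rewrite ltr0n regime_n_gt0.
by rewrite expRN mulrC mulr_natr -mulr_natl expRM_natl lnK.
Qed.

(** The Rademacher-Menshov argument loses a factor k.+1, hence log n only. *)
Lemma dyadic_levels m : m%:R <= 6 * S ->
  exists k : nat, [/\ (m <= 2 ^ k)%N, (2 ^ k)%:R <= 12 * S &
    k.+1%:R <= ((ln 12 + 1) / ln 2 + 1) * L].
Proof.
move=> hm.
have l2 : (0 : R) < ln 2 by rewrite ln_gt0// ltr1n.
have l12 : (0 : R) < ln 12 by rewrite ln_gt0// ltr1n.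
have [k [mk kS]] : exists k : nat, (m <= 2 ^ k)%N /\ (2 ^ k)%:R <= 12 * S.
  have [m1|m1] := leqP m 1.
    by exists 0%N; split => //; rewrite expn0; have := effective_size_ge1; lra.
  exists (up_log 2 m); have /andP[h1 h2] := up_log_bounds (isT : (1 < 2)%N) m1.
  split => //.
  have k0 : (0 < up_log 2 m)%N.
    by rewrite lt0n; apply/eqP => k0; move: h2; rewrite k0 expn0 leqNgt m1.
  have h3 : (2 ^ up_log 2 m <= 2 * m)%N.
    by rewrite -(prednK k0) expnS leq_mul2l/= ltnW.
  have {}h3 : (2 ^ up_log 2 m)%:R <= 2 * m%:R :> R by rewrite -natrM ler_nat.
  have -> : 12 * S = 2 * (6 * S) by ring.
  by apply: le_trans h3 _; rewrite ler_pM2l.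
exists k; split => //.
have h1 : k%:R * ln 2 <= ln 12 + L.
  have -> : k%:R * ln 2 = ln ((2 ^ k)%:R : R) by rewrite natrX lnXn// mulr_natl.
  have n0 : (0 : R) < n%:R by rewrite ltr0n regime_n_gt0.
  rewrite -lnM ?posrE// ler_ln ?posrE ?mulr_gt0//.
  by apply: (le_trans kS); rewrite ler_pM2l// effective_size_le.
have h2 : k%:R <= (ln 12 + L) / ln 2 by rewrite ler_pdivlMr.
rewrite -natr1 mulrDl lerD ?mul1r// (le_trans h2)// mulrAC ler_pM2r ?invr_gt0//.
by rewrite mulrDl mul1r lerD2r ler_peMr// ltW.
Qed.

End Rates.

(** * Uniform bounds for partial sums of centred indicators *)

Lemma indic_slab (R : realType) (G : R -> history R -> R) t x y (z : history R) : x <= y ->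
  \1_(below G t y `\` below G t x) z = \1_(below G t y) z - \1_(below G t x) z :> R.
Proof.
move=> xy; rewrite !indicE in_setD.
case: (boolP (z \in below G t x)) => [/set_mem h|_]; last by rewrite andbT subr0.
by rewrite mem_set ?subrr//; exact: le_trans xy.
Qed.

Lemma measure_bigsetU_le d (T : measurableType d) (R : realType)
    (P : probability T R) (I : finType) (B : I -> set T) (t : R) :
  (forall i, measurable (B i)) -> (forall i, (P (B i) <= t%:E)%E) ->
  (P (\big[setU/set0]_i B i) <= (#|I|%:R * t)%:E)%E.
Proof.
move=> mB Bt.
have h (s : seq I) : (P (\big[setU/set0]_(i <- s) B i) <= ((size s)%:R * t)%:E)%E.
  elim: s => [|i s IH]; first by rewrite big_nil measure0 mul0r.
  rewrite big_cons; apply: (le_trans (measureU2 _ _ _)) => //.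
    by apply: bigsetU_measurable.
  by rewrite /= -natr1 mulrDl mul1r addrC EFinD leeD.
by have := h (index_enum I); rewrite cardT enumT unlock.
Qed.

Section UniformTails.
Context (R : realType) d (T : measurableType d) (P : probability T R).
Variables (eps : int -> {RV P >-> R}) (eps' : {RV P >-> R}).
Hypothesis eps_iid : iid (innovations eps eps').
Local Notation past := (past eps).
Local Notation coupled_past := (coupled_past eps eps').
Variables (b : nat -> R) (n : nat).
Hypothesis reg : regime b n.
Local Notation L := (ln n%:R : R).
Local Notation S := (n%:R * b n).
Local Notation r := (L / Num.sqrt S).
Local Notation rho := (rho b n).
Local Notation rate := (rate b n).
Local Notation kappa := ((ln 12 + 1) / ln 2 + 1 : R).

Let S0 : 0 < S. Proof. exact: lt_le_trans (effective_size_ge1 reg). Qed.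
Let L1 : 1 <= L. Proof. by case: reg. Qed.
Let n0 : (0 : R) < n%:R. Proof. by rewrite ltr0n (regime_n_gt0 reg). Qed.

(** The exponential inequality at the scale where the variance proxy of a sum over
    a window is S sigma; the deviation carries a large multiple of log n so as to
    beat any power of n. *)
Lemma window_partial_sums_tail (E : nat -> set (history R)) (p : nat -> history R -> R)
    (c dl : nat -> R) (v h D V sigma A l2 : R) (a m : nat) :
  (forall i, predictor eps (E i) (p i) v) -> (forall i, `|c i| <= 1) ->
  0 <= h -> (forall j, 0 <= dl j) -> (forall M, \sum_(j < M) dl j <= D) ->
  (forall i k, Ex P (fun w => (p i (past k%:Z w) - p i (coupled_past k w)) ^+ 2) <=
    (h * dl k) ^+ 2) ->
  1 <= S * sigma -> v <= V * sigma -> 6 <= A -> 0 < l2 -> m%:R <= 6 * S ->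
  exists B : set T, [/\ measurable B,
    (P B <= (14 * expR (3 * V) / n%:R ^+ 2 +
       12 * kappa ^+ 2 * (h ^+ 2 * D ^+ 2) * (L ^+ 2 * S) / l2 ^+ 2)%:E)%E &
    forall w, ~ B w -> forall j, (j <= m)%N ->
      `|block (centred_term eps E c ^~ w) a j| <= A * (Num.sqrt (S * sigma) * L) + l2].
Proof.
move=> pE c1 h0 dl0 dlD p_stable Ssigma vV A6 l20 mS.
have [k [mk kS kL]] := dyadic_levels reg mS.
set q := Num.sqrt (S * sigma).
have q1 : 1 <= q by rewrite -sqrtr1 ler_wsqrtr.
have q0 : 0 < q by exact: lt_le_trans q1.
have qq : q ^+ 2 = S * sigma by rewrite sqr_sqrtr// (le_trans _ Ssigma).
(* for this x the variance term 2 x^2 v m is bounded *)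
pose x := (2 * q)^-1.
have x0 : 0 < x by rewrite invr_gt0 mulr_gt0.
have x2 : x <= 2^-1 by rewrite /x invfM ler_piMr// invf_le1.
have [B [mB PB hB]] := partial_sums_tail eps_iid pE c1 h0 dl0 dlD p_stable a
  (A * (q * L)) x0 x2 l20 mk.
exists B; split => //; apply: (le_trans PB); rewrite lee_fin; apply: lerD.
  have sigma0 : 0 < sigma.
    by have := lt_le_trans ltr01 Ssigma; rewrite pmulr_rgt0.
  have v0 : 0 <= v.
    by have [_ _ p0 pv _] := pE 0%N; exact: le_trans (p0 (fun=> 0)) (pv _).
  have V0 : 0 <= V by have := le_trans v0 vV; rewrite pmulr_lge0.
  have e1 : 2 * x ^+ 2 * v * m%:R <= 3 * V.
    apply: (@le_trans _ _ (2 * x ^+ 2 * (V * sigma) * (6 * S))).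
      by apply: ler_pM => //; [rewrite mulr_ge0// mulr_ge0// sqr_ge0|
         rewrite ler_wpM2l// mulr_ge0// sqr_ge0].
    have -> : 2 * x ^+ 2 * (V * sigma) * (6 * S) = 12 * V * (x ^+ 2 * (S * sigma)) by ring.
    rewrite -qq /x le_eqVlt; apply/orP; left; apply/eqP; field.
    by rewrite gt_eqF.
  have e2 : x * (A * (q * L)) = A / 2 * L by rewrite /x; field; rewrite gt_eqF.
  have e3 : expR (2 * x ^+ 2 * v * m%:R - x * (A * (q * L))) <= expR (3 * V) / n%:R ^+ 3.
    rewrite e2 -(expR_log reg) -expRD ler_expR; apply: lerD => //.
    rewrite lerN2 ler_wpM2r ?(le_trans ler01 L1)// ler_pdivlMr//.
    by apply: le_trans A6; rewrite -natrM.
  have m7 : m.+1%:R <= 7 * n%:R :> R.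
    rewrite -natr1; have := effective_size_le reg; have := effective_size_ge1 reg.
    by move: mS; lra.
  have eV := expR_gt0 (3 * V).
  apply: (@le_trans _ _ (7 * n%:R * (2 * (expR (3 * V) / n%:R ^+ 3)))).
    by apply: ler_pM; rewrite ?mulr_ge0 ?expR_ge0 ?ler_pM2l.
  by rewrite le_eqVlt; apply/orP; left; apply/eqP; field; rewrite gt_eqF.
rewrite ler_pM2r ?invr_gt0 ?exprn_gt0//.
have hD : 0 <= h ^+ 2 * D ^+ 2 by rewrite mulr_ge0// sqr_ge0.
have -> : 12 * kappa ^+ 2 * (h ^+ 2 * D ^+ 2) * (L ^+ 2 * S) =
  (kappa * L) ^+ 2 * (h ^+ 2 * D ^+ 2) * (12 * S) by ring.
apply: ler_pM => //; first by rewrite mulr_ge0// sqr_ge0.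
rewrite ler_wpM2r// ler_sqr ?nnegrE//.
exact: le_trans kL.
Qed.

Variables (G : R -> history R -> R) (Fc : R -> R -> history R -> R).
Hypothesis G_meas : measurable_model G.
Hypothesis Fc_cond : is_cond_cdf eps G Fc.
Hypothesis B1 : condB1 eps eps' Fc.
Variable C0 : R.
Hypothesis C0_ge0 : 0 <= C0.
Hypothesis steep : forall i : int,
  {ae P, forall w : T, (ereal_sup [set (dFc Fc 1 z.1 z.2 (past i w))%:E
                  | z in unit_strip] < C0%:E)%E}.
Local Notation F := (mcdf eps G).
Variables (tau base u : nat -> R) (a m : nat).
Hypothesis tau01 : forall i, 0 <= tau i <= 1.
Hypothesis u06 : forall i, 0 <= u i <= 6.
Hypothesis mS : m%:R <= 6 * S.

Definition deviation (l : nat -> R) (i : nat) (w : T) : R :=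
  \1_(below G (tau i) (l i)) (past i%:Z w) - F (tau i) (l i).

Variables D0 D1 : R.
Hypothesis D0_ub : forall M, \sum_(j < M) rdelta eps eps' (dFc Fc 0) j <= D0.
Hypothesis D1_ub : forall M, \sum_(j < M) rdelta eps eps' (dFc Fc 1) j <= D1.

(** Half-lines are predicted by the conditional distribution functions, with v = h = 1. *)
Lemma base_deviation_tail A : 6 <= A ->
  exists B : set T, [/\ measurable B,
    (P B <= (14 * expR 3 / n%:R ^+ 2 + 12 * kappa ^+ 2 * D0 ^+ 2 / A ^+ 2)%:E)%E &
    forall w, ~ B w -> forall j, (j <= m)%N ->
      `|block (deviation base ^~ w) a j| <= 2 * A * (S * r)].
Proof.
move=> A6; have A0 : 0 < A by exact: lt_le_trans A6.
have st : stable eps eps' (dFc Fc 0) by case: (B1 (isT : (0 <= 3)%N)).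
have r0 := noise_gt0 reg.
have l20 : 0 < A * (S * r) by rewrite mulr_gt0// mulr_gt0.
have sm i k : Ex P (fun w => (below_predictor Fc (tau i) (base i) (past k%:Z w) -
    below_predictor Fc (tau i) (base i) (coupled_past k w)) ^+ 2) <=
    (1 * rdelta eps eps' (dFc Fc 0) k) ^+ 2.
  by rewrite mul1r; exact: (below_predictor_stable G_meas Fc_cond (base i) k (tau01 i) st).
have pE i := below_predictorP G_meas Fc_cond (base i) (tau01 i).
have S1 : 1 <= S * 1 by rewrite mulr1 effective_size_ge1.
have c1 (i : nat) : `|1 : R| <= 1 by rewrite normr1.
have V1 : 1 <= 1 * 1 :> R by rewrite mulr1.
have [B [mB PB hB]] := window_partial_sums_tail a pE c1 ler01 (rdelta_ge0 _ _ _)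
  D0_ub sm S1 V1 A6 l20 mS.
exists B; split => //.
  apply: (le_trans PB); rewrite lee_fin mulr1 lerD2l.
  rewrite le_eqVlt; apply/orP; left; apply/eqP.
  have -> : (A * (S * r)) ^+ 2 = A ^+ 2 * (S * (S * r ^+ 2)) by ring.
  rewrite (noise_sqr reg); set q := kappa; set s := S; field.
  by rewrite !gt_eqF// (lt_le_trans ltr01 L1).
move=> w Bw j jm; have := hB w Bw j jm.
rewrite (_ : block _ a j = block (deviation base ^~ w) a j); last first.
  apply: eq_bigr => i _; rewrite /centred_term /deviation mul1r.
  by rewrite (mcdf_past eps_iid G_meas).
move=> /le_trans; apply; rewrite mulr1.
have -> : Num.sqrt S * L = S * r.
  have q0 : Num.sqrt S != 0 by rewrite gt_eqF// sqrtr_gt0.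
  by rewrite -{2}(sqr_sqrtr (ltW S0)); field.
by rewrite le_eqVlt; apply/orP; left; apply/eqP; ring.
Qed.

(** The parametrization with slopes u i >= 0 makes lines monotone in both
    parameters. *)
Definition line (g0 g1 : R) (i : nat) : R := base i + g0 + g1 * u i.

(** The probability of a slab is the mean of its predictor. *)
Lemma mcdf_increment_le s x y : 0 <= s <= 1 -> x <= y -> F s y - F s x <= C0 * (y - x).
Proof.
move=> s01 xy; rewrite -(mcdf_slab eps_iid G_meas 0 s01 xy).
have pr := slab_predictorP eps_iid G_meas Fc_cond B1 C0_ge0 steep s01 xy.
have [mE _ _ pv _] := pr.
have := Ex_predictor pr 0 (bounded_measurable_cst _ 1).
under eq_fun do rewrite mulr1.
under [X in _ = Ex P X]eq_fun do rewrite mulr1.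
rewrite Ex_indic; last exact: measurable_past_preimage.
move=> ->; rewrite -[leRHS](Ex_cst P); apply: le_Ex.
- exact/bounded_measurable_past/(predictor_bounded pr).
- exact: bounded_measurable_cst.
- by move=> w; exact: pv.
Qed.

(** Signed slabs turn the increment between two lines into a sum of centred
    indicators whose probabilities are of the order of the distance. *)
Lemma line_deviation_tail M g0 g1 A : 0 <= M -> `|g0| <= 2 * M * rho ->
  `|g1| <= 2 * M * rho -> 6 <= A ->
  exists B : set T, [/\ measurable B,
    (P B <= (14 * expR (42 * C0 * M) / n%:R ^+ 2 +
      12 * kappa ^+ 2 * ((14 * M) ^+ 2 * D1 ^+ 2) * (rho ^+ 2 * r ^+ 2) / (A * rate) ^+ 2)%:E)%E &
    forall w, ~ B w -> forall j, (j <= m)%N ->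
      `|block (fun i => deviation (line g0 g1) i w - deviation base i w) a j| <=
      2 * A * (S * rate)].
Proof.
move=> M0 hg0 hg1 A6; have A0 : 0 < A by exact: lt_le_trans A6.
have p0 := rho_gt0 reg; have x0 := rate_gt0 reg; have r0 := noise_gt0 reg.
pose H := 14 * M * rho.
have H0 : 0 <= H by rewrite !mulr_ge0// ltW.
pose lo i := Num.min (base i) (line g0 g1 i).
pose hi i := Num.max (base i) (line g0 g1 i).
have lohi i : lo i <= hi i by rewrite ge_min le_max lexx.
have hilo i : hi i - lo i <= H.
  have -> : hi i - lo i = `|g0 + g1 * u i|.
    rewrite /hi /lo (_ : g0 + g1 * u i = line g0 g1 i - base i); last by rewrite /line; ring.
    by case: leP => h; [rewrite ger0_norm ?subr_ge0|rewrite ltr0_norm ?subr_lt0// opprB].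
  apply: (le_trans (ler_normD _ _)); rewrite normrM /H.
  have /andP[u0 u6] := u06 i.
  have : `|g1| * `|u i| <= 2 * M * rho * 6 by apply: ler_pM => //; rewrite ger0_norm.
  lra.
pose E i := below G (tau i) (hi i) `\` below G (tau i) (lo i).
pose p i := slab_predictor Fc C0 (tau i) (lo i) (hi i).
pose c i : R := if base i <= line g0 g1 i then 1 else -1.
have pE i : predictor eps (E i) (p i) (C0 * H).
  have [h1 h2 h3 h4 h5] :=
    slab_predictorP eps_iid G_meas Fc_cond B1 C0_ge0 steep (tau01 i) (lohi i).
  by split => // z; apply: le_trans (h4 z) _; rewrite ler_wpM2l.
have c1 i : `|c i| <= 1 by rewrite /c; case: ifP => _; rewrite ?normrN normr1.
have sm i k : Ex P (fun w => (p i (past k%:Z w) - p i (coupled_past k w)) ^+ 2) <=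
    (H * rdelta eps eps' (dFc Fc 1) k) ^+ 2.
  apply: le_trans (slab_predictor_stable eps_iid G_meas Fc_cond B1 C0_ge0 steep k
    (tau01 i) (lohi i)) _.
  have d0 := rdelta_ge0 (P := P) eps eps' (dFc Fc 1) k.
  have hl0 : 0 <= hi i - lo i by rewrite subr_ge0.
  by apply: lerXn2r; rewrite ?nnegrE; [exact: mulr_ge0|exact: mulr_ge0|exact: ler_wpM2r].
have Sp : 1 <= S * rho.
  by have := inv_effective_size_le_rho reg; rewrite -div1r ler_pdivrMr// mulrC.
have vV : C0 * H <= (14 * C0 * M) * rho.
  by rewrite le_eqVlt; apply/orP; left; apply/eqP; rewrite /H; ring.
have l20 : 0 < A * (S * rate) by rewrite mulr_gt0// mulr_gt0.
have [B [mB PB hB]] := window_partial_sums_tail a pE c1 H0 (rdelta_ge0 _ _ _)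
  D1_ub sm Sp vV A6 l20 mS.
exists B; split => //.
  apply: (le_trans PB); rewrite lee_fin.
  have -> : 3 * (14 * C0 * M) = 42 * C0 * M by ring.
  rewrite lerD2l le_eqVlt; apply/orP; left; apply/eqP.
  rewrite -(noise_sqr reg) /H; set q := kappa; set s := S; set y := r; field.
  by rewrite !gt_eqF.
move=> w Bw j jm; have := hB w Bw j jm.
rewrite (_ : block _ a j =
    block (fun i => deviation (line g0 g1) i w - deviation base i w) a j); last first.
  apply: eq_bigr => i _; rewrite /centred_term /deviation /E.
  rewrite (mcdf_slab eps_iid G_meas _ (tau01 _) (lohi _)) indic_slab//.
  rewrite /c /lo /hi; case: leP => h; ring.
move=> /le_trans; apply; rewrite -(sqrt_rho_noise reg).
have := sqrt_rho_noise_le_rate reg; rewrite -(ler_pM2l S0) -(ler_pM2l A0); lra.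
Qed.

(** Indicators and distribution functions increase with the line; the centring of a
    line differs from those of the two lines around it by the Lipschitz bound. *)
Lemma deviation_bracket (l l1 l2 : nat -> R) (w : T) (e dlt : R) j :
  (forall i, l1 i <= l i <= l2 i) -> (forall i, l2 i - l1 i <= dlt) ->
  `|block (fun i => deviation l1 i w - deviation base i w) a j| <= e ->
  `|block (fun i => deviation l2 i w - deviation base i w) a j| <= e ->
  `|block (fun i => deviation l i w - deviation base i w) a j| <= e + C0 * dlt * j%:R.
Proof.
move=> hl hd; rewrite !ler_norml => /andP[h1 _] /andP[_ h2].
have e1 : C0 * dlt * j%:R = \sum_(i < j) C0 * dlt by rewrite sumr_const card_ord mulr_natr.
have ind i x y : x <= y -> \1_(below G (tau i) x) (past i%:Z w) <=
    \1_(below G (tau i) y) (past i%:Z w) :> R.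
  move=> xy; rewrite !indicE ler_nat; case: (boolP (_ \in below G (tau i) x)) => // /set_mem h.
  by rewrite mem_set//; exact: le_trans xy.
have inc i x y : x <= y -> y - x <= dlt ->
    F (tau i) y - F (tau i) x <= C0 * dlt.
  move=> xy yx; apply: (le_trans (mcdf_increment_le (tau01 i) xy)).
  by rewrite ler_wpM2l.
have hl1 i : l1 i <= l i by have /andP[] := hl i.
have hl2 i : l i <= l2 i by have /andP[] := hl i.
have lower : block (fun i => deviation l1 i w - deviation base i w) a j - \sum_(i < j) C0 * dlt <=
    block (fun i => deviation l i w - deviation base i w) a j.
  rewrite /block -sumrB; apply: ler_sum => i _; rewrite /deviation.
  set k := (a + i)%N.
  have h3 := ind k _ _ (hl1 k).
  have h4 : F (tau k) (l k) - F (tau k) (l1 k) <= C0 * dlt.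
    by apply: inc => //; apply: le_trans (hd k); rewrite lerD2r.
  lra.
have upper : block (fun i => deviation l i w - deviation base i w) a j <=
    block (fun i => deviation l2 i w - deviation base i w) a j + \sum_(i < j) C0 * dlt.
  rewrite /block -big_split/=; apply: ler_sum => i _; rewrite /deviation.
  set k := (a + i)%N.
  have h3 := ind k _ _ (hl2 k).
  have h4 : F (tau k) (l2 k) - F (tau k) (l k) <= C0 * dlt.
    by apply: inc => //; apply: le_trans (hd k); rewrite lerD2l lerN2.
  lra.
by rewrite e1; apply/andP; split; lra.
Qed.

(** A grid of mesh rate in the ball of radius M rho: between two neighbouring lines
    the deviations are monotone up to the increment of the distribution function. *)
Lemma uniform_line_deviation_tail M A : 3 <= M -> 6 <= A ->
  exists B : set T, [/\ measurable B,
    (P B <= ((4 * M) ^+ 2 * (14 * expR (42 * C0 * M)) / n%:R +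
      (4 * M) ^+ 2 * (12 * kappa ^+ 2 * ((14 * M) ^+ 2 * D1 ^+ 2)) / A ^+ 2)%:E)%E &
    forall w, ~ B w -> forall g0 g1, `|g0| <= M * rho -> `|g1| <= M * rho ->
      forall j, (j <= m)%N ->
      `|block (fun i => deviation (line g0 g1) i w - deviation base i w) a j| <=
      (2 * A + 42 * C0) * (S * rate)].
Proof.
move=> M3 A6; have M0 : 0 < M by exact: lt_le_trans M3.
have A0 : 0 < A by exact: lt_le_trans A6.
have p0 := rho_gt0 reg; have x0 := rate_gt0 reg; have r0 := noise_gt0 reg.
(* the cell of M rho may end beyond M rho, hence N.+2 points in each direction *)
pose N := Num.truncn (2 * M * rho / rate).
have Mp0 : 0 < M * rho by rewrite mulr_gt0.
have xMp : rate <= M * rho.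
  by apply: (le_trans (rate_le reg)); rewrite ler_pM2r.
have y0 : 0 <= 2 * M * rho / rate by rewrite !mulr_ge0// ?invr_ge0 ltW.
have NE := truncn_itv y0; rewrite -/N in NE.
have /andP[N1 N2] := NE.
pose pt (j : nat) : R := - (M * rho) + j%:R * rate.
have ptS j : pt j.+1 = pt j + rate by rewrite /pt -natr1 mulrDl mul1r addrA.
have ptb (j : nat) : (j <= N.+1)%N -> `|pt j| <= 2 * M * rho.
  move=> jN; have : j%:R * rate <= N.+1%:R * rate by rewrite ler_pM2r// ler_nat.
  have : N%:R * rate <= 2 * M * rho by rewrite -ler_pdivlMr.
  have : 0 <= j%:R * rate by rewrite mulr_ge0// ltW.
  rewrite -natr1 mulrDl mul1r ler_norml /pt => *; apply/andP; split; lra.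
pose tail := 14 * expR (42 * C0 * M) / n%:R ^+ 2 +
      12 * kappa ^+ 2 * ((14 * M) ^+ 2 * D1 ^+ 2) * (rho ^+ 2 * r ^+ 2) / (A * rate) ^+ 2.
have /boolp.choice[B hB] : forall jj : 'I_N.+2 * 'I_N.+2, exists B : set T, [/\ measurable B,
    (P B <= tail%:E)%E & forall w, ~ B w -> forall j, (j <= m)%N ->
      `|block (fun i => deviation (line (pt jj.1) (pt jj.2)) i w - deviation base i w) a j| <=
      2 * A * (S * rate)].
  move=> [j0 j1]; apply: line_deviation_tail => //; first exact: ltW.
  - by apply: ptb; rewrite -ltnS.
  - by apply: ptb; rewrite -ltnS.
exists (\big[setU/set0]_jj B jj); split.
- by apply: bigsetU_measurable => jj _; have [] := hB jj.
- have mB jj : measurable (B jj) by have [] := hB jj.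
  have PB jj : (P (B jj) <= tail%:E)%E by have [] := hB jj.
  apply: (le_trans (measure_bigsetU_le mB PB)).
  rewrite lee_fin card_prod card_ord natrM -expr2.
  have yx : N.+2%:R <= 4 * M * (rho / rate).
    have : 1 <= M * rho / rate by rewrite ler_pdivlMr// mul1r.
    by move: N1; rewrite -!mulrA -[N.+2%:R]natr1 -[N.+1%:R]natr1; lra.
  have tail0 : 0 <= tail.
    apply: addr_ge0; first by rewrite divr_ge0 ?mulr_ge0 ?expR_ge0 ?sqr_ge0.
    by repeat first [exact: sqr_ge0 | exact: ler0n | rewrite invr_ge0 | apply: mulr_ge0].
  apply: (@le_trans _ _ ((4 * M * (rho / rate)) ^+ 2 * tail)).
    by rewrite ler_wpM2r// lerXn2r ?nnegrE// (le_trans _ yx).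
  pose z := (rho / rate) ^+ 2.
  have z0 : 0 <= z by exact: sqr_ge0.
  have zr : z * r <= 1.
    by rewrite /z expr_div_n mulrAC ler_pdivrMr ?exprn_gt0// mul1r (rate_sqr_ge reg).
  have zn : z <= n%:R.
    have q1 : 1 <= Num.sqrt S by rewrite -[leLHS]sqrtr1; apply: ler_wsqrtr; exact: effective_size_ge1 reg.
    have r1 : 1 <= n%:R * r.
      apply: (@le_trans _ _ (S * r)); last by rewrite ler_pM2r// effective_size_le.
      have -> : S * r = Num.sqrt S * L.
        by rewrite -{1}(sqr_sqrtr (ltW S0)); field; rewrite gt_eqF// sqrtr_gt0.
      by rewrite -[leLHS]mulr1; apply: ler_pM.
    rewrite -(ler_pM2r r0); exact: le_trans zr r1.
  have -> : (4 * M * (rho / rate)) ^+ 2 * tail = (4 * M) ^+ 2 * (14 * expR (42 * C0 * M)) * (z / n%:R ^+ 2) +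
    (4 * M) ^+ 2 * (12 * kappa ^+ 2 * ((14 * M) ^+ 2 * D1 ^+ 2)) / A ^+ 2 * (z * r) ^+ 2.
    rewrite /tail /z; set q := kappa; set y := r; set e := expR _; field.
    by rewrite !gt_eqF.
  apply: lerD.
    apply: ler_wpM2l.
      by repeat first [exact: sqr_ge0 | exact: ler0n | exact: expR_ge0 | apply: mulr_ge0].
    by rewrite ler_pdivrMr ?exprn_gt0// expr2 mulrA mulVf ?gt_eqF// mul1r.
  rewrite ler_piMr//.
    by repeat first [exact: sqr_ge0 | exact: ler0n | rewrite invr_ge0 | apply: mulr_ge0].
  by rewrite expr_le1// mulr_ge0// ltW.
move=> w Bw g0 g1 hg0 hg1 j jm.
have {}Bw jj : ~ B jj w.
  by move=> h; apply: Bw; rewrite (bigD1 jj)//=; left.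
have cell g : `|g| <= M * rho -> exists2 k : nat, (k <= N)%N & pt k <= g <= pt k.+1.
  rewrite ler_norml => /andP[h1 h2].
  have z0 : 0 <= (g + M * rho) / rate by apply: divr_ge0; [lra|exact: ltW].
  have /andP[k1 k2] := truncn_itv z0.
  exists (Num.truncn ((g + M * rho) / rate)).
    by apply: le_truncn; rewrite ler_pM2r ?invr_gt0//; lra.
  rewrite /pt; move: k1 k2; rewrite ler_pdivlMr// ltr_pdivrMr// => *; apply/andP; split; lra.
have [k0 kN0 /andP[k01 k02]] := cell g0 hg0.
have [k1 kN1 /andP[k11 k12]] := cell g1 hg1.
have k0S : (k0 < N.+2)%N by rewrite ltnS leqW.
have k1S : (k1 < N.+2)%N by rewrite ltnS leqW.
pose lo : 'I_N.+2 * 'I_N.+2 := (Ordinal k0S, Ordinal k1S).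
pose hi : 'I_N.+2 * 'I_N.+2 := (@Ordinal N.+2 k0.+1 kN0, @Ordinal N.+2 k1.+1 kN1).
have [_ _ /(_ _ (Bw lo) j jm) hlo] := hB lo.
have [_ _ /(_ _ (Bw hi) j jm) hhi] := hB hi.
have h := @deviation_bracket (line g0 g1) _ _ w _ (7 * rate) j _ _ hlo hhi.
apply: (le_trans (h _ _)).
- move=> i; have /andP[u0 u6] := u06 i; rewrite /line/=.
  have h1 : pt k1 * u i <= g1 * u i by rewrite ler_wpM2r.
  have h2 : g1 * u i <= pt k1.+1 * u i by rewrite ler_wpM2r.
  by apply/andP; split; lra.
- move=> i; have /andP[u0 u6] := u06 i; rewrite /line/= !ptS.
  have : rate * u i <= rate * 6 by rewrite ler_pM2l.
  lra.
have jS : j%:R <= 6 * S by apply: le_trans mS; rewrite ler_nat.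
have : C0 * (7 * rate) * j%:R <= C0 * (7 * rate) * (6 * S).
  by rewrite ler_wpM2l// !mulr_ge0// ltW.
lra.
Qed.

End UniformTails.

(** * Minimizers of convex criteria with a nearly linear subgradient *)

(** At the point at distance tau from the zero of the affine map, on the way to th, the
    affine map has a component of order - c tau along the segment.  An error of less
    than half of it per coordinate cannot make its product with th - (u, v)
    non-negative. *)
Lemma minimizer_near_zero (R : realType) (S0 S1 : R -> R -> R)
    (g0 g1 c0 c1 e tau th0 th1 : R) :
  0 < c0 -> 0 < c1 -> 0 < tau -> 2 * e < c0 * tau -> 2 * e < c1 * tau ->
  (forall u v, 0 <= S0 u v * (th0 - u) + S1 u v * (th1 - v)) ->
  (forall u v, `|u - g0 / c0| <= tau -> `|v - g1 / c1| <= tau ->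
     `|S0 u v - (g0 - c0 * u)| <= e /\ `|S1 u v - (g1 - c1 * v)| <= e) ->
  `|th0 - g0 / c0| <= tau /\ `|th1 - g1 / c1| <= tau.
Proof.
move=> c00 c10 tau0 e0 e1 sub lin.
set z0 := g0 / c0; set z1 := g1 / c1.
apply: contrapT => far.
pose N := Num.max `|th0 - z0| `|th1 - z1|.
have tN : tau < N.
  rewrite /N lt_max -[X in X || _]negbK -[X in _ || X]negbK -!leNgt -negb_and.
  by apply/negP => /andP h; apply: far.
have N0 : 0 < N by exact: lt_trans tN.
pose d0 := (th0 - z0) / N; pose d1 := (th1 - z1) / N.
have d0E : th0 = z0 + N * d0 by rewrite /d0; field; rewrite gt_eqF.
have d1E : th1 = z1 + N * d1 by rewrite /d1; field; rewrite gt_eqF.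
have d0_le : `|d0| <= 1.
  by rewrite normrM normfV (gtr0_norm N0) ler_pdivrMr// mul1r le_max lexx.
have d1_le : `|d1| <= 1.
  by rewrite normrM normfV (gtr0_norm N0) ler_pdivrMr// mul1r le_max lexx orbT.
have one : d0 ^+ 2 = 1 \/ d1 ^+ 2 = 1.
  have : N = `|th0 - z0| \/ N = `|th1 - z1| by rewrite /N; case: leP; [right|left].
  move=> [] e'; [left|right]; rewrite -[_ ^+ 2]ger0_norm ?sqr_ge0// normrX normrM normfV.
    by rewrite (gtr0_norm N0) -e' divff ?gt_eqF// expr1n.
  by rewrite (gtr0_norm N0) -e' divff ?gt_eqF// expr1n.
pose u := z0 + tau * d0; pose v := z1 + tau * d1.
have tle x : `|x| <= 1 -> `|tau * x| <= tau.
  by move=> h; rewrite normrM gtr0_norm// ler_piMr// ltW.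
have hu : `|u - z0| <= tau by rewrite /u addrC addKr tle.
have hv : `|v - z1| <= tau by rewrite /v addrC addKr tle.
have [h0 h1] := lin u v hu hv.
have := sub u v.
have -> : th0 - u = (N - tau) * d0 by rewrite d0E /u; ring.
have -> : th1 - v = (N - tau) * d1 by rewrite d1E /v; ring.
have -> : S0 u v * ((N - tau) * d0) + S1 u v * ((N - tau) * d1) =
  (N - tau) * (S0 u v * d0 + S1 u v * d1) by ring.
rewrite pmulr_rge0 ?subr_gt0//.
have E0 : g0 - c0 * u = - (c0 * tau * d0).
  by rewrite /u /z0; field; rewrite gt_eqF.
have E1 : g1 - c1 * v = - (c1 * tau * d1).
  by rewrite /v /z1; field; rewrite gt_eqF.
have e_ge0 : 0 <= e by exact: le_trans h0.
have b0 : `|(S0 u v - (g0 - c0 * u)) * d0| <= e.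
  by rewrite normrM -[leRHS]mulr1 ler_pM.
have b1 : `|(S1 u v - (g1 - c1 * v)) * d1| <= e.
  by rewrite normrM -[leRHS]mulr1 ler_pM.
have b0' := le_trans (ler_norm _) b0; have b1' := le_trans (ler_norm _) b1.
move: b0' b1'; rewrite E0 E1 !mulrBl !mulNr => b0' b1'.
have q0 : 0 <= c0 * tau * d0 * d0.
  by rewrite -[leRHS]mulrA -expr2 mulr_ge0 ?sqr_ge0// mulr_ge0// ltW.
have q1 : 0 <= c1 * tau * d1 * d1.
  by rewrite -[leRHS]mulrA -expr2 mulr_ge0 ?sqr_ge0// mulr_ge0// ltW.
have : c0 * tau <= c0 * tau * d0 * d0 + c1 * tau * d1 * d1 \/
       c1 * tau <= c0 * tau * d0 * d0 + c1 * tau * d1 * d1.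
  case: one => h; [left|right].
    by rewrite -[X in _ <= X + _]mulrA -expr2 h mulr1 lerDl.
  by rewrite -[X in _ <= _ + X]mulrA -expr2 h mulr1 lerDr.
by case => h h'; lra.
Qed.

Section CheckLoss.
Context (R : realType).
Implicit Types (alpha x y : R).

Lemma check_loss_subgradient alpha x y : 0 <= alpha <= 1 ->
  check_loss alpha x + psi alpha x * (y - x) <= check_loss alpha y.
Proof.
move=> /andP[a0 a1]; rewrite /check_loss /psi.
have h1 : alpha * y <= alpha * Num.max y 0 by rewrite ler_wpM2l// le_max lexx.
have h2 : (1 - alpha) * (- y) <= (1 - alpha) * Num.max (- y) 0.
  by rewrite ler_wpM2l ?subr_ge0// le_max lexx.
have h3 : 0 <= alpha * Num.max y 0 by rewrite mulr_ge0// le_max lexx orbT.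
have h4 : 0 <= (1 - alpha) * Num.max (- y) 0.
  by rewrite mulr_ge0 ?subr_ge0// le_max lexx orbT.
have [x0|x0] := leP x 0.
  rewrite max_l ?oppr_ge0//=; lra.
rewrite max_r ?oppr_le0 ?(ltW x0)//=; lra.
Qed.

(** Minus the score is a subgradient of the criterion, so that a minimizer
    satisfies this inequality at every point (b0, b1). *)
Lemma objective_subgradient (K : R -> R) (b : nat -> R) alpha n (x : nat -> R)
    (s b0 b1 c0 c1 : R) : 0 <= alpha <= 1 -> (forall u, 0 <= K u) ->
  is_argmin K b alpha n x s c0 c1 ->
  0 <= (c0 - b0) * (\sum_(1 <= i < n.+1)
      psi alpha (x i - b0 - b1 * (design n i - s)) * K ((design n i - s) / b n)) +
    (c1 - b1) * (\sum_(1 <= i < n.+1)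
      psi alpha (x i - b0 - b1 * (design n i - s)) * (design n i - s) *
      K ((design n i - s) / b n)).
Proof.
move=> a01 K0 /(_ b0 b1) amin.
rewrite !mulr_sumr -big_split/= -oppr_le0 -sumrN.
apply: le_trans (_ : objective K b alpha n x s c0 c1 - objective K b alpha n x s b0 b1 <= 0);
  last by rewrite subr_le0.
rewrite /objective -sumrB; apply: ler_sum => i _.
set z := design n i - s; set k := K _.
have := ler_wpM2r (K0 (z / b n)) (check_loss_subgradient (x i - b0 - b1 * z)
  (x i - c0 - c1 * z) a01).
rewrite -/k; lra.
Qed.

End CheckLoss.

(** * Kernel sums over a window *)

Section Window.
Context (R : realType).
Variables (b : nat -> R) (n : nat) (t : R).
Hypothesis reg : regime b n.
Local Notation S := (n%:R * b n).
Hypothesis t_lo : n%:R^-1 <= t - 2 * b n.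
Hypothesis t_hi : t + 2 * b n <= 1.
Local Notation mu := (@lebesgue_measure R).

Let b0 : 0 < b n. Proof. by case: reg. Qed.
Let n0 : (0 : R) < n%:R. Proof. by rewrite ltr0n (regime_n_gt0 reg). Qed.
Let S0 : 0 < S. Proof. by rewrite mulr_gt0. Qed.

(** The indices from window_start to window_end, excluded, contain every i such that
    i / n is within b n of a point of the window around t. *)
Definition window_start : nat := Num.truncn (n%:R * (t - 2 * b n)).
Definition window_end : nat := (Num.truncn (n%:R * (t + 2 * b n))).+1.
Definition window_size : nat := window_end - window_start.
Local Notation a := window_start.
Local Notation m := window_size.

Let lo_ge0 : 0 <= n%:R * (t - 2 * b n).
Proof. by rewrite mulr_ge0// (le_trans _ t_lo)// invr_ge0. Qed.
Let hi_ge0 : 0 <= n%:R * (t + 2 * b n).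
Proof. by apply: le_trans lo_ge0 _; rewrite ler_pM2l//; move: b0; lra. Qed.

Lemma window_start_le : a%:R <= n%:R * (t - 2 * b n).
Proof. by have /andP[] := truncn_itv lo_ge0. Qed.

Lemma window_start_gt : n%:R * (t - 2 * b n) < a%:R + 1.
Proof. by have /andP[_] := truncn_itv lo_ge0; rewrite natr1. Qed.

Lemma window_end_gt : n%:R * (t + 2 * b n) < window_end%:R.
Proof. by have /andP[] := truncn_itv hi_ge0. Qed.

Lemma window_end_le : window_end%:R <= n%:R * (t + 2 * b n) + 1.
Proof. by rewrite /window_end -[leLHS]natr1 lerD2r; have /andP[] := truncn_itv hi_ge0. Qed.

Lemma window_start_gt0 : (0 < a)%N.
Proof.
rewrite truncn_gt_nat; apply: (@le_trans _ _ (n%:R * n%:R^-1)).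
  by rewrite divff// gt_eqF.
by rewrite ler_pM2l.
Qed.

Lemma window_endE : window_end = (a + m)%N.
Proof.
rewrite /window_size subnKC// -(ler_nat R); apply/ltW/(le_lt_trans window_start_le).
by apply: le_lt_trans window_end_gt; rewrite ler_pM2l//; move: b0; lra.
Qed.

Lemma window_end_le_n : (window_end <= n.+1)%N.
Proof.
rewrite /window_end ltnS -(ler_nat R); have /andP[h _] := truncn_itv hi_ge0.
by apply: le_trans h _; rewrite ler_piMr.
Qed.

Lemma window_size_le : m%:R <= 6 * S.
Proof.
have h1 := window_end_le; have h2 := window_start_gt; have h3 := effective_size_ge1 reg.
move: h1; rewrite window_endE natrD; lra.
Qed.

Lemma design_window i : (a <= i < a + m)%N -> 0 <= (design n i : R) <= 1 /\
  -3 <= (design n i - t) / b n <= 2.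
Proof.
move=> /andP[ai im].
have iw : (i <= n)%N by rewrite -ltnS (leq_trans im)// -window_endE window_end_le_n.
have h1 : a%:R <= i%:R :> R by rewrite ler_nat.
have h2 : i%:R + 1 <= window_end%:R :> R by rewrite natr1 ler_nat window_endE.
split.
  rewrite /design divr_ge0//= ler_pdivrMr// mul1r ler_nat//.
have e : (design n i - t) / b n = (i%:R - n%:R * t) / S.
  by rewrite /design; field; rewrite !gt_eqF.
have h3 := window_end_le; have h4 := window_start_gt; have h5 := effective_size_ge1 reg.
by rewrite e ler_pdivlMr// ler_pdivrMr//; apply/andP; split; lra.
Qed.

Variable s : R.
Hypothesis st : t - b n <= s <= t + b n.
Local Notation v i := ((design n i - s) / b n).

Lemma design_grid j : v (a + j) = grid (v a) S^-1 j.
Proof. by rewrite /grid /design natrD; field; rewrite !gt_eqF. Qed.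

Lemma window_grid_lo : v a <= -1.
Proof.
have h := window_start_le; have /andP[h1 h2] := st.
rewrite ler_pdivrMr// mulN1r lerBlDr /design ler_pdivrMr//; apply: (le_trans h).
by rewrite mulrC ler_pM2r//; lra.
Qed.

Lemma window_grid_hi : 1 < grid (v a) S^-1 m.
Proof.
rewrite -design_grid -window_endE.
have h := window_end_gt; have /andP[h1 h2] := st.
rewrite ltr_pdivlMr// mul1r ltrBrDr /design ltr_pdivlMr//; apply: le_lt_trans h.
by rewrite mulrC ler_pM2l//; lra.
Qed.

Lemma design_mono i j : (i < j)%N -> v i < v j.
Proof. by move=> ij; rewrite ltr_pM2r ?invr_gt0// ltrD2r ltr_pM2r ?invr_gt0// ltr_nat. Qed.

Lemma window_sum (g : nat -> R) (kern : R -> R) : (forall u, 1 < `|u| -> kern u = 0) ->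
  \sum_(1 <= i < n.+1) g i * kern (v i) =
  \sum_(j < m) g (a + j)%N * kern (v (a + j)).
Proof.
move=> kz.
have we : (a <= window_end)%N by rewrite window_endE leq_addr.
rewrite (big_cat_nat (n := a)) ?window_start_gt0//=; last first.
  exact: leq_trans we window_end_le_n.
rewrite [X in _ + X](big_cat_nat (n := window_end)) ?window_end_le_n//=.
rewrite [X in X + _]big1_seq ?add0r; last first.
  move=> i /andP[_]; rewrite mem_index_iota => /andP[_ ia].
  have h := lt_le_trans (design_mono ia) window_grid_lo.
  rewrite kz ?mulr0// ltr_normr; apply/orP; right; move: h; lra.
rewrite [X in _ + X]big1_seq ?addr0; last first.
  move=> i /andP[_]; rewrite mem_index_iota => /andP[ia _].
  have := window_grid_hi; rewrite -design_grid -window_endE => h.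
  have h2 : v window_end <= v i.
    by move: ia; rewrite leq_eqVlt => /orP[/eqP <-//|/design_mono/ltW].
  by rewrite kz ?mulr0// (lt_le_trans h)// (le_trans h2)// ler_norm.
rewrite -{1}[a]addn0 addnC big_addn big_mkord.
by apply: eq_bigr => j _; rewrite addnC.
Qed.

Variables (kern : R -> R) (Lk Bk : R).
Hypothesis bk : lipschitz_bump kern Lk Bk.

Let Lk0 : 0 <= Lk. Proof. by case: bk. Qed.
Let kB u : `|kern u| <= Bk. Proof. by case: bk. Qed.
Let Bk0 : 0 <= Bk. Proof. exact: le_trans (kB 0). Qed.

Let Sm : S^-1 * m%:R <= 6.
Proof. by rewrite mulrC ler_pdivrMr// window_size_le. Qed.

Lemma window_abel (x : nat -> R) (E : R) : 0 <= E ->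
  (forall j, (j <= m)%N -> `|block x a j| <= E) ->
  `|\sum_(j < m) x (a + j)%N * kern (v (a + j))| <= (6 * Lk + 3 * Bk) * E.
Proof.
move=> E0 hE.
have h0 : 0 < S^-1 by rewrite invr_gt0.
have := @abel_bound R (fun j => kern (grid (v a) S^-1 j)) (fun j => x (a + j)%N) m E Bk
  (6 * Lk + 2 * Bk) E0 hE (fun i => kB _).
have hv : \sum_(j < m) `|kern (grid (v a) S^-1 j.+1) - kern (grid (v a) S^-1 j)| <=
    6 * Lk + 2 * Bk.
  apply: (le_trans (bump_variation bk _ h0 _)); rewrite lerD2r -mulrA mulrC.
  by rewrite ler_wpM2r.
move=> /(_ hv) h.
have -> : (6 * Lk + 3 * Bk) * E = (Bk + (6 * Lk + 2 * Bk)) * E by ring.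
apply: le_trans h; rewrite le_eqVlt; apply/orP; left; apply/eqP; congr (`|_|).
by apply: eq_bigr => j _; rewrite design_grid mulrC.
Qed.

Lemma window_sum_le (x : nat -> R) (e : R) : 0 <= e ->
  (forall i, (a <= i < a + m)%N -> `|v i| <= 1 -> `|x i| <= e) ->
  `|\sum_(j < m) x (a + j)%N * kern (v (a + j))| <= 6 * Bk * e * S.
Proof.
move=> e0 hx; apply: (le_trans (ler_norm_sum _ _ _)).
apply: (@le_trans _ _ (\sum_(j < m) e * Bk)).
  apply: ler_sum => j _; rewrite normrM.
  have [h|h] := leP `|v (a + j)| 1.
    apply: ler_pM => //; apply: hx => //.
    by rewrite leq_addr ltn_add2l ltn_ord.
  have [_ _ kz _ _] := bk.
  by rewrite kz// normr0 mulr0 mulr_ge0.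
rewrite sumr_const card_ord -[leLHS]mulr_natr.
have -> : 6 * Bk * e * S = e * Bk * (6 * S) by ring.
by rewrite ler_wpM2l ?mulr_ge0// window_size_le.
Qed.

Lemma window_riemann :
  `|S^-1 * \sum_(j < m) kern (v (a + j)) - \int[mu]_(u in `[-1, 1]) kern u| <=
  S^-1 * (6 * Lk + 2 * Bk).
Proof.
have h0 : 0 < S^-1 by rewrite invr_gt0.
have g0 : grid (v a) S^-1 0 <= -1 by rewrite -design_grid addn0 window_grid_lo.
rewrite -(bump_integral_support bk g0 window_grid_hi).
under eq_bigr => j _ do rewrite design_grid.
apply: (le_trans (bump_riemann_sum bk _ h0 _)); rewrite ler_pM2l// lerD2r -mulrA mulrC.
by rewrite ler_wpM2r.
Qed.

End Window.

(** * The score in a shrinking neighbourhood *)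

Lemma lipschitz_bump_weaken (R : realType) (k : R -> R) (L L' B : R) : L <= L' ->
  lipschitz_bump k L B -> lipschitz_bump k L' B.
Proof.
move=> LL [L0 kB kz kL mk]; split => //; first exact: le_trans LL.
by move=> x y hx hy; apply: le_trans (kL x y hx hy) _; rewrite ler_wpM2r.
Qed.

Section Expansion.
Context (R : realType) d (T : measurableType d) (P : probability T R).
Variables (eps : int -> {RV P >-> R}) (eps' : {RV P >-> R}).
Hypothesis eps_iid : iid (innovations eps eps').
Variables (G : R -> history R -> R) (f : R -> R -> R).
Hypothesis G_meas : measurable_model G.
Hypothesis f_density : is_density eps G f.
Local Notation past := (past eps).
Local Notation F := (mcdf eps G).
Local Notation mu := (@lebesgue_measure R).
Variables (K : R -> R) (b : nat -> R) (alpha t : R) (n : nat).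
Hypothesis alpha01 : 0 < alpha < 1.
Hypothesis B3 : condB3 f.
Hypothesis reg : regime b n.
Local Notation L := (ln n%:R : R).
Local Notation S := (n%:R * b n).
Local Notation r := (L / Num.sqrt S).
Local Notation rho := (rho b n).
Local Notation rate := (rate b n).
Local Notation q := (quantile eps G alpha).
Local Notation dq := (dquantile eps G alpha).
Hypothesis t_lo : n%:R^-1 <= t - 2 * b n.
Hypothesis t_hi : t + 2 * b n <= 1.
Local Notation a := (window_start b n t).
Local Notation m := (window_size b n t).

Let b0 : 0 < b n. Proof. by case: reg. Qed.
Let n0 : (0 : R) < n%:R. Proof. by rewrite ltr0n (regime_n_gt0 reg). Qed.
Let S0 : 0 < S. Proof. by rewrite mulr_gt0. Qed.

(** The bounds for partial sums are stated for sequences defined at all indices;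
    the truncations have no effect inside the window. *)
Definition time (i : nat) : R := Num.min 1 (design n i).
Definition baseline (i : nat) : R := q t + (time i - t) * dq t.
Definition offset (i : nat) : R := clamp 0 6 ((design n i - t) / b n + 3).

Lemma time01 i : 0 <= time i <= 1.
Proof. by rewrite /time le_min ler01 ge_min lexx/= andbT divr_ge0. Qed.

Lemma offset06 i : 0 <= offset i <= 6.
Proof. by rewrite /offset clamp_ge clamp_le. Qed.

Lemma time_window i : (a <= i < a + m)%N -> time i = design n i.
Proof. by move=> /(design_window reg t_lo t_hi)[/andP[_ h] _]; rewrite /time min_r. Qed.

Lemma offset_window i : (a <= i < a + m)%N -> offset i = (design n i - t) / b n + 3.
Proof.
move=> /(design_window reg t_lo t_hi)[_ /andP[h1 h2]]; rewrite /offset clamp_id//; lra.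
Qed.

Variables Lam Lf C0 : R.
Hypothesis Lam0 : 0 <= Lam.
Hypothesis q_taylor : forall x s, 0 <= x <= 1 -> 0 <= s <= 1 ->
  `|q x - q s - (x - s) * dq s| <= Lam * (x - s) ^+ 2.
Hypothesis dq_lip : forall x s, 0 <= x <= 1 -> 0 <= s <= 1 ->
  `|dq x - dq s| <= Lam * `|x - s|.
Hypothesis dq_bnd : forall x, 0 <= x <= 1 -> `|dq x| <= Lam.
Hypothesis Lf0 : 0 < Lf.
Hypothesis f_lip : forall s t x y, 0 <= s <= 1 -> 0 <= t <= 1 ->
  `|f s x - f t y| <= Lf * (`|s - t| + `|x - y|).
Hypothesis C00 : 0 <= C0.
Hypothesis F_lip : forall s x y, 0 <= s <= 1 -> x <= y -> F s y - F s x <= C0 * (y - x).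

(** The tangent to the quantile curve at s, perturbed by (u, v) on the scale of the
    bandwidth. *)
Definition tangent (s u v : R) (i : nat) : R :=
  q s + u + (dq s + v / b n) * (design n i - s).

Lemma tangentE s u v i :
  tangent s u v i = q s + (design n i - s) * dq s + (u + v * ((design n i - s) / b n)).
Proof. by rewrite /tangent; ring. Qed.

(** The coefficients are of order rho because the quantile curve has a bounded
    second derivative and the window has length of order b n. *)
Lemma tangent_line M s u v : 0 <= s <= 1 -> t - b n <= s <= t + b n -> 0 <= M ->
  `|u| <= M * rho -> `|v| <= M * rho ->
  exists g0 g1, [/\ `|g0| <= (4 * Lam + 5 * M) * rho, `|g1| <= (4 * Lam + 5 * M) * rho &
    forall i, (a <= i < a + m)%N -> line baseline offset g0 g1 i = tangent s u v i].
Proof.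
move=> s01 st M0 hu hv.
have t01 : 0 <= t <= 1.
  have : 0 < n%:R^-1 :> R by rewrite invr_gt0.
  by move: t_lo t_hi b0 => *; apply/andP; split; lra.
have st' : `|s - t| <= b n by rewrite ler_norml; apply/andP; split; lra.
have p0 := rho_gt0 reg; have bp := sqr_bandwidth_le_rho reg.
pose g1 := b n * (dq s - dq t) + v.
pose g0 := (q s - q t - (s - t) * dq s) + u - v * ((s - t) / b n) - 3 * g1.
have h1 : `|b n * (dq s - dq t)| <= Lam * rho.
  rewrite normrM gtr0_norm//; apply: (@le_trans _ _ (b n * (Lam * b n))).
    rewrite ler_pM2l//; apply: le_trans (dq_lip s01 t01) _; exact: ler_wpM2l.
  have -> : b n * (Lam * b n) = Lam * b n ^+ 2 by ring.
  exact: ler_wpM2l.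
have hg1 : `|g1| <= (Lam + M) * rho.
  by rewrite mulrDl; apply: (le_trans (ler_normD _ _)); exact: lerD.
have h2 : `|q s - q t - (s - t) * dq s| <= Lam * rho.
  rewrite (_ : _ - _ = - (q t - q s - (t - s) * dq s)); last by ring.
  rewrite normrN; apply: le_trans (q_taylor t01 s01) _; rewrite ler_wpM2l//.
  apply: le_trans bp; rewrite -[leLHS]real_normK ?num_real// distrC ler_sqr ?nnegrE//.
  exact: ltW.
have h3 : `|v * ((s - t) / b n)| <= M * rho.
  rewrite normrM -[leRHS]mulr1; apply: ler_pM => //.
  by rewrite normrM normfV (gtr0_norm b0) ler_pdivrMr// mul1r.
exists g0, g1; split.
- have -> : (4 * Lam + 5 * M) * rho = Lam * rho + M * rho + M * rho + 3 * ((Lam + M) * rho).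
    by ring.
  apply: (le_trans (ler_normB _ _)); apply: lerD; last by rewrite normrM ger0_norm// ler_wpM2l.
  apply: (le_trans (ler_normB _ _)); apply: lerD => //.
  by apply: (le_trans (ler_normD _ _)); apply: lerD.
- apply: (le_trans hg1); rewrite ler_wpM2r ?(ltW p0)//; move: Lam0 M0; lra.
- move=> i iw; rewrite /line /baseline /tangent offset_window// time_window// /g0 /g1.
  by field; rewrite gt_eqF.
Qed.

Lemma density_near s : 0 <= s <= 1 -> t - b n <= s <= t + b n ->
  `|f s (q s) - f t (q t)| <= Lf * (1 + 2 * Lam) * b n.
Proof.
move=> s01; rewrite -ler_distl => st.
have t01 : 0 <= t <= 1.
  have : 0 < n%:R^-1 :> R by rewrite invr_gt0.
  by move: t_lo t_hi b0 => *; apply/andP; split; lra.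
apply: le_trans (f_lip _ _ s01 t01) _; rewrite -mulrA ler_pM2l// mulrDl mul1r.
apply: lerD => //; rewrite -[q s - q t](subrK ((s - t) * dq t)).
apply: (le_trans (ler_normD _ _)).
have -> : 2 * Lam * b n = Lam * b n + b n * Lam by ring.
apply: lerD; last by rewrite normrM; apply: ler_pM => //; exact: dq_bnd.
apply: le_trans (q_taylor s01 t01) _; rewrite ler_wpM2l//.
rewrite -[leLHS]real_normK ?num_real// expr2 -[leRHS]mulr1.
by apply: ler_pM => //; apply: (le_trans st); case: reg.
Qed.

Variable w : T.

Definition increments_within (M E : R) : Prop := forall g0 g1,
  `|g0| <= M * rho -> `|g1| <= M * rho -> forall j, (j <= m)%N ->
  `|block (fun i => deviation eps G time (line baseline offset g0 g1) i w -
                    deviation eps G time baseline i w) a j| <= E * (S * rate).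

Definition base_within (E : R) : Prop := forall j, (j <= m)%N ->
  `|block (fun i => deviation eps G time baseline i w) a j| <= E * (S * r).

(** The two components of the score have the weights K z and z * K z. *)
Definition weighted_score (kern : R -> R) (s u v : R) : R :=
  \sum_(1 <= i < n.+1) psi alpha (obs eps G n w i - (q s + u) -
     (dq s + v / b n) * (design n i - s)) * kern ((design n i - s) / b n).

Lemma weighted_score_window (kern : R -> R) s u v (l : nat -> R) :
  (forall z, 1 < `|z| -> kern z = 0) -> t - b n <= s <= t + b n ->
  (forall i, (a <= i < a + m)%N -> l i = tangent s u v i) ->
  weighted_score kern s u v =
  \sum_(j < m) (alpha - F (time (a + j)) (tangent s u v (a + j)) -
     deviation eps G time l (a + j)%N w) * kern ((design n (a + j) - s) / b n).
Proof.
move=> kz st hl.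
rewrite /weighted_score (window_sum reg t_lo t_hi st _ kz); apply: eq_bigr => j _.
congr (_ * _).
have aj : (a <= a + j < a + m)%N by rewrite leq_addr ltn_add2l ltn_ord.
rewrite /deviation /psi hl// time_window// /obs /zeta indicE.
rewrite (_ : (_ - _ - _ <= 0) = (past (a + j)%N%:Z w \in below G (design n (a + j))
    (tangent s u v (a + j)))); first by rewrite opprB addrA subrK.
apply/idP/idP => [h|/set_mem]; last by rewrite /below/= /tangent; lra.
by apply/mem_set; rewrite /below/= /tangent; lra.
Qed.

Section Weight.
Variables (kern : R -> R) (Lk Bk : R).
Hypothesis bk : lipschitz_bump kern Lk Bk.

Let kz z : 1 < `|z| -> kern z = 0. Proof. by case: bk => _ _ h _ _; exact: h. Qed.
Let Lk0 : 0 <= Lk. Proof. by case: bk. Qed.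
Let Bk0 : 0 <= Bk. Proof. by case: bk => _ h _ _ _; exact: le_trans (h 0). Qed.

Lemma mcdf_lipschitz s x y : 0 <= s <= 1 -> `|F s y - F s x| <= C0 * `|y - x|.
Proof.
move=> s01; wlog xy : x y / x <= y.
  move=> h; have [xy|/ltW yx] := leP x y; first exact: h.
  by rewrite distrC [`|y - x|]distrC; exact: h.
rewrite !ger0_norm ?subr_ge0//; first exact: F_lip.
exact: (mcdf_nondecreasing eps_iid G_meas f_density s01 xy).
Qed.

(** Taylor's formula; this is the source of the bias term b n ^ 2 in rho. *)
Lemma tangent_quantile s i : (a <= i < a + m)%N -> 0 <= s <= 1 ->
  `|(design n i - s) / b n| <= 1 ->
  `|tangent s 0 0 i - q (time i)| <= Lam * b n ^+ 2.
Proof.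
move=> iw s01 iv; have [i01 _] := design_window reg t_lo t_hi iw.
rewrite time_window// tangentE mul0r !addr0 distrC.
rewrite (_ : _ - _ = q (design n i) - q s - (design n i - s) * dq s); last by ring.
apply: le_trans (q_taylor i01 s01) _; rewrite ler_wpM2l//.
move: iv; rewrite normrM normfV (gtr0_norm b0) ler_pdivrMr// mul1r => h.
rewrite -[leLHS]real_normK ?num_real// ler_sqr ?nnegrE//; exact: ltW.
Qed.

(** At the true quantile line the score is a sum of centred indicators, up to the
    curvature of the quantile. *)
Lemma score_size s E1 E0 : 0 <= s <= 1 -> t - b n <= s <= t + b n -> 0 <= E1 -> 0 <= E0 ->
  increments_within (4 * Lam) E1 -> base_within E0 ->
  `|S^-1 * weighted_score kern s 0 0| <=
  ((6 * Lk + 3 * Bk) * (3 * E1 + E0) + 6 * Bk * C0 * Lam) * rho.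
Proof.
move=> s01 st E10 E00 hE1 hE0.
have p0 := rho_gt0 reg; have x0 := rate_gt0 reg; have r0 := noise_gt0 reg.
have z0 : `|0 : R| <= 0 * rho by rewrite normr0 mul0r.
have [g0 [g1 [hg0 hg1 hl]]] := tangent_line s01 st (lexx 0) z0 z0.
rewrite mulr0 addr0 in hg0 hg1.
rewrite (weighted_score_window kz st hl).
set l := line _ _ _ _ in hl *.
pose D i := deviation eps G time l i w - deviation eps G time baseline i w.
pose D0 i := deviation eps G time baseline i w.
pose N i := alpha - F (time i) (tangent s 0 0 i).
have -> : \sum_(j < m) (alpha - F (time (a + j)) (tangent s 0 0 (a + j)) -
     deviation eps G time l (a + j)%N w) * kern ((design n (a + j) - s) / b n) =
  \sum_(j < m) N (a + j)%N * kern ((design n (a + j) - s) / b n) -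
  \sum_(j < m) D (a + j)%N * kern ((design n (a + j) - s) / b n) -
  \sum_(j < m) D0 (a + j)%N * kern ((design n (a + j) - s) / b n).
  by rewrite -!sumrB; apply: eq_bigr => j _; rewrite /N /D /D0; ring.
have hD := window_abel reg t_lo s bk (x := D)
  (mulr_ge0 E10 (mulr_ge0 (ltW S0) (ltW x0))) (hE1 g0 g1 hg0 hg1).
have hD0 := window_abel reg t_lo s bk (x := D0)
  (mulr_ge0 E00 (mulr_ge0 (ltW S0) (ltW r0))) hE0.
have hN : `|\sum_(j < m) N (a + j)%N * kern ((design n (a + j) - s) / b n)| <=
    6 * Bk * (C0 * (Lam * rho)) * S.
  apply: (window_sum_le reg t_lo bk) => [|i iw iv].
    by rewrite !mulr_ge0// ltW.
  rewrite /N -(mcdf_quantile eps_iid G_meas f_density B3 alpha01 (time01 i)) distrC.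
  apply: (le_trans (mcdf_lipschitz _ _ (time01 i))); rewrite ler_wpM2l//.
  apply: (le_trans (tangent_quantile iw s01 iv)); rewrite ler_wpM2l//.
  exact: sqr_bandwidth_le_rho.
rewrite normrM normfV (gtr0_norm S0) mulrC ler_pdivrMr//.
apply: (le_trans (ler_normB _ _)); apply: (le_trans (lerD (ler_normB _ _) (lexx _))).
apply: (le_trans (lerD (lerD hN hD) hD0)).
have Lk3 : 0 <= 6 * Lk + 3 * Bk by rewrite addr_ge0 ?mulr_ge0.
have h1 : (6 * Lk + 3 * Bk) * (E1 * (S * rate)) <= (6 * Lk + 3 * Bk) * (E1 * (S * (3 * rho))).
  by rewrite !ler_wpM2l ?(ltW S0)// rate_le.
have h2 : (6 * Lk + 3 * Bk) * (E0 * (S * r)) <= (6 * Lk + 3 * Bk) * (E0 * (S * rho)).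
  by rewrite !ler_wpM2l ?(ltW S0)// noise_le_rho.
lra.
Qed.

(** To first order the score is affine in the perturbation (u, v), with a slope
    given by the density at the quantile and the moments of the weight. *)
Lemma score_increment M E1 fhi s u v : 0 <= s <= 1 -> t - b n <= s <= t + b n ->
  0 <= M -> 0 <= E1 -> increments_within (4 * Lam + 5 * M) E1 ->
  f s (q s) <= fhi -> `|u| <= M * rho -> `|v| <= M * rho ->
  `|S^-1 * weighted_score kern s u v - S^-1 * weighted_score kern s 0 0 +
    f s (q s) * (u * (\int[mu]_(z in `[-1, 1]) kern z) +
                 v * (\int[mu]_(z in `[-1, 1]) (z * kern z)))| <=
  (2 * E1 * (6 * Lk + 3 * Bk) + 12 * Bk * Lf * M * (1 + Lam + 2 * M) +
   fhi * M * (12 * Lk + 10 * Bk)) * rate.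
Proof.
move=> s01 st M0 E10 hE hf hu hv.
have p0 := rho_gt0 reg; have x0 := rate_gt0 reg.
have fs0 : 0 <= f s (q s) by have [_ h _] := f_density s01.
have z0 : `|0 : R| <= M * rho by rewrite normr0 mulr_ge0// ltW.
have [g0 [g1 [hg0 hg1 hl]]] := tangent_line s01 st M0 z0 z0.
have [g0' [g1' [hg0' hg1' hl']]] := tangent_line s01 st M0 hu hv.
rewrite (weighted_score_window kz st hl) (weighted_score_window kz st hl').
set l := line _ _ g0 g1 in hl *; set l' := line _ _ g0' g1' in hl' *.
pose vi i := (design n i - s) / b n.
pose D i := deviation eps G time l i w - deviation eps G time baseline i w.
pose D' i := deviation eps G time l' i w - deviation eps G time baseline i w.
pose fs := f s (q s).
pose N i := F (time i) (tangent s u v i) - F (time i) (tangent s 0 0 i) -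
  fs * (u + v * vi i).
have hS : S^-1 * \sum_(j < m) (alpha - F (time (a + j)) (tangent s u v (a + j)) -
     deviation eps G time l' (a + j)%N w) * kern (vi (a + j)%N) -
  S^-1 * \sum_(j < m) (alpha - F (time (a + j)) (tangent s 0 0 (a + j)) -
     deviation eps G time l (a + j)%N w) * kern (vi (a + j)%N) =
  S^-1 * (\sum_(j < m) D (a + j)%N * kern (vi (a + j)%N) -
  \sum_(j < m) D' (a + j)%N * kern (vi (a + j)%N) -
  \sum_(j < m) N (a + j)%N * kern (vi (a + j)%N)) -
  fs * (u * (S^-1 * \sum_(j < m) kern (vi (a + j)%N)) +
        v * (S^-1 * \sum_(j < m) vi (a + j)%N * kern (vi (a + j)%N))).
  rewrite -!mulrBr -!sumrB !mulr_sumr -big_split/= mulr_sumr -sumrB.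
  by apply: eq_bigr => j _; rewrite /N /D /D'; ring.
have hD := window_abel reg t_lo s bk (x := D)
  (mulr_ge0 E10 (mulr_ge0 (ltW S0) (ltW x0))) (hE g0 g1 hg0 hg1).
have hD' := window_abel reg t_lo s bk (x := D')
  (mulr_ge0 E10 (mulr_ge0 (ltW S0) (ltW x0))) (hE g0' g1' hg0' hg1').
have hN : `|\sum_(j < m) N (a + j)%N * kern (vi (a + j)%N)| <=
    6 * Bk * (Lf * (2 * M) * (1 + Lam + 2 * M) * rate) * S.
  apply: (window_sum_le reg t_lo bk) => [|i iw iv].
    have h1 : 0 <= 1 + Lam + 2 * M by rewrite addr_ge0 ?addr_ge0 ?mulr_ge0.
    by rewrite mulr_ge0 ?(ltW x0)// mulr_ge0// mulr_ge0 ?(ltW Lf0)// mulr_ge0.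
  have [i01 _] := design_window reg t_lo t_hi iw.
  have := mcdf_linear eps_iid G_meas f_density (s := s) (t := time i)
    (tangent s 0 0 i) (tangent s u v i) (q s) Lf0 f_lip s01 (time01 i).
  have yx : tangent s u v i - tangent s 0 0 i = u + v * vi i.
    by rewrite !tangentE /vi; ring.
  rewrite yx => h; apply: le_trans h _.
  have di : `|design n i - s| <= b n.
    by move: iv; rewrite normrM normfV (gtr0_norm b0) ler_pdivrMr// mul1r.
  have h1 : `|time i - s| <= b n by rewrite time_window.
  have h2 : `|tangent s 0 0 i - q s| <= b n * Lam.
    rewrite tangentE mul0r !addr0 addrC addKr normrM; apply: ler_pM => //; exact: dq_bnd.
  have h3 : `|u + v * vi i| <= 2 * M * rho.
    apply: (le_trans (ler_normD _ _)).
    have -> : 2 * M * rho = M * rho + M * rho by ring.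
    by apply: lerD => //; rewrite normrM -[leRHS]mulr1; apply: ler_pM.
  have M2 : 0 <= 2 * M * rho by exact: le_trans h3.
  apply: (@le_trans _ _ (Lf * (b n + b n * Lam + 2 * M * rho) * (2 * M * rho))).
    apply: ler_pM => //; first by rewrite mulr_ge0 ?addr_ge0// ltW.
    by rewrite ler_pM2l// !lerD.
  have -> : Lf * (b n + b n * Lam + 2 * M * rho) * (2 * M * rho) =
    Lf * (2 * M) * ((1 + Lam) * (b n * rho) + 2 * M * rho ^+ 2) by ring.
  rewrite -[leRHS]mulrA ler_wpM2l ?mulr_ge0 ?(ltW Lf0)//.
  have h4 : (1 + Lam) * (b n * rho) <= (1 + Lam) * rate.
    by rewrite ler_wpM2l ?addr_ge0// bandwidth_rho_le_rate.
  have h5 : 2 * M * rho ^+ 2 <= 2 * M * rate.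
    by rewrite ler_wpM2l ?mulr_ge0// sqr_rho_le_rate.
  lra.
have hR0 := window_riemann reg t_lo st bk.
have hR1 := window_riemann reg t_lo st (lipschitz_bumpX bk).
rewrite hS.
set R0 := S^-1 * _ in hR0; set R1 := S^-1 * _ in hR1.
set I0 := Rintegral _ _ _ in hR0 *; set I1 := Rintegral _ _ _ in hR1 *.
rewrite -/R0 -/R1.
move: hD hD' hN; rewrite -/(vi _).
set SD := (X in `|X| <= _ -> _); set SD' := (X in _ -> `|X| <= _ -> _).
set SN := (X in _ -> _ -> `|X| <= _ -> _) => hD hD' hN.
rewrite -/SD -/SD' -/SN -/fs.
have -> : S^-1 * (SD - SD' - SN) - fs * (u * R0 + v * R1) + fs * (u * I0 + v * I1) =
  S^-1 * (SD - SD' - SN) - (fs * (u * (R0 - I0)) + fs * (v * (R1 - I1))) by ring.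
have hin := inv_effective_size_le_rho reg.
have part (x c I : R) : 0 <= c -> `|x| <= M * rho -> `|I| <= S^-1 * c ->
    `|fs * (x * I)| <= fhi * M * c * rate.
  move=> c0 hx hI; rewrite normrM (ger0_norm fs0).
  have h1 : `|x * I| <= (M * rho) * (rho * c).
    rewrite normrM; apply: ler_pM => //; apply: (le_trans hI); exact: ler_wpM2r.
  have -> : fhi * M * c * rate = fhi * (M * c * rate) by ring.
  apply: ler_pM => //; apply: (le_trans h1).
  have -> : M * rho * (rho * c) = M * c * rho ^+ 2 by ring.
  by rewrite ler_wpM2l ?mulr_ge0// sqr_rho_le_rate.
have hp0 : `|fs * (u * (R0 - I0))| <= fhi * M * (6 * Lk + 2 * Bk) * rate.
  by apply: part => //; rewrite addr_ge0 ?mulr_ge0.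
have hp1 : `|fs * (v * (R1 - I1))| <= fhi * M * (6 * (Lk + Bk) + 2 * Bk) * rate.
  by apply: part => //; rewrite addr_ge0 ?mulr_ge0 ?addr_ge0.
have hq : `|S^-1 * (SD - SD' - SN)| <= (2 * E1 * (6 * Lk + 3 * Bk) +
    12 * Bk * Lf * M * (1 + Lam + 2 * M)) * rate.
  rewrite normrM normfV (gtr0_norm S0) mulrC ler_pdivrMr//.
  apply: (le_trans (ler_normB _ _)); apply: (le_trans (lerD (ler_normB _ _) (lexx _))).
  apply: (le_trans (lerD (lerD hD hD') hN)).
  by rewrite le_eqVlt; apply/orP; left; apply/eqP; ring.
apply: (le_trans (ler_normB _ _)); apply: (le_trans (lerD hq (ler_normD _ _))).
apply: (le_trans (lerD (lexx _) (lerD hp0 hp1))).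
by rewrite le_eqVlt; apply/orP; left; apply/eqP; ring.
Qed.

End Weight.

Hypothesis K_kernel : is_kernel K.
Variables LK BK : R.
Hypothesis K_bump : lipschitz_bump K LK BK.
Local Notation Lk := (LK + BK).

Let BK0 : 0 <= BK. Proof. by case: K_bump => _ h _ _ _; exact: le_trans (h 0). Qed.
Let LK0 : 0 <= LK. Proof. by case: K_bump. Qed.

Let K_bump' : lipschitz_bump K Lk BK.
Proof. by apply: lipschitz_bump_weaken K_bump; rewrite lerDl. Qed.

Variables Qhat dQhat : nat -> R -> T -> R.
Local Notation theta := (theta_hat eps G b alpha Qhat dQhat n).
Local Notation remainder := (bahadur_remainder eps G f K b alpha Qhat dQhat n).

Lemma remainder_coord0 s : remainder s w 0 0 =
  f s (q s) * (Qhat n s w - q s) - S^-1 * weighted_score K s 0 0.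
Proof.
rewrite /bahadur_remainder /muK mul_diag_mx !mxE/= mul1r.
congr (_ - _ * _); rewrite /score summxE; apply: eq_bigr => i _.
by rewrite !mxE/= mulr1 addr0 mul0r addr0 [dq s * _]mulrC.
Qed.

Lemma remainder_coord1 s : remainder s w 1 0 =
  f s (q s) * mu2 K * (b n * (dQhat n s w - dq s)) -
  S^-1 * weighted_score (fun z => z * K z) s 0 0.
Proof.
rewrite /bahadur_remainder /muK mul_diag_mx !mxE/= mulrA.
congr (_ - _ * _); rewrite /score summxE; apply: eq_bigr => i _.
by rewrite !mxE/= addr0 mul0r addr0 [dq s * _]mulrC -mulrA [K _ * _]mulrC.
Qed.

Lemma enorm_le (x : 'cV[R]_2) : enorm x <= `|x 0 0| + `|x 1 0|.
Proof.
rewrite /enorm big_ord_recl big_ord1.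
have -> : lift ord0 ord0 = 1 :> 'I_2 by exact/val_inj.
rewrite -[leRHS]ger0_norm ?addr_ge0// -sqrtr_sqr ler_wsqrtr// sqrrD.
by rewrite -!normrX ![`|_ ^+ 2|]ger0_norm ?sqr_ge0// lerD2r lerDl mulrn_wge0// mulr_ge0.
Qed.

(** The linearization of the two components of the score, applied to the criterion:
    A is large enough for minimizer_near_zero to apply at distance A * rate, and M
    for the points at this distance from the zero of the affine map to be among
    those where the score has been linearized. *)
Lemma remainder_bound s M E1 E2 E0 flo fhi C1 C2 A :
  0 <= s <= 1 -> t - b n <= s <= t + b n ->
  is_argmin K b alpha n (obs eps G n w) s (Qhat n s w) (dQhat n s w) ->
  0 <= E1 -> 0 <= E2 -> 0 <= E0 ->
  increments_within (4 * Lam) E2 -> base_within E0 ->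
  increments_within (4 * Lam + 5 * M) E1 ->
  0 < flo -> flo <= f s (q s) <= fhi ->
  (6 * Lk + 3 * BK) * (3 * E2 + E0) + 6 * BK * C0 * Lam <= C1 ->
  2 * E1 * (6 * Lk + 3 * BK) + 12 * BK * Lf * M * (1 + Lam + 2 * M) +
    fhi * M * (12 * Lk + 10 * BK) <= C2 ->
  C1 / flo + 1 <= M -> C1 / (flo * mu2 K) + 1 <= M ->
  0 < A -> 2 * C2 < flo * A -> 2 * C2 < flo * mu2 K * A -> A * rate <= rho ->
  enorm (remainder s w) <= fhi * (1 + mu2 K) * A * rate.
Proof.
move=> s01 st amin E10 E20 E00 hE2 hE0 hE1 flo0 /andP[flof ffhi] hC1 hC2 hM0 hM1 A0 hA0 hA1 Ar.
have p0 := rho_gt0 reg; have x0 := rate_gt0 reg.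
have m2 := mu2_gt0 K_kernel.
have K0 u : 0 <= K u by have [h _ _ _ _] := K_kernel; exact: h.
set fs := f s (q s) in flof ffhi *.
have fs0 : 0 < fs by exact: lt_le_trans flof.
have uK := lipschitz_bumpX K_bump.
have C10 : 0 <= C1.
  have Lk0 : 0 <= Lk by exact: addr_ge0.
  apply: le_trans hC1; apply: addr_ge0; first by rewrite mulr_ge0 ?addr_ge0 ?mulr_ge0.
  by rewrite mulr_ge0// mulr_ge0// mulr_ge0.
have M0 : 0 <= M by apply: le_trans hM0; rewrite addr_ge0// divr_ge0// ltW.
pose g0 := S^-1 * weighted_score K s 0 0.
pose g1 := S^-1 * weighted_score (fun z => z * K z) s 0 0.
have hg0 : `|g0| <= C1 * rho.
  apply: le_trans (score_size K_bump' s01 st E20 E00 hE2 hE0) _.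
  by rewrite ler_wpM2r// ltW.
have hg1 : `|g1| <= C1 * rho.
  apply: le_trans (score_size uK s01 st E20 E00 hE2 hE0) _.
  by rewrite ler_wpM2r// ltW.
have ball (g c z : R) : 0 < c -> C1 / c + 1 <= M -> `|g| <= C1 * rho ->
    forall c', c <= c' -> `|z - g / c'| <= A * rate -> `|z| <= M * rho.
  move=> c0 cM hg c' cc' hz; have c'0 : 0 < c' by exact: lt_le_trans cc'.
  rewrite -[z](subrK (g / c')) addrC; apply: (le_trans (ler_normD _ _)).
  apply: (@le_trans _ _ (C1 / c * rho + rho)); last first.
    by rewrite -[X in _ + X]mul1r -mulrDl ler_pM2r.
  apply: lerD; last exact: le_trans Ar.
  rewrite normrM normfV (gtr0_norm c'0) mulrAC.
  apply: ler_pM => //; first by rewrite invr_ge0 ltW.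
  by rewrite lef_pV2.
have e0 : 2 * (C2 * rate) < fs * (A * rate).
  rewrite !mulrA ltr_pM2r//; apply: (lt_le_trans hA0); by rewrite ler_pM2r.
have e1 : 2 * (C2 * rate) < fs * mu2 K * (A * rate).
  rewrite !mulrA ltr_pM2r//; apply: (lt_le_trans hA1); by rewrite !ler_pM2r.
have [] := @minimizer_near_zero R
  (fun u v => S^-1 * weighted_score K s u v)
  (fun u v => S^-1 * weighted_score (fun z => z * K z) s u v) g0 g1 fs (fs * mu2 K)
  (C2 * rate) (A * rate) (Qhat n s w - q s) (b n * (dQhat n s w - dq s))
  fs0 (mulr_gt0 fs0 m2) (mulr_gt0 A0 x0) e0 e1.
- move=> u v.
  have a01 : 0 <= alpha <= 1 by have /andP[h1 h2] := alpha01; rewrite !ltW.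
  have := objective_subgradient (q s + u) (dq s + v / b n) a01 K0 amin.
  set W0 := \sum_(_ <= _ < _) _ * K _; set W1 := \sum_(_ <= _ < _) _.
  have -> : W1 = b n * weighted_score (fun z => z * K z) s u v.
    rewrite /W1 /weighted_score mulr_sumr; apply: eq_bigr => i _.
    by field; rewrite gt_eqF.
  have -> : W0 = weighted_score K s u v by [].
  rewrite -(pmulr_rge0 _ (_ : 0 < S^-1)) ?invr_gt0// => h; apply: le_trans h _.
  rewrite le_eqVlt; apply/orP; left; apply/eqP.
  by field; rewrite !gt_eqF.
- move=> u v hu hv.
  have {}hu := ball _ _ _ flo0 hM0 hg0 _ flof hu.
  have {}hv : `|v| <= M * rho.
    by apply: (ball g1 (flo * mu2 K) v (mulr_gt0 flo0 m2) hM1 hg1 _ _ hv); rewrite ler_pM2r.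
  have h0 := score_increment K_bump' s01 st M0 E10 hE1 ffhi hu hv.
  have h1 := score_increment uK s01 st M0 E10 hE1 ffhi hu hv.
  rewrite (kernel_mass K_kernel) (kernel_first_moment K_kernel) mulr1 mulr0 addr0 in h0.
  rewrite (kernel_first_moment K_kernel) mulr0 add0r in h1.
  have mK : \int[mu]_(z in `[-1, 1]) (z * (z * K z)) = mu2 K.
    by apply: eq_Rintegral => z _; rewrite expr2 mulrA.
  rewrite mK in h1.
  have {}hC2 := ler_wpM2r (ltW x0) hC2.
  split; [apply: le_trans hC2|apply: le_trans hC2].
    by apply: le_trans h0; rewrite -/fs -/g0 opprB addrA addrAC.
  by apply: le_trans h1; rewrite -/fs -/g1 opprB addrA addrAC [v * _]mulrC mulrA.
move=> h0 h1.
apply: (le_trans (enorm_le _)); rewrite remainder_coord0 remainder_coord1 -/g0 -/g1 -/fs.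
have -> : fhi * (1 + mu2 K) * A * rate = fhi * (A * rate) + fhi * mu2 K * (A * rate) by ring.
have part (c z g : R) : 0 < c -> `|z - g / c| <= A * rate -> `|c * z - g| <= c * (A * rate).
  move=> c0 h; have -> : c * z - g = c * (z - g / c) by field; rewrite gt_eqF.
  by rewrite normrM gtr0_norm// ler_pM2l.
have Ax : 0 <= A * rate by rewrite mulr_ge0// ltW.
apply: lerD.
  by apply: (le_trans (part _ _ _ fs0 h0)); rewrite ler_wpM2r.
apply: (le_trans (part _ _ _ (mulr_gt0 fs0 m2) h1)).
by rewrite ler_wpM2r// ler_wpM2r// ltW.
Qed.

End Expansion.

(** * The regime of large samples *)

Section LargeSamples.
Context (R : realType).

Lemma near_ge_log (c : R) : \forall n \near \oo, c <= ln n%:R.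
Proof.
near=> n.
have h : expR c <= n%:R by near: n; exact: nbhs_infty_ger.
by rewrite -[leLHS]expRK ler_ln ?posrE ?expR_gt0// (lt_le_trans (expR_gt0 c)).
Unshelve. all: by end_near. Qed.

Lemma near_div_le (c e : R) : 0 < e -> \forall n \near \oo, c / n%:R <= e.
Proof.
move=> e0; near=> n.
have n1 : (1 : R) <= n%:R by near: n; exact: nbhs_infty_ger.
have h : c / e <= n%:R by near: n; exact: nbhs_infty_ger.
rewrite ler_pdivrMr ?(lt_le_trans ltr01)// mulrC -ler_pdivrMr//.
Unshelve. all: by end_near. Qed.

Lemma large_enough (c e : R) : 0 <= c -> 0 < e -> exists2 A, 6 <= A & c / A ^+ 2 <= e.
Proof.
move=> c0 e0; have ce : 0 <= c / e by rewrite divr_ge0// ltW.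
exists (6 + c / e); first by rewrite lerDl.
have A0 : 0 < 6 + c / e by rewrite ltr_pwDl.
rewrite ler_pdivrMr ?exprn_gt0// mulrC -ler_pdivrMr// expr2.
apply: (@le_trans _ _ (6 + c / e)); first by rewrite lerDr.
rewrite ler_peMr ?(ltW A0)//; lra.
Qed.

Variable b : nat -> R.
Hypothesis b_gt0 : forall n, (0 < n)%N -> 0 < b n.
Hypothesis nb_oo : n%:R * b n / ln n%:R ^+ 2 @[n --> \oo] --> +oo.
Hypothesis b_0 : b n @[n --> \oo] --> 0.

Lemma near_bandwidth_le (c : R) : 0 < c -> \forall n \near \oo, b n <= c.
Proof.
move=> c0; have /cvgrPdist_le/(_ c c0) := b_0.
apply: filterS => n; rewrite sub0r normrN; exact/le_trans/ler_norm.
Qed.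

Lemma near_noise_le (c : R) : 0 < c ->
  \forall n \near \oo, ln n%:R / Num.sqrt (n%:R * b n) <= c.
Proof.
move=> c0; near=> n.
have n1 : (1 : R) <= n%:R by near: n; exact: nbhs_infty_ger.
have L1 : 1 <= ln n%:R :> R by near: n; exact: near_ge_log.
have h : (c ^+ 2)^-1 <= n%:R * b n / ln n%:R ^+ 2 by near: n; exact: (cvgryPge _).1.
have n0 : (0 < n)%N by rewrite -(ltr0n R) (lt_le_trans ltr01).
have S0 : 0 < n%:R * b n by rewrite mulr_gt0 ?b_gt0// ltr0n.
have L0 : 0 < ln n%:R :> R by exact: lt_le_trans L1.
rewrite ler_pdivrMr ?sqrtr_gt0// -ler_sqr ?nnegrE ?mulr_ge0 ?sqrtr_ge0 ?(ltW L0) ?(ltW c0)//.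
rewrite exprMn sqr_sqrtr ?(ltW S0)// mulrC -ler_pdivrMr ?exprn_gt0//.
by rewrite mulrC -ler_pdivlMr ?exprn_gt0.
Unshelve. all: by end_near. Qed.

Lemma near_regime : \forall n \near \oo, regime b n.
Proof.
near=> n.
have n1 : (1 : R) <= n%:R by near: n; exact: nbhs_infty_ger.
have n0 : (0 < n)%N by rewrite -(ltr0n R) (lt_le_trans ltr01).
have bn0 := b_gt0 n0.
have b2 : b n <= 2^-1 by near: n; apply: near_bandwidth_le; rewrite invr_gt0.
have L1 : 1 <= ln n%:R :> R by near: n; exact: near_ge_log.
have r2 : ln n%:R / Num.sqrt (n%:R * b n) <= 2^-1.
  by near: n; apply: near_noise_le; rewrite invr_gt0.
have S1 : 1 <= n%:R * b n / ln n%:R ^+ 2 by near: n; exact: (cvgryPge _).1.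
split => //; first by apply: (le_trans b2); lra.
  by rewrite -[leLHS]mul1r -ler_pdivlMr// exprn_gt0// (lt_le_trans ltr01).
have : b n ^+ 2 <= 2^-1 by rewrite expr2 (le_trans _ b2)// ler_piMl ?(ltW bn0)//; lra.
rewrite /rho; lra.
Unshelve. all: by end_near. Qed.

(** The rate is negligible with respect to rho, since rate / rho is at most the sum of
    sqrt(r), b n and rho. *)
Lemma near_rate_le (A : R) : 0 < A -> \forall n \near \oo, A * rate b n <= rho b n.
Proof.
move=> A0; pose c := Num.min 2^-1 (4 * A)^-1.
have c0 : 0 < c by rewrite lt_min !invr_gt0 ltr0n mulr_gt0.
have c2 : c <= 2^-1 by rewrite ge_min lexx.
have cA : A * (4 * c) <= 1.
  have : c <= (4 * A)^-1 by rewrite ge_min lexx orbT.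
  by rewrite -div1r ler_pdivlMr ?mulr_gt0//; lra.
near=> n.
have reg : regime b n by near: n; exact: near_regime.
have bc : b n <= c by near: n; exact: near_bandwidth_le.
have rc : ln n%:R / Num.sqrt (n%:R * b n) <= c ^+ 2.
  by near: n; apply: near_noise_le; rewrite exprn_gt0.
have [bn0 _ _ _ _] := reg.
have p0 := rho_gt0 reg; have r0 := noise_gt0 reg; have rp := noise_le_rho b n.
set r := ln n%:R / _ in rc r0 rp.
have cc : c ^+ 2 <= c by rewrite expr2 ler_piMl ?(ltW c0)// (le_trans c2)//; lra.
have b2 : b n ^+ 2 <= c.
  by apply: le_trans cc; rewrite ler_sqr ?nnegrE ?(ltW bn0) ?(ltW c0).
have p2 : rho b n <= 2 * c.
  by rewrite /rho -/r; have := le_trans rc cc; lra.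
have h1 : Num.sqrt (rho b n) * r <= rho b n * c.
  have e1 : r = Num.sqrt r * Num.sqrt r by rewrite -expr2 sqr_sqrtr// ltW.
  have e2 : rho b n = Num.sqrt (rho b n) * Num.sqrt (rho b n).
    by rewrite -expr2 sqr_sqrtr// ltW.
  rewrite {1}e1 mulrA [X in _ <= X * c]e2; apply: ler_pM; rewrite ?mulr_ge0 ?sqrtr_ge0//.
    by rewrite ler_wpM2l ?sqrtr_ge0// ler_wsqrtr.
  by rewrite -[leRHS]ger0_norm ?(ltW c0)// -sqrtr_sqr ler_wsqrtr.
have h2 : b n * rho b n <= rho b n * c by rewrite mulrC ler_pM2l.
have h3 : rho b n ^+ 2 <= rho b n * (2 * c) by rewrite expr2 ler_pM2l.
have h4 : rate b n <= rho b n * (4 * c).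
  rewrite /rate -[_ * ln _ / _]mulrA -/r; lra.
apply: (@le_trans _ _ (A * (rho b n * (4 * c)))); first by rewrite ler_pM2l.
by rewrite mulrCA ler_piMr// ltW.
Unshelve. all: by end_near. Qed.

Lemma near_window t : 0 < t < 1 -> \forall n \near \oo,
  n%:R^-1 <= t - 2 * b n /\ t + 2 * b n <= 1.
Proof.
move=> /andP[t0 t1]; near=> n.
have h1 : b n <= t / 4 by near: n; apply: near_bandwidth_le; rewrite divr_gt0.
have h2 : b n <= (1 - t) / 2.
  by near: n; apply: near_bandwidth_le; rewrite divr_gt0// subr_gt0.
have h3 : 1 / n%:R <= t / 2 by near: n; apply: near_div_le; rewrite divr_gt0.
rewrite div1r in h3; split; lra.
Unshelve. all: by end_near. Qed.

End LargeSamples.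

(** * The representation *)

Section Bahadur.
Context (R : realType) d (T : measurableType d) (P : probability T R).
Variables (eps : int -> {RV P >-> R}) (eps' : {RV P >-> R}).
Hypothesis eps_iid : iid (innovations eps eps').
Variables (G : R -> history R -> R) (Fc : R -> R -> history R -> R).
Variables (b : nat -> R) (alpha t : R).
Hypothesis G_meas : measurable_model G.
Hypothesis Fc_cond : is_cond_cdf eps G Fc.
Hypothesis b_gt0 : forall n, (0 < n)%N -> 0 < b n.
Hypothesis t01 : 0 < t < 1.
Hypothesis nb_oo : n%:R * b n / ln n%:R ^+ 2 @[n --> \oo] --> +oo.
Hypothesis b_0 : b n @[n --> \oo] --> 0.
Hypothesis B1 : condB1 eps eps' Fc.
Variable C0 : R.
Hypothesis C00 : 0 <= C0.
Hypothesis steep : forall i : int,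
  {ae P, forall w : T, (ereal_sup [set (dFc Fc 1 z.1 z.2 (past eps i w))%:E
                  | z in unit_strip] < C0%:E)%E}.

(** The constant A of the tail bound is chosen after e, so that only the terms that
    vanish as n grows remain. *)
Lemma base_within_prob (e : R) : 0 < e -> exists2 E : R, 0 <= E &
  \forall n \near \oo, exists B : set T, [/\ measurable B, (P B <= e%:E)%E &
    forall w, ~ B w -> base_within eps G b alpha t n w E].
Proof.
move=> e0.
have [D0 hD0] : exists D : R, forall M, \sum_(j < M) rdelta eps eps' (dFc Fc 0) j <= D.
  by apply: rdelta_summable; case: (B1 (isT : (0 <= 3)%N)).
have e2 : 0 < e / 2 by rewrite divr_gt0.
have [|A A6 hA] := @large_enough R (12 * ((ln 12 + 1) / ln 2 + 1) ^+ 2 * D0 ^+ 2) _ _ e2.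
  by rewrite mulr_ge0 ?sqr_ge0// mulr_ge0// sqr_ge0.
exists (2 * A); first by rewrite mulr_ge0// (le_trans _ A6).
near=> n.
have reg : regime b n by near: n; exact: near_regime.
have [t_lo t_hi] : n%:R^-1 <= t - 2 * b n /\ t + 2 * b n <= 1.
  by near: n; exact: near_window.
have hn : 14 * expR 3 / n%:R <= e / 2 by near: n; exact: near_div_le.
have [B [mB PB hB]] := base_deviation_tail eps_iid reg G_meas Fc_cond B1
  (baseline eps G alpha t n) (window_start b n t) (time01 R n) (window_size_le reg t_lo)
  hD0 A6.
exists B; split => //; apply: (le_trans PB); rewrite lee_fin [leRHS]splitr; apply: lerD => //.
have n1 : (1 : R) <= n%:R by rewrite ler1n (regime_n_gt0 reg).
apply: le_trans hn; rewrite ler_wpM2l ?mulr_ge0 ?expR_ge0//.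
rewrite lef_pV2 ?posrE ?exprn_gt0 ?(lt_le_trans ltr01 n1)// expr2.
by rewrite ler_peMl// (le_trans ler01 n1).
Unshelve. all: by end_near. Qed.

Lemma increments_within_prob (M e : R) : 0 < e -> exists2 E : R, 0 <= E &
  \forall n \near \oo, exists B : set T, [/\ measurable B, (P B <= e%:E)%E &
    forall w, ~ B w -> increments_within eps G b alpha t n w M E].
Proof.
move=> e0.
have [D1 hD1] : exists D : R, forall M, \sum_(j < M) rdelta eps eps' (dFc Fc 1) j <= D.
  by apply: rdelta_summable; case: (B1 (isT : (1 <= 3)%N)).
have e2 : 0 < e / 2 by rewrite divr_gt0.
pose M3 := Num.max 3 M.
have hM3 : 3 <= M3 by rewrite le_max lexx.
have [|A A6 hA] := @large_enough R ((4 * M3) ^+ 2 * (12 * ((ln 12 + 1) / ln 2 + 1) ^+ 2 *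
    ((14 * M3) ^+ 2 * D1 ^+ 2))) _ _ e2.
  by repeat first [exact: sqr_ge0 | exact: ler0n | apply: mulr_ge0].
exists (2 * A + 42 * C0); first by rewrite addr_ge0 ?mulr_ge0// (le_trans _ A6).
near=> n.
have reg : regime b n by near: n; exact: near_regime.
have [t_lo t_hi] : n%:R^-1 <= t - 2 * b n /\ t + 2 * b n <= 1.
  by near: n; exact: near_window.
have hn : (4 * M3) ^+ 2 * (14 * expR (42 * C0 * M3)) / n%:R <= e / 2.
  by near: n; exact: near_div_le.
have [B [mB PB hB]] := uniform_line_deviation_tail eps_iid reg G_meas Fc_cond B1 C00 steep
  (baseline eps G alpha t n) (window_start b n t) (time01 R n) (offset06 b t n)
  (window_size_le reg t_lo) hD1 hM3 A6.
exists B; split => //.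
  by apply: (le_trans PB); rewrite lee_fin [leRHS]splitr; exact: lerD.
have MM : M * rho b n <= M3 * rho b n.
  by rewrite ler_wpM2r ?(ltW (rho_gt0 reg))// le_max lexx orbT.
by move=> w Bw g0 g1 hg0 hg1 j jm; apply: hB => //; exact: le_trans MM.
Unshelve. all: by end_near. Qed.

End Bahadur.

Lemma half_close (R : realFieldType) (x y : R) : `|x - y| <= y / 2 -> y / 2 <= x <= 2 * y.
Proof. by rewrite ler_norml => /andP[h1 h2]; apply/andP; split; lra. Qed.

Unset Implicit Arguments.

Theorem theorem2 (R : realType) (d : measure_display) (T : measurableType d)
    (P : probability T R)
    (eps : int -> {RV P >-> R}) (eps' : {RV P >-> R})
    (G : R -> history R -> R)
    (f : R -> R -> R) (Fc : R -> R -> history R -> R)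
    (K : R -> R) (b : nat -> R)
    (alpha t : R) (Qhat dQhat : nat -> R -> T -> R)
    (eps_iid : iid (innovations eps eps'))
    (G_meas : measurable_model G)
    (f_density : is_density eps G f)
    (Fc_cond : is_cond_cdf eps G Fc)
    (K_kernel : is_kernel K)
    (b_gt0 : forall n, (0 < n)%N -> 0 < b n)
    (hat_argmin : forall n (s : R) (w : T), (0 < n)%N -> 0 <= s <= 1 ->
       is_argmin K b alpha n (obs eps G n w) s (Qhat n s w) (dQhat n s w))
    (alpha01 : 0 < alpha < 1) (t01 : 0 < t < 1)
    (f_gt0 : 0 < f t (quantile eps G alpha t))
    (nb_oo : n%:R * b n / ln n%:R ^+ 2 @[n --> \oo] --> +oo)
    (b_0 : b n @[n --> \oo] --> 0)
    (A1 : condA1 eps G)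
    (B1 : condB1 eps eps' Fc)
    (B2 : condB2 eps Fc)
    (B3 : condB3 f) :
  bigO_P P
    (fun n w => ereal_sup
       [set (enorm (bahadur_remainder eps G f K b alpha Qhat dQhat n s w))%:E
       | s in window b n t])
    (rate b).
Proof.
have t01' : 0 <= t <= 1 by have /andP[h1 h2] := t01; rewrite !ltW.
have [C0' steep'] := B2.
pose C0 := Num.max 0 C0'.
have C00 : 0 <= C0 by rewrite le_max lexx.
have steep i : {ae P, forall w, (ereal_sup
    [set (dFc Fc 1 z.1 z.2 (past eps i w))%:E | z in unit_strip] < C0%:E)%E}.
  apply: filterS (steep' i) => w h; apply: lt_le_trans h _.
  by rewrite lee_fin le_max lexx orbT.
have F_lip s x y := @mcdf_increment_le _ _ _ _ _ _ eps_iid _ _ G_meas Fc_cond B1 _ C00 steep s x y.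
have [Lf Lf0 f_lip] := density_lipschitz B3.
have qC2 := A1 alpha alpha01.
have [Lam1 Lam10 hLam1] := C2_taylor ltr01 qC2.
have [Lam2 Lam20 hLam2] := C1_lipschitz qC2.2.
have qC1 : C1_on `[0, 1] (quantile eps G alpha).
  by split; [exact: qC2.1 | exact: (C1_continuous qC2.2)].
have [Lam3 Lam30 hLam3] := C1_derive_bounded qC1.
pose Lam := Lam1 + Lam2 + Lam3.
have Lam0 : 0 <= Lam by rewrite !addr_ge0.
have q_taylor x s : 0 <= x <= 1 -> 0 <= s <= 1 ->
    `|quantile eps G alpha x - quantile eps G alpha s - (x - s) * dquantile eps G alpha s| <=
    Lam * (x - s) ^+ 2.
  move=> x01 s01; apply: le_trans (hLam1 x s x01 s01) _; rewrite ler_wpM2r ?sqr_ge0//.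
  rewrite /Lam; lra.
have dq_lip x s : 0 <= x <= 1 -> 0 <= s <= 1 ->
    `|dquantile eps G alpha x - dquantile eps G alpha s| <= Lam * `|x - s|.
  move=> x01 s01; apply: le_trans (hLam2 s x s01 x01) _; rewrite ler_wpM2r//.
  rewrite /Lam; lra.
have dq_bnd x : 0 <= x <= 1 -> `|dquantile eps G alpha x| <= Lam.
  move=> x01; apply: le_trans (hLam3 x x01) _; rewrite /Lam; lra.
have [LK [BK [BK0 K_bump]]] := kernel_bump K_kernel.
have LK0 : 0 <= LK by case: K_bump.
have m2 := mu2_gt0 K_kernel.
set q := quantile eps G alpha in f_gt0 q_taylor *.
pose ft := f t (q t).
pose flo := ft / 2; pose fhi := 2 * ft.
have flo0 : 0 < flo by rewrite divr_gt0.
have fhi0 : 0 < fhi by rewrite mulr_gt0.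
move=> e e0.
pose e3 := e / 3; have e30 : 0 < e3 by rewrite divr_gt0.
have [E0 E00 hE0] := @base_within_prob R d T P eps eps' eps_iid G Fc b alpha t G_meas
  Fc_cond b_gt0 t01 nb_oo b_0 B1 _ e30.
have incr M := @increments_within_prob R d T P eps eps' eps_iid G Fc b alpha t G_meas
  Fc_cond b_gt0 t01 nb_oo b_0 B1 C0 C00 steep M _ e30.
have [E2 E20 hE2] := incr (4 * Lam).
pose C1 := (6 * (LK + BK) + 3 * BK) * (3 * E2 + E0) + 6 * BK * C0 * Lam.
have C10 : 0 <= C1.
  rewrite /C1; apply: addr_ge0; last by rewrite !mulr_ge0// ltW.
  by apply: mulr_ge0; rewrite !addr_ge0 ?mulr_ge0// ?addr_ge0// ltW.
pose M := C1 / flo + C1 / (flo * mu2 K) + 1.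
have M0 : C1 / flo + 1 <= M.
  by rewrite /M addrAC lerDl divr_ge0// ltW// mulr_gt0.
have M1 : C1 / (flo * mu2 K) + 1 <= M.
  by rewrite /M -addrA lerDr divr_ge0// ltW.
(* E1 depends on the radius M, which was fixed by means of E0 and E2 alone *)
have [E1 E10 hE1] := incr (4 * Lam + 5 * M).
pose C2 := Num.max 0 (2 * E1 * (6 * (LK + BK) + 3 * BK) +
  12 * BK * Lf * M * (1 + Lam + 2 * M) + fhi * M * (12 * (LK + BK) + 10 * BK)).
have C20 : 0 <= C2 by rewrite le_max lexx.
have C2' : 2 * E1 * (6 * (LK + BK) + 3 * BK) +
  12 * BK * Lf * M * (1 + Lam + 2 * M) + fhi * M * (12 * (LK + BK) + 10 * BK) <= C2.
  by rewrite le_max lexx orbT.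
have C21 : 0 < 2 * C2 + 1 by rewrite ltr_wpDl// mulr_ge0.
pose A := (2 * C2 + 1) / flo + (2 * C2 + 1) / (flo * mu2 K).
have fm0 : 0 < flo * mu2 K by exact: mulr_gt0.
have A0 : 0 < A by rewrite addr_gt0// divr_gt0.
have hA0 : 2 * C2 < flo * A.
  rewrite /A mulrDr mulrCA divff ?gt_eqF// mulr1.
  apply: (@lt_trans _ _ (2 * C2 + 1)); rewrite ltrDl//.
  by rewrite mulr_gt0// divr_gt0.
have hA1 : 2 * C2 < flo * mu2 K * A.
  rewrite /A mulrDr [X in _ + X]mulrCA divff ?gt_eqF// mulr1.
  apply: (@lt_trans _ _ (2 * C2 + 1)); first by rewrite ltrDl.
  by rewrite ltrDr mulr_gt0// divr_gt0.
exists (fhi * (1 + mu2 K) * A); split; first by rewrite mulr_gt0// mulr_gt0// addr_gt0.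
near=> n.
have reg : regime b n by near: n; exact: near_regime.
have [t_lo t_hi] : n%:R^-1 <= t - 2 * b n /\ t + 2 * b n <= 1.
  by near: n; exact: near_window.
have Ar : A * rate b n <= rho b n by near: n; exact: near_rate_le.
have bf : b n <= flo / (Lf * (1 + 2 * Lam)).
  near: n; apply: near_bandwidth_le => //; rewrite divr_gt0// mulr_gt0//.
  by rewrite ltr_wpDr// mulr_ge0.
have [V0 [mV0 PV0 hV0]] : exists B : set T, [/\ measurable B, (P B <= e3%:E)%E &
    forall w, ~ B w -> base_within eps G b alpha t n w E0] by near: n.
have [V2 [mV2 PV2 hV2]] : exists B : set T, [/\ measurable B, (P B <= e3%:E)%E &
    forall w, ~ B w -> increments_within eps G b alpha t n w (4 * Lam) E2] by near: n.
have [V1 [mV1 PV1 hV1]] : exists B : set T, [/\ measurable B, (P B <= e3%:E)%E &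
    forall w, ~ B w -> increments_within eps G b alpha t n w (4 * Lam + 5 * M) E1] by near: n.
have [bn0 bn1 _ _ _] := reg.
have n0 := regime_n_gt0 reg.
have mV : measurable (V0 `|` (V2 `|` V1)) by apply: measurableU => //; exact: measurableU.
apply: (@le_trans _ _ (P (V0 `|` (V2 `|` V1)))); last first.
  apply: (le_trans (measureU2 _ _ _)) => //; first exact: measurableU.
  have -> : e%:E = (e3%:E + (e3%:E + e3%:E))%E.
    by rewrite -!EFinD; congr EFin; rewrite /e3; field.
  apply: leeD => //; apply: (le_trans (measureU2 _ _ _)) => //; exact: leeD.
rewrite -(measurable_mu_extE P mV); apply: le_mu_ext => w /= big.
apply: contrapT => /not_orP[w0 /not_orP[w2 w1]].
have bound s : window b n t s ->
    enorm (bahadur_remainder eps G f K b alpha Qhat dQhat n s w) <=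
    fhi * (1 + mu2 K) * A * rate b n.
  move=> [/=]; rewrite !in_itv/= => st s01.
  have f_bnd : flo <= f s (q s) <= fhi.
    apply: half_close; apply: le_trans (density_near reg t_lo t_hi Lam0 q_taylor dq_bnd
      Lf0 f_lip s01 st) _.
    by rewrite mulrC -ler_pdivlMr// mulr_gt0// ltr_wpDr// mulr_ge0.
  exact: (remainder_bound eps_iid G_meas f_density alpha01 B3 reg t_lo t_hi Lam0 q_taylor
    dq_lip dq_bnd Lf0 f_lip C00 F_lip K_kernel K_bump s01 st (hat_argmin n s w n0 s01)
    E10 E20 E00 (hV2 w w2) (hV0 w w0) (hV1 w w1) flo0 f_bnd (lexx _) C2' M0 M1 A0 hA0 hA1 Ar).
move: big; apply/negP; rewrite -leNgt gee0_abs.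
  by apply: ub_ereal_sup => _ [s hs <-]; rewrite lee_fin; exact: bound.
apply: (@le_trans _ _ (enorm (bahadur_remainder eps G f K b alpha Qhat dQhat n t w))%:E).
  by rewrite lee_fin sqrtr_ge0.
apply: ereal_sup_ubound; exists t => //; split => /=; rewrite in_itv//=.
by rewrite lerBlDr !lerDl !(ltW bn0).
Unshelve. all: by end_near. Qed.
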